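(* Fix a positive integer $p$ and let $g=g_V$ be the function on $\mathbb{R}^n$ defined in the context, with $V$ distributed Haar randomly and $\epsilon=0.1/\sqrt{k}$. The complexity of $\epsilon$-optimizing the class of functions $g$ is at least: (a) $k$ rounds in the parallel randomized setting where in each round $K=K(n)$ parallel queries to $\mathsf{Q}_g$ are allowed, and $Kn^{-9}\ll 1$ (that is, $Kn^{-9}\to 0$ as $n\to\infty$): any such algorithm using fewer than $k$ rounds outputs an $\epsilon$-optimal point with probability $o(1)$ as $n\to\infty$. (Moreover, by modifying the constants in the definition of the function, $K$ can be allowed to be any polynomial in $n$.) (b) $k$ queries in the quantum setting to get success probability larger than $n^{-4}$: for all sufficiently large $n$, any quantum algorithm making fewer than $k$ queries to $\mathsf{Q}_g$ outputs an $\epsilon$-optimal point with probability at most $n^{-4}$.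
   Context: Norms are $\ell_2$. $B_\eta(x)=\{y\in\mathbb{R}^n:\|y-x\|\le\eta\}$. Parameters: for fixed $p$ and large $n$, $\gamma=40\sqrt{\ln n/n}$, $k=\lfloor(0.1/\gamma)^{2/3}\rfloor$, $\alpha=p+1$, $\rho=\gamma/(100\alpha\ln n)$, $\beta=\gamma/\ln n$. Smoothing: for $f:\mathbb{R}^n\to\mathbb{R}$ and $\eta>0$ let $S_\eta[f](x)=\mathbb{E}_{y\in B_\eta(x)}[f(y)]$ ($y$ uniform in the ball), and $\mathcal{S}[f]=S_{\beta/2^p}[S_{\beta/2^{p-1}}[\cdots S_{\beta/2^2}[S_{\beta/2}[f]]\cdots]]$. Function class: for a list $V=(v_1,\dots,v_k)$ of orthonormal vectors in $\mathbb{R}^n$ define for $i\in[k]=\{1,\dots,k\}$ $$f_i(x)=\rho\ln\Bigl(\sum_{j=1}^{i}\exp\bigl((\langle v_j,x\rangle+(k-j)\gamma)/\rho\bigr)\Bigr)+\rho(k-i)n^{-\alpha},$$ $h(x)=\max_{i\in[k]}f_i(x)$, and $g=\mathcal{S}[h]$. $V$ Haar random means $V$ is uniformly random among ordered $k$-tuples of orthonormal vectors in $\mathbb{R}^n$. Oracle: a query may be made at any point $x\in\mathbb{R}^n$, and $\mathsf{Q}_f(x)=(f(x),\nabla f(x),\dots,\nabla^pf(x))$. An $\epsilon$-optimal point for $g$ is an $\epsilon$-approximate minimum of $g$ in the unit ball $B_1(0)$, which is any $x^*$ that satisfies $g(x^* )-\min_{z\in B_1(0)}g(z)\le\epsilon$.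 A parallel randomized algorithm proceeds in rounds; in each round it submits up to $K$ queries, which may depend on the answers from previous rounds (and internal randomness) but not on answers in the same round. A $t$-query quantum algorithm is a circuit $U_tO_gU_{t-1}O_g\cdots U_1O_gU_0$ applied to a fixed initial state $|0\rangle$ and then measured to obtain the output, where the $U_i$ are arbitrary unitaries independent of $V$ and $O_g$ is a unitary implementation of the oracle, $|x\rangle|b\rangle\mapsto|x\rangle|b\oplus\mathsf{Q}_g(x)\rangle$, supporting queries in superposition, with real numbers represented with any (arbitrarily high) number of bits of precision chosen by the algorithm. Probabilities are over $V$ and the algorithm's randomness (or measurement).
   Formalization: Queries to Q_g are informative only inside the unit ball (outside it the answer is 0), since with informative answers at any point of R^n far random queries reveal the vectors v_j and the bounds fail; an ε-optimal point is required to lie in the unit ball. *)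

(* Defs.v *)
(* MathComp / MathComp-Analysis development, over an arbitrary R : realType. *)
From HB Require Import structures.
From mathcomp Require Import all_boot all_order all_algebra.
From mathcomp Require Import spectral complex.
From mathcomp Require Import all_classical all_reals all_analysis.
Set Implicit Arguments.
Unset Strict Implicit.
Unset Printing Implicit Defensive.
Import Order.TTheory GRing.Theory Num.Theory.
Import numFieldNormedType.Exports.
Local Open Scope classical_set_scope.
Local Open Scope ring_scope.

Section Euclidean.
Context {R : realType}.

Definition dot n (x y : 'rV[R]_n) : R := \sum_i x 0 i * y 0 i.

(* The library norm on 'rV[R]_n is the sup norm; this is the l2 norm. *)
Definition l2norm n (x : 'rV[R]_n) : R := Num.sqrt (dot x x).

Definition l2ball n (x : 'rV[R]_n) (eta : R) : set 'rV[R]_n :=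
  [set y | l2norm (y - x) <= eta].

(* The Lebesgue integral over R^n, as the n-fold iterated integral. *)
Fixpoint leb_int n : ('rV[R]_n -> \bar R) -> \bar R :=
  match n return ('rV[R]_n -> \bar R) -> \bar R with
  | 0%N => fun F => F 0
  | m.+1 => fun F =>
      (\int[@lebesgue_measure R]_t
         leb_int (fun y : 'rV[R]_m => F (row_mx (t%:M : 'rV[R]_1) y)))%E
  end.

(* The expectation of f at a uniform random point of the eta-ball at x. *)
Definition smooth n (eta : R) (f : 'rV[R]_n -> R) (x : 'rV[R]_n) : R :=
  fine (leb_int (fun y => (\1_(l2ball x eta) y * f y)%:E)) /
  fine (leb_int (fun y => (\1_(l2ball x eta) y)%:E)).

(* Innermost radius b / 2, outermost radius b / 2 ^ m. *)
Fixpoint multi_smooth n (b : R) (m : nat) (f : 'rV[R]_n -> R) :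
    'rV[R]_n -> R :=
  if m is m'.+1 then smooth (b / 2 ^+ m) (multi_smooth b m' f) else f.

Fixpoint partials n (s : seq 'I_n) (f : 'rV[R]_n -> R) : 'rV[R]_n -> R :=
  if s is i :: s' then 'D_(delta_mx 0 i) (partials s' f) else f.

End Euclidean.

(* Index set of the entries of (f, nabla f, ..., nabla^p f): an order q <= p
   together with q coordinate directions. *)
Definition jet_index (n p : nat) := {q : 'I_p.+1 & q.-tuple 'I_n}.

Definition jet_size (n p : nat) : nat := #|{: jet_index n p}|.

Section Oracle.
Context {R : realType}.

(* Q_f(x), its entries listed in one vector. *)
Definition jet n (p : nat) (f : 'rV[R]_n -> R) (x : 'rV[R]_n) :
    'rV[R]_(jet_size n p) :=
  \row_a partials (tval (tagged (enum_val a))) f x.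

(* Any point may be queried, but outside the unit ball (the domain of the
   optimization problem) the answer is 0, which carries no information.
   Unrestricted answers would defeat the lower bound: at a random point of huge
   norm the gradient of g_V is, up to an exponentially small error, a uniformly
   chosen v_j. *)
Definition oracle n (p : nat) (f : 'rV[R]_n -> R) (x : 'rV[R]_n) :
    'rV[R]_(jet_size n p) :=
  if l2norm x <= 1 then jet p f x else 0.

(* The minimum over the (compact) unit ball is written as an infimum. *)
Definition eps_optimal n (f : 'rV[R]_n -> R) (eps : R) (x : 'rV[R]_n) : Prop :=
  l2norm x <= 1 /\ f x - inf [set f z | z in l2ball 0 1] <= eps.

End Oracle.

(* c is the leading constant of gamma; the other parameters are those of the
   construction, expressed through gamma. *)
Section Construction.
Context {R : realType}.
Variables (c : R) (p n : nat).

Definition gamma : R := c * Num.sqrt (ln n%:R / n%:R).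
Definition dimk : nat := Num.truncn (((1 / 10) / gamma) `^ (2 / 3)).
Definition alpha : nat := p.+1.
Definition rho : R := gamma / (100 * alpha%:R * ln n%:R).
Definition beta : R := gamma / ln n%:R.
Definition epsilon : R := (1 / 10) / Num.sqrt dimk%:R.

Variable V : 'M[R]_(dimk, n).

(* f_i for 1 <= i <= k.  The ordinal j : 'I_k is 0-based: row j V is the vector
   number j.+1. *)
Definition f_part (i : nat) (x : 'rV[R]_n) : R :=
  rho * ln (\sum_(j < dimk | (j < i)%N)
              expR ((dot (row j V) x + (dimk - j.+1)%:R * gamma) / rho))
  + rho * (dimk - i)%:R * n%:R ^- alpha.

Definition h_fun (x : 'rV[R]_n) : R :=
  \big[Num.max/f_part 1 x]_(1 <= i < dimk.+1) f_part i x.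

Definition g_fun : 'rV[R]_n -> R := multi_smooth beta p h_fun.

End Construction.

(* Real matrices with their Borel sigma-algebra. *)
Definition borel_mx (R : realType) (m n : nat) :=
  g_sigma_algebraType (@open 'M[R]_(m, n)).

Section Haar.
Context {R : realType}.

(* P is the distribution of the rows of a Haar random V: the (unique) law on
   orthonormal k-tuples which is invariant under every rotation of R^n. *)
Definition haar_frame (k n : nat) (P : probability (borel_mx R k n) R) : Prop :=
  P [set V : 'M[R]_(k, n) | V *m V^T = 1%:M] = 1%E /\
  forall O : 'M[R]_n, O *m O^T = 1%:M ->
  forall A : set (borel_mx R k n), measurable A ->
    P [set V : 'M[R]_(k, n) | A (V *m O)] = P A.

End Haar.

Section Parallel.
Context {R : realType}.

(* A parallel randomized algorithm in dimension n, with K queries per round and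
   answers of length N, whose internal randomness is a point of W.  A history
   is the tuple of the answers of the previous rounds, one matrix per round and
   one row per query. *)
Record par_alg (n N K : nat) d (W : measurableType d) := ParAlg {
  par_rounds : nat;
  par_query : forall r : nat,
    W * r.-tuple (borel_mx R K N) -> borel_mx R K n;
  par_output : W * par_rounds.-tuple (borel_mx R K N) -> borel_mx R 1 n;
  par_query_meas : forall r : nat, measurable_fun setT (@par_query r);
  par_output_meas : measurable_fun setT par_output
}.

Arguments par_query {n N K d W} _ {r} _.
Arguments par_output {n N K d W} _ _.

Variables (n N K : nat) (d : measure_display) (W : measurableType d).
Variables (A : par_alg n N K W) (O : 'rV[R]_n -> 'rV[R]_N) (w : W).

Definition par_answers (X : 'M[R]_(K, n)) : 'M[R]_(K, N) :=
  \matrix_(l < K) O (row l X).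

Fixpoint par_history (r : nat) : r.-tuple (borel_mx R K N) :=
  match r return r.-tuple (borel_mx R K N) with
  | 0%N => [tuple]
  | r'.+1 => [tuple of rcons (par_history r')
                (par_answers (par_query A (w, par_history r')))]
  end.

Definition par_run : 'rV[R]_n := par_output A (w, par_history (par_rounds A)).

End Parallel.

(* For the construction with constant c: uniformly over the algorithms with K n
   queries per round and fewer than k rounds, the success probability is o(1).
   The product measure makes V independent of the internal randomness. *)
Definition parallel_lower_bound (R : realType) (c : R) (p : nat)
    (K : nat -> nat) : Prop :=
  forall delta : R, 0 < delta ->
  \forall n \near \oo,
  forall P : probability (borel_mx R (dimk c n) n) R, haar_frame P ->
  forall (d : measure_display) (W : measurableType d) (Q : probability W R)
    (A : par_alg n (jet_size n p) (K n) W),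
  (par_rounds A < dimk c n)%N ->
  ((P \x Q) [set Vw : borel_mx R (dimk c n) n * W |
      let g := g_fun p (Vw.1 : 'M[R]_(dimk c n, n)) in
      eps_optimal g (epsilon c n) (par_run A (oracle p g) Vw.2)]
   <= delta%:E)%E.

(* Fixed-point numbers on m bits, s of them fractional, in two's complement:
   the bit string of the integer z mod 2^m represents z / 2^s. *)
Section FixedPoint.
Context {R : realType}.

Definition nat_of_bits m (b : m.-tuple bool) : nat :=
  (\sum_(i < m) tnth b i * 2 ^ i)%N.

Definition bits_of_nat m (z : nat) : m.-tuple bool :=
  [tuple odd (z %/ 2 ^ i) | i < m].

Definition fixed_decode m (s : nat) (b : m.-tuple bool) : R :=
  let z := nat_of_bits b in
  (z%:R - (if (2 ^ m <= 2 * z)%N then 2 ^+ m else 0)) / 2 ^+ s.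

Definition fixed_encode m (s : nat) (y : R) : m.-tuple bool :=
  bits_of_nat m `|(Num.floor (y * 2 ^+ s) %% (2 ^ m)%N%:Z)%Z|%N.

End FixedPoint.

(* Computational basis states |x>|b>|w>: query, answer and work registers. *)
Definition qbasis (n N min mout work : nat) : finType :=
  (n.-tuple (min.-tuple bool) * N.-tuple (mout.-tuple bool)
   * work.-tuple bool)%type.

Definition qzero n N min mout work : qbasis n N min mout work :=
  ([tuple [tuple false | _ < min] | _ < n],
   [tuple [tuple false | _ < mout] | _ < N],
   [tuple false | _ < work]).

Section Quantum.
Context {R : realType}.

(* A quantum query algorithm, including its choice of precision; only the
   unitaries of index at most qalg_queries are used.  qalg_output is the
   classical reading of the measured basis state. *)
Record quantum_alg (n N : nat) := QuantumAlg {
  qalg_queries : nat;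
  qalg_in_bits : nat;
  qalg_in_frac : nat;
  qalg_out_bits : nat;
  qalg_out_frac : nat;
  qalg_work : nat;
  qalg_basis := qbasis n N qalg_in_bits qalg_out_bits qalg_work;
  qalg_U : nat -> 'M[R[i]]_#|{: qalg_basis}|;
  qalg_unitary : forall i : nat, qalg_U i \is unitarymx;
  qalg_output : qalg_basis -> 'rV[R]_n
}.

Variables (n N : nat) (A : quantum_alg n N) (O : 'rV[R]_n -> 'rV[R]_N).

Definition qoracle_basis (z : qalg_basis A) : qalg_basis A :=
  let: (x, b, w) := z in
  let y := O (\row_i fixed_decode (qalg_in_frac A) (tnth x i)) in
  (x,
   [tuple [tuple tnth (tnth b j) i (+)
             tnth (fixed_encode (qalg_out_bits A) (qalg_out_frac A) (y 0 j)) i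
          | i < qalg_out_bits A] | j < N],
   w).

Definition qoracle : 'M[R[i]]_#|{: qalg_basis A}| :=
  \matrix_(r, s) (enum_val r == qoracle_basis (enum_val s))%:R.

Fixpoint qstate (t : nat) : 'cV[R[i]]_#|{: qalg_basis A}| :=
  match t with
  | 0%N => qalg_U A 0 *m delta_mx (enum_rank (qzero _ _ _ _ _ : qalg_basis A)) 0
  | t'.+1 => qalg_U A t *m (qoracle *m qstate t')
  end.

Definition qprob (z : qalg_basis A) : R :=
  let a := qstate (qalg_queries A) (enum_rank z) 0 in
  complex.Re a ^+ 2 + complex.Im a ^+ 2.

Definition qprob_event (S : set 'rV[R]_n) : R :=
  \sum_(z : qalg_basis A | `[< S (qalg_output z) >]) qprob z.

End Quantum.

(* Main.v *)
Require Import Defs.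
From HB Require Import structures.
From mathcomp Require Import all_boot all_order all_algebra.
From mathcomp Require Import spectral complex.
From mathcomp Require Import all_classical all_reals all_analysis.
From mathcomp Require Import measurable_realfun zify ring lra.
Set Implicit Arguments.
Unset Strict Implicit.
Unset Printing Implicit Defensive.
Import Order.TTheory GRing.Theory Num.Theory.
Import numFieldNormedType.Exports.
Local Open Scope classical_set_scope.
Local Open Scope ring_scope.

(** Write [v_1, ..., v_k] for the rows of the random frame. The proof combines
    three facts.

    Locality. Suppose that a point [x] of the unit ball is nearly orthogonal,
    up to [gamma / 4], to the rows from number [r + 1] on. Near [x] the bonuses
    [(k - j) * gamma] then make every piece [f_i] with [i > r + 1] at most
    [f_(r + 1)], so that [h] is the maximum of [f_1, ..., f_(r + 1)]. The
    smoothing radii add up to less than [beta], which is much smaller than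
    [gamma], hence all derivatives of [g] at [x] only depend on the first
    [r + 1] rows: this is [jet_g_upto]. On the other hand an [epsilon]-optimal
    point has an inner product below [- gamma / 4] with the last row
    ([eps_optimal_dot]), because [g] is about [- 1 / sqrt k] at the normalized
    sum of the [- v_i].

    Concentration. Given the first [r] rows, a later row is uniformly
    distributed on a sphere of dimension about [n - r], so that it is nearly
    orthogonal to any point that depends on the first [r] rows only, except
    with probability about [n ^- 11] for [gamma = 40 * sqrt (ln n / n)]. The law of
    the frame is only known through its invariance under rotations, and the
    conditioning is replaced with neighbourhoods of a given frame
    ([near_rows_tail]): the reflections that fix the first [r] rows of that
    frame preserve both the law and the neighbourhood, and averaging over them
    turns the inner product with a later row into a random signed sum, to which
    the exponential moment method applies. Integrating over the centre of the
    neighbourhood and letting it shrink yields the conditional estimate for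
    closed sets, then for Borel sets ([borel_tail]), and a finite net of the
    ball yields it for random points ([first_rows_tail]).

    Hybrids. Count the rounds from 0, and answer the round [r] with the
    function [g_upto _ (r + 1)], which only uses the first [r + 1] rows. In this
    hybrid the queries of the round [r] are functions of the first [r] rows. By
    concentration and a union bound no query correlates with a later row, except with small probability; then
    by locality the hybrid is the true run, and after fewer than [k] rounds the
    output does not correlate with the last row, hence is not optimal
    ([parallel_success]). For a quantum algorithm the states of the two runs
    are compared. One replaced answer changes the state by at most twice the
    norm of its part on queries that correlate with an unknown row, and unitary
    maps do not amplify this. The mean squared norm of that part is small since
    the amplitudes of the hybrid are functions of the known rows, whereas every
    basis state queries a fixed point ([quantum_success]).

    The events of which probabilities are taken must be measurable. The oracle
    answers contain derivatives of [g]; these exist and are continuous up to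
    the order [p] since each ball average gains one derivative
    ([ball_average_derive], [Ck_multi_smooth]), and they are jointly measurable
    in the frame and the point as functions measurable in one and continuous in
    the other ([measurable_caratheodory]). *)

(** * Borel sets of matrices *)

Section BorelMatrices.
Context {R : realType}.

Lemma open_borel_mx m n (U : set 'M[R]_(m, n)) :
  open U -> measurable (U : set (borel_mx R m n)).
Proof. by move=> oU; apply: sub_sigma_algebra. Qed.

Lemma closed_borel_mx m n (F : set 'M[R]_(m, n)) :
  closed F -> measurable (F : set (borel_mx R m n)).
Proof.
move=> cF; rewrite -[F]setCK; apply: measurableC.
by apply: open_borel_mx; rewrite openC.
Qed.

Lemma continuous_borel_mx m n (f : 'M[R]_(m, n) -> R) :
  continuous f -> measurable_fun [set: borel_mx R m n] f.
Proof.
move=> cf; apply: (measurability _ (RGenOpens.measurableE R)) => /=.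
move=> _ [_ [a [b ->]] <-]; rewrite setTI; apply: open_borel_mx.
by apply: open_comp; [move=> + _; exact: cf|exact: interval_open].
Qed.

Lemma measurable_coord_mx m n i j :
  measurable_fun [set: borel_mx R m n] (fun M : 'M[R]_(m, n) => M i j).
Proof. by apply: continuous_borel_mx; exact: coord_continuous. Qed.

Lemma lt_mx_norm m n (M : 'M[R]_(m, n)) (e : R) : 0 < e ->
  (`|M| < e) <-> (forall i j, `|M i j| < e).
Proof.
move=> e0; have -> : (`|M| < e) = (`|0 - M| < e) by rewrite sub0r normrN.
have -> : (`|0 - M| < e) <-> ball (0 : 'M[R]_(m, n)) e M.
  by rewrite -ball_normE.
split=> [[_ h] i j|h].
  by have := h i j; rewrite -ball_normE /= mxE sub0r normrN.
by split=> // i j; rewrite -ball_normE /= mxE sub0r normrN.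
Qed.

Lemma le_mx_norm m n (M : 'M[R]_(m, n)) (e : R) : 0 <= e ->
  (forall i j, `|M i j| <= e) -> `|M| <= e.
Proof.
move=> e0 h; apply/ler_addgt0Pr => d d0; apply/ltW.
by rewrite lt_mx_norm ?ltr_wpDl// => i j; rewrite (le_lt_trans (h i j))// ltrDl.
Qed.

Lemma coord_le_norm m n (M : 'M[R]_(m, n)) i j : `|M i j| <= `|M|.
Proof.
apply/ler_addgt0Pr => d d0; apply/ltW.
by have /lt_mx_norm : `|M| < `|M| + d; [rewrite ltrDl|apply; rewrite ltr_wpDl].
Qed.

(** A map into matrices is measurable as soon as its entries are: every open
    set is a countable union of balls with rational centre and radius. *)
Lemma measurable_borel_mx d (T : measurableType d) m n
    (f : T -> 'M[R]_(m, n)) :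
  (forall i j, measurable_fun setT (fun x => f x i j)) ->
  measurable_fun setT (f : T -> borel_mx R m n).
Proof.
move=> mf; have H := @measurability _ _ _ (borel_mx R m n) setT f (@open 'M[R]_(m, n)).
apply: H => //.
move=> _ [U oU <-]; rewrite setTI.
pose c (q : 'M[rat]_(m, n) * nat) : 'M[R]_(m, n) := map_mx ratr q.1.
pose I (q : 'M[rat]_(m, n) * nat) := `[< ball (c q) q.2.+1%:R^-1 `<=` U >].
have -> : f @^-1` U =
    \bigcup_q (if I q then f @^-1` ball (c q) q.2.+1%:R^-1 else set0).
  apply/seteqP; split => [x Ux|x [q _]]; last first.
    by case: ifPn => // /asboolP; apply.
  have [e /= e0 eU] : nbhs_ball (f x) U by apply/nbhs_ballP; exact: open_nbhs_nbhs.
  have [k ke] : exists k : nat, k.+1%:R^-1 < e / 2.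
    exists (Num.truncn (e / 2)^-1).
    rewrite -[ltRHS]invrK ltf_pV2 ?posrE ?invr_gt0 ?divr_gt0//.
    by rewrite truncnS_gt.
  have /choice[q /= qP] : forall ij : 'I_m * 'I_n, exists q : rat,
      `|f x ij.1 ij.2 - ratr q| < k.+1%:R^-1.
    move=> [i j] /=.
    have [|q] := @rat_in_itvoo R (f x i j - k.+1%:R^-1) (f x i j + k.+1%:R^-1).
      by rewrite ltrD2l gtrN// invr_gt0.
    rewrite in_itv/= => /andP[q1 q2]; exists q.
    by rewrite ltr_distlC q1.
  exists (\matrix_(i, j) q (i, j), k) => //.
  rewrite /I /=; case: asboolP => [_ /=|].
    split; first by rewrite invr_gt0.
    by move=> i j; rewrite -ball_normE /= !mxE distrC; exact: (qP (i, j)).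
  apply: contra_notP => _ y [_ yq]; apply: eU; split => // i j.
  have := yq i j; rewrite -!ball_normE /= !mxE => h1.
  have h2 := qP (i, j); rewrite /= in h2.
  rewrite -(subrKA (ratr (q (i, j)))) (le_lt_trans (ler_normD _ _))//.
  by rewrite (splitr e) ltrD// (lt_trans _ ke).
apply: countable_bigcupT_measurable => [|q]; first exact: countableP.
case: ifPn => // _.
have -> : f @^-1` ball (c q) q.2.+1%:R^-1 =
    \bigcap_(ij in [set: 'I_m * 'I_n])
       [set x | `|c q ij.1 ij.2 - f x ij.1 ij.2| < q.2.+1%:R^-1].
  apply/seteqP; split => [x [_ h] [i j] _|x h].
    by have := h i j; rewrite -ball_normE.
  by split; [rewrite invr_gt0|move=> i j; rewrite -ball_normE; exact: (h (i, j))].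
apply: fin_bigcap_measurable => // -[i j] _ /=.
rewrite -[X in measurable X]setTI; apply: measurable_fun_ltr => //.
by apply/measurableT_comp => //; apply: measurable_funB.
Qed.

Lemma measurable_entry d (T : measurableType d) m n (f : T -> 'M[R]_(m, n))
    i j :
  measurable_fun setT (f : T -> borel_mx R m n) ->
  measurable_fun setT (fun x => f x i j).
Proof.
by move=> mf; apply: measurableT_comp (@measurable_coord_mx m n i j) mf.
Qed.

End BorelMatrices.

Section Caratheodory.
Context {R : realType} d (T : measurableType d).
Variables m n : nat.

(** Rounding the argument down to the grid of mesh [1 / k.+1] gives a function
    that is measurable by pieces, and continuity makes these converge. *)
Lemma measurable_caratheodory (F : T -> 'M[R]_(m, n) -> R) :
  (forall x, measurable_fun setT (F ^~ x)) ->
  (forall t, continuous (F t)) ->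
  measurable_fun setT (fun z : T * borel_mx R m n => F z.1 z.2).
Proof.
move=> mF cF.
pose grid k (a : 'M[int]_(m, n)) : 'M[R]_(m, n) :=
  \matrix_(i, j) ((a i j)%:~R / k.+1%:R).
pose cell k (x : 'M[R]_(m, n)) : 'M[int]_(m, n) :=
  \matrix_(i, j) Num.floor (x i j * k.+1%:R).
have mcell k a : measurable [set z : T * borel_mx R m n | cell k z.2 = a].
  rewrite [X in measurable X](_ : _ = \bigcap_(ij in [set: 'I_m * 'I_n])
     [set z : T * borel_mx R m n |
        (a ij.1 ij.2)%:~R <= (z.2 : 'M[R]_(m, n)) ij.1 ij.2 * k.+1%:R <
        (a ij.1 ij.2 + 1)%:~R]).
    apply: fin_bigcap_measurable => // -[i j] _ /=.
    rewrite -[X in measurable X]setTI.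
    have mij : measurable_fun setT
        (fun z : T * borel_mx R m n => (z.2 : 'M[R]_(m, n)) i j * k.+1%:R).
      by apply: measurable_funM => //; apply: measurable_entry.
    by apply: measurable_and => //;
      [apply: measurable_fun_ler|apply: measurable_fun_ltr].
  apply/seteqP; split => [z <- [i j] _|z h] /=.
    by rewrite !mxE floor_itv.
  apply/matrixP => i j; rewrite mxE; apply: floor_def.
  by have := h (i, j) Logic.I.
apply: (@measurable_fun_cvg _ _ _ _
  (fun k (z : T * borel_mx R m n) => F z.1 (grid k (cell k z.2)))).
  move=> k _ Y mY; rewrite setTI.
  rewrite [X in measurable X](_ : _ = \bigcup_a
     ([set z : T * borel_mx R m n | cell k z.2 = a] `&`
      ((fun z => F z.1 (grid k a)) @^-1` Y))).
    apply: countable_bigcupT_measurable => [|a]; first exact: countableP.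
    apply: measurableI => //; rewrite -[X in measurable X]setTI.
    by apply: (measurableT_comp (mF (grid k a))).
  apply/seteqP; split => [z /= Yz|z [a _ [/= <-]]//].
  by exists (cell k z.2).
move=> [t x] _ /=; apply: continuous_cvg; first exact: cF.
apply/cvgrPdist_lt => e e0; near=> k.
rewrite lt_mx_norm// => i j; rewrite !mxE.
have k0 : 0 < k.+1%:R :> R by [].
have /andP[h1 h2] := floor_itv (x i j * k.+1%:R).
have : k.+1%:R^-1 < e.
  by near: k; exact: (near_infty_natSinv_lt (PosNum e0)).
apply: le_lt_trans; rewrite ler_distl.
rewrite intrD in h2.
apply/andP; split; rewrite -(ler_pM2r k0) ?mulrBl ?mulrDl divfK ?gt_eqF//.
  by rewrite mulVf ?gt_eqF// (le_trans _ h1) ?gerBl.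
by rewrite mulVf ?gt_eqF// ltW.
Unshelve. all: by end_near. Qed.

End Caratheodory.

Section Regularity.
Context {R : realType} (m n : nat).
Variable mu : {measure set (borel_mx R m n) -> \bar R}.
Hypothesis mufin : (mu setT < +oo)%E.

Let approximable (B : set 'M[R]_(m, n)) := forall e : R, 0 < e ->
  exists C U : set 'M[R]_(m, n), [/\ closed C, open U, C `<=` B, B `<=` U &
    (mu (U `\` C) < e%:E)%E].

Let mufinS (B : set (borel_mx R m n)) : measurable B -> (mu B < +oo)%E.
Proof. by move=> mB; rewrite (le_lt_trans _ mufin)// le_measure ?inE. Qed.

Let shrink (U : set 'M[R]_(m, n)) k : set 'M[R]_(m, n) :=
  [set x | ball x k.+1%:R^-1 `<=` U].

Let closed_shrink U k : closed (shrink U k).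
Proof.
rewrite -openC openE => x /existsNP[y /not_implyP[xy nUy]].
rewrite /interior; move: (xy); rewrite -ball_normE /= => xy'.
apply/nbhs_ballP; exists (k.+1%:R^-1 - `|x - y|); first by rewrite /= subr_gt0.
move=> z; rewrite -ball_normE /= => xz hz; apply: nUy; apply: hz.
rewrite -ball_normE /= -(subrKA x) (le_lt_trans (ler_normD _ _))//.
by rewrite distrC -ltrBrDr.
Qed.

Let open_approx (U : set 'M[R]_(m, n)) : open U -> approximable U.
Proof.
move=> oU e e0.
have mUk k : measurable (U `\` shrink U k : set (borel_mx R m n)).
  apply: measurableD; first exact: open_borel_mx.
  by apply: closed_borel_mx.
have cap0 : \bigcap_k (U `\` shrink U k) = set0.
  apply/seteqP; split => // x h; have [Ux _] := h 0%N Logic.I.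
  have [r /= r0 rU] : nbhs_ball x U by apply/nbhs_ballP; exact: open_nbhs_nbhs.
  have [k kr] : exists k : nat, k.+1%:R^-1 < r.
    near \oo => k; exists k; near: k; exact: (near_infty_natSinv_lt (PosNum r0)).
  have [_] := h k Logic.I; apply => y xy; apply: rU; exact: (le_ball (ltW kr)).
have : mu (U `\` shrink U k) @[k --> \oo] --> (0 : \bar R)%E.
  rewrite -(measure0 mu) -cap0.
  apply: nonincreasing_cvg_mu => //.
  - exact: mufinS.
  - by apply: bigcap_measurable => //; exists 0%N.
  - apply/nonincreasing_seqP => k; apply/subsetPset => x [Ux h]; split => //.
    apply: contra_not h => h y xy; apply: h.
    move: xy; apply: le_ball; by rewrite lef_pV2 ?posrE// ler_nat.
move=> /fine_cvgP[_] /cvgrPdist_lt/(_ _ e0)[k _ /(_ k (leqnn k))/=].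
rewrite sub0r normrN => hk.
exists (shrink U k), U; split => //.
- by move=> x; apply; apply: ballxx.
- rewrite -[X in (X < _)%E]fineK ?lte_fin; last by rewrite ge0_fin_numE ?mufinS.
  exact: le_lt_trans (ler_norm _) hk.
Unshelve. all: by end_near. Qed.

(** The sets that lie between a closed and an open set whose difference has
    small measure form a sigma-algebra; it contains an open set [U] because [U]
    is the increasing union of the closed sets [shrink U k]. *)
Lemma inner_regular_mx (B : set 'M[R]_(m, n)) (e : R) :
  measurable (B : set (borel_mx R m n)) -> 0 < e ->
  exists2 C : set 'M[R]_(m, n), closed C & C `<=` B /\ (mu (B `\` C) < e%:E)%E.
Proof.
move=> mB e0; suff : approximable B.
  move=> /(_ e e0)[C [U [cC oU CB BU h]]]; exists C => //; split => //.
  rewrite (le_lt_trans _ h)// le_measure ?inE//.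
  - by apply: measurableD => //; exact: closed_borel_mx.
  - by apply: measurableD; [exact: open_borel_mx|exact: closed_borel_mx].
  - by move=> x [Bx nC]; split => //; exact: BU.
suff H : <<s @open 'M[R]_(m, n) >> `<=` approximable by exact: H.
move=> {B mB}; apply: smallest_sub => [|U oU]; last exact: open_approx.
split => [|B hB|F hF].
- by apply: open_approx; exact: open0.
- move=> r r0; have [C [U [cC oU CB BU h]]] := hB r r0.
  exists (~` U), (~` C); split.
  + by rewrite closedC.
  + by rewrite openC.
  + by rewrite setTD; exact: subsetC.
  + by rewrite setTD; exact: subsetC.
  + by rewrite setDE setCK setIC -setDE.
- move=> r r0.
  pose ri i : R := r / 2 / (2 ^ i.+1)%:R.
  have ri0 i : 0 < ri i by rewrite !divr_gt0// ltr0n expn_gt0.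
  have /choice[C /choice[U CU]] i := hF i (ri i) (ri0 i).
  pose UU := \bigcup_i U i; pose CC k := \bigcup_(i < k) C i.
  have oUU : open UU by apply: bigcup_open => i _; have [] := CU i.
  have cCC k : closed (CC k).
    by apply: closed_bigcup => // i _; have [] := CU i.
  have mUC i : measurable (U i `\` C i : set (borel_mx R m n)).
    have [cC oU _ _ _] := CU i.
    by apply: measurableD; [exact: open_borel_mx|exact: closed_borel_mx].
  have mUk k : measurable (UU `\` CC k : set (borel_mx R m n)).
    by apply: measurableD; [exact: open_borel_mx|exact: closed_borel_mx].
  have mcap : measurable (\bigcap_k (UU `\` CC k) : set (borel_mx R m n)).
    by apply: bigcap_measurable => //; exists 0%N.
  have capr : (mu (\bigcap_k (UU `\` CC k)) <= (r / 2)%:E)%E.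
    apply: (@le_trans _ _ (\sum_(i <oo) mu (U i `\` C i))%E).
      apply: measure_sigma_subadditive => // x h.
      have [[i _ Ux] _] := h 0%N Logic.I; exists i => //; split => //.
      by move=> Cx; have [_] := h i.+1 Logic.I; apply; exists i => /=.
    apply: le_trans (epsilon_trick0 xpredT (ltW (divr_gt0 r0 _))) => //.
    by apply: lee_nneseries => // i _; apply: ltW; have [] := CU i.
  have : mu (UU `\` CC k) @[k --> \oo] --> mu (\bigcap_k (UU `\` CC k)).
    apply: nonincreasing_cvg_mu => //; first exact: mufinS.
    apply/nonincreasing_seqP => k; apply/subsetPset => x [Ux h]; split => //.
    by apply: contra_not h => -[i ik Cx]; exists i => //=; exact: ltnW.
  have cfin : mu (\bigcap_k (UU `\` CC k)) \is a fin_num.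
    by rewrite ge0_fin_numE ?mufinS.
  rewrite -[X in _ --> X]fineK// => /fine_cvgP[_].
  have r2 : 0 < r / 2 by rewrite divr_gt0.
  move=> /cvgrPdist_lt/(_ _ r2)[k _ /(_ k (leqnn k))/=] hk.
  exists (CC k), UU; split => //.
  + by move=> x [i _ Cx]; exists i => //; have [_ _ + _ _] := CU i; apply.
  + by move=> x [i _ Fx]; exists i => //; have [_ _ _ + _] := CU i; apply.
  + rewrite -[X in (X < _)%E]fineK ?lte_fin; last first.
      by rewrite ge0_fin_numE ?mufinS.
    move: capr; rewrite -[X in (X <= _)%E]fineK// lee_fin => capr.
    rewrite distrC in hk; have := le_lt_trans (ler_norm _) hk.
    by rewrite ltrBlDr [X in _ -> _ < X]splitr => /lt_le_trans; apply; rewrite lerD2l.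
Qed.

End Regularity.

(** * Lebesgue measure on the space of row vectors *)

Section LebesgueRow.
Context {R : realType}.
Notation leb := (@lebesgue_measure R).

Definition cons_row n (z : R * 'rV[R]_n) : 'rV[R]_n.+1 :=
  row_mx (z.1%:M : 'rV[R]_1) z.2.

Definition insert_row n (i : 'I_n.+1) (z : 'rV[R]_n * R) : 'rV[R]_n.+1 :=
  \row_j if unlift i j is Some j' then z.1 0 j' else z.2.

Lemma cons_row0 n (z : R * 'rV[R]_n) : cons_row z 0 ord0 = z.1.
Proof.
rewrite /cons_row (_ : ord0 = lshift n (ord0 : 'I_1)); last exact: val_inj.
by rewrite (row_mxEl (z.1%:M : 'rV[R]_1)) mxE eqxx.
Qed.

Lemma cons_rowS n (z : R * 'rV[R]_n) j : cons_row z 0 (lift ord0 j) = z.2 0 j.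
Proof.
rewrite /cons_row (_ : lift ord0 j = rshift 1 j); last exact: val_inj.
by rewrite (row_mxEr (z.1%:M : 'rV[R]_1)).
Qed.

Lemma insert_row_at n (i : 'I_n.+1) z : insert_row i z 0 i = z.2.
Proof. by rewrite mxE unlift_none. Qed.

Lemma insert_row_lift n (i : 'I_n.+1) z j : insert_row i z 0 (lift i j) = z.1 0 j.
Proof. by rewrite mxE liftK. Qed.

Lemma insert_row_ord0 n y t : insert_row ord0 (y, t) = cons_row (t, y) :> 'rV[R]_n.+1.
Proof.
apply/rowP => j; case: (unliftP ord0 j) => [j'|] ->.
  by rewrite insert_row_lift cons_rowS.
by rewrite insert_row_at cons_row0.
Qed.

Lemma insert_row_cons n (i : 'I_n.+1) s y t :
  insert_row (lift ord0 i) (cons_row (s, y), t) = cons_row (s, insert_row i (y, t)).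
Proof.
apply/rowP => j; case: (unliftP ord0 j) => [j'|] ->; last first.
  rewrite cons_row0 (_ : ord0 = lift (lift ord0 i) ord0) ?insert_row_lift ?cons_row0//.
  exact: val_inj.
rewrite cons_rowS; case: (unliftP i j') => [j''|] ->; last first.
  by rewrite !insert_row_at.
have E : lift ord0 (lift i j'') = lift (lift ord0 i) (lift ord0 j'').
  by apply: val_inj; rewrite /= /bump /=; lia.
by rewrite E insert_row_lift cons_rowS /= insert_row_lift.
Qed.

Lemma measurable_cons_row n :
  measurable_fun setT (@cons_row n : measurableTypeR R * borel_mx R 1 n -> borel_mx R 1 n.+1).
Proof.
apply: measurable_borel_mx => i j; rewrite ord1.
case: (unliftP ord0 j) => [j'|] ->.
  under eq_fun do rewrite cons_rowS.
  by apply: measurable_entry.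
by under eq_fun do rewrite cons_row0; exact: measurable_fst.
Qed.

Lemma measurable_insert_row n (i : 'I_n.+1) :
  measurable_fun setT
    (insert_row i : borel_mx R 1 n * measurableTypeR R -> borel_mx R 1 n.+1).
Proof.
apply: measurable_borel_mx => i' j; rewrite ord1.
case: (unliftP i j) => [j'|] ->.
  under eq_fun do rewrite insert_row_lift.
  by apply: measurable_entry.
by under eq_fun do rewrite insert_row_at; exact: measurable_snd.
Qed.

Section Step.
Variables (n : nat) (mu : {sigma_finite_measure set (borel_mx R 1 n) -> \bar R}).

Definition cons_measure : set (borel_mx R 1 n.+1) -> \bar R :=
  pushforward (leb \x mu)%E
    (@cons_row n : measurableTypeR R * borel_mx R 1 n -> borel_mx R 1 n.+1).

Let mpre (A : set (borel_mx R 1 n.+1)) : measurable A ->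
  measurable ((@cons_row n : measurableTypeR R * borel_mx R 1 n -> borel_mx R 1 n.+1) @^-1` A).
Proof. by move=> mA; rewrite -[X in measurable X]setTI; apply: measurable_cons_row. Qed.

Let cons_measure0 : cons_measure set0 = 0%E.
Proof. by rewrite /cons_measure /pushforward preimage_set0 measure0. Qed.

Let cons_measure_ge0 A : (0 <= cons_measure A)%E.
Proof. by apply: integral_ge0 => t _ /=. Qed.

Let cons_measure_additive : semi_sigma_additive cons_measure.
Proof.
move=> F mF tF mUF; rewrite /cons_measure /pushforward preimage_bigcup.
apply: (@measure_semi_sigma_additive _ _ _ (leb \x mu)%E).
- by move=> k; exact: mpre.
- apply/trivIsetP => /= i j _ _ ij; rewrite -preimage_setI.
  by move/trivIsetP : tF => /(_ _ _ _ _ ij) ->//; rewrite preimage_set0.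
- by have := mpre mUF; rewrite preimage_bigcup.
Qed.

HB.instance Definition _ := isMeasure.Build _ _ _ cons_measure
  cons_measure0 cons_measure_ge0 cons_measure_additive.

Let cons_measure_sigma_finite : sigma_finite setT cons_measure.
Proof.
pose uncons (x : borel_mx R 1 n.+1) : measurableTypeR R * borel_mx R 1 n :=
  (x 0 ord0, \row_j x 0 (lift ord0 j)).
have munc : measurable_fun setT uncons.
  apply: measurable_fun_pair; first exact: measurable_coord_mx.
  apply: measurable_borel_mx => i j.
  by under eq_fun do rewrite mxE; exact: measurable_coord_mx.
have consK : cancel (@cons_row n) uncons.
  case=> t y; rewrite /uncons cons_row0; congr pair.
  by apply/rowP => j; rewrite mxE cons_rowS.
have /sigma_finiteP[F [TF ndF Foo]] := sigma_finiteT leb.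
have /sigma_finiteP[G [TG ndG Goo]] := sigma_finiteT mu.
exists (fun k => uncons @^-1` (F k `*` G k)) => [|k].
  apply/seteqP; split => // x _.
  have [a _ Fa] : (\bigcup_k F k) (uncons x).1 by rewrite -TF.
  have [b _ Gb] : (\bigcup_k G k) (uncons x).2 by rewrite -TG.
  exists (maxn a b) => //; split.
  - by move: Fa; exact/subsetPset/ndF/leq_maxl.
  - by move: Gb; exact/subsetPset/ndG/leq_maxr.
have [mF Fk] := Foo k; have [mG Gk] := Goo k; split.
  by rewrite -[X in measurable X]setTI; apply: munc => //; exact: measurableX.
rewrite /cons_measure /pushforward [X in (_ X < _)%E](_ : _ = F k `*` G k).
  by rewrite product_measure1E// lte_mul_pinfty// ge0_fin_numE.
by apply/funext => z; rewrite /preimage /mkset consK.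
Qed.

HB.instance Definition _ := Measure_isSigmaFinite.Build _ _ _ cons_measure
  cons_measure_sigma_finite.

End Step.

(** A product measure rather than an iterated integral, so that Fubini's theorem
    applies at every level. *)
Fixpoint lebn n : {sigma_finite_measure set (borel_mx R 1 n) -> \bar R} :=
  match n with
  | 0%N => dirac (0 : borel_mx R 1 0)
  | m.+1 => cons_measure (lebn m)
  end.

Lemma integral_indicT d (T : measurableType d) (mu : {measure set T -> \bar R})
    (A : set T) :
  measurable A -> (\int[mu]_x (\1_A x)%:E = mu A)%E.
Proof. by move=> mA; rewrite integral_indic// setIT. Qed.

Lemma lebn_ge0_integralS n (F : borel_mx R 1 n.+1 -> \bar R) :
  measurable_fun setT F -> (forall x, (0 <= F x)%E) ->
  (\int[lebn n.+1]_x F x = \int[leb]_t \int[lebn n]_y F (cons_row (t, y)))%E.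
Proof.
move=> mF F0.
rewrite [LHS](ge0_integral_pushforward (@measurable_cons_row n) (leb \x lebn n)%E)//.
rewrite preimage_setT (fubini_tonelli1 (m1 := leb) (m2 := lebn n)
  (F \o (@cons_row n : measurableTypeR R * borel_mx R 1 n -> borel_mx R 1 n.+1)))//.
  exact: (measurableT_comp mF (@measurable_cons_row n)).
by move=> z; exact: F0.
Qed.

(** By induction on the dimension, the integral over the coordinate [i] moves
    past the integrals over the preceding ones. *)
Lemma lebn_ge0_integral_insert n (i : 'I_n.+1) (F : borel_mx R 1 n.+1 -> \bar R) :
  measurable_fun setT F -> (forall x, (0 <= F x)%E) ->
  (\int[lebn n.+1]_x F x = \int[lebn n]_y \int[leb]_t F (insert_row i (y, t)))%E.
Proof.
have base m (G : borel_mx R 1 m.+1 -> \bar R) :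
    measurable_fun setT G -> (forall x, (0 <= G x)%E) ->
    (\int[lebn m.+1]_x G x =
      \int[lebn m]_y \int[leb]_t G (insert_row ord0 (y, t)))%E.
  move=> mG G0; rewrite lebn_ge0_integralS//.
  rewrite (fubini_tonelli (m1 := leb) (m2 := lebn m) (G \o (@cons_row m :
    measurableTypeR R * borel_mx R 1 m -> borel_mx R 1 m.+1)))//=.
    apply: eq_integral => y _; apply: eq_integral => t _.
    by rewrite insert_row_ord0.
  exact: (measurableT_comp mG (@measurable_cons_row m)).
elim: n => [|n IH] in i F *; move=> mF F0; first by rewrite ord1; exact: base.
case: (unliftP ord0 i) => [i'|] ->; last exact: base.
rewrite lebn_ge0_integralS// [RHS]lebn_ge0_integralS//; first last.
- by move=> y; apply: integral_ge0.
- apply: (measurable_fun_fubini_tonelli_F (m2 := leb)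
    (F \o (insert_row (lift ord0 i') : borel_mx R 1 n.+1 * measurableTypeR R ->
       borel_mx R 1 n.+2))) => //.
    exact: (measurableT_comp mF (measurable_insert_row _)).
  by move=> z; exact: F0.
apply: eq_integral => s _; rewrite (IH i').
- apply: eq_integral => y _; apply: eq_integral => t _.
  by rewrite insert_row_cons.
- apply: measurableT_comp mF _.
  exact: (measurableT_comp (@measurable_cons_row n.+1) (pair1_measurable s)).
- by move=> x.
Qed.

Lemma lebn_insert n (i : 'I_n.+1) (A : set (borel_mx R 1 n.+1)) :
  measurable A ->
  lebn n.+1 A = pushforward (lebn n \x leb)%E
    (insert_row i : borel_mx R 1 n * measurableTypeR R -> borel_mx R 1 n.+1) A.
Proof.
move=> mA; have mI := measurable_insert_row i.
have mpre : measurable ((insert_row i : borel_mx R 1 n * measurableTypeR R ->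
    borel_mx R 1 n.+1) @^-1` A).
  by rewrite -[X in measurable X]setTI; exact: mI.
rewrite -[LHS]integral_indicT// (lebn_ge0_integral_insert i)//; last first.
  by apply/measurable_EFinP; exact: measurable_indic.
rewrite /pushforward -[RHS]integral_indicT//.
rewrite (fubini_tonelli1 (m1 := lebn n) (m2 := leb)
  (EFin \o \1_((insert_row i : borel_mx R 1 n * measurableTypeR R ->
    borel_mx R 1 n.+1) @^-1` A)))//.
  by apply/measurable_EFinP; exact: measurable_indic.
by move=> z; rewrite /= lee_fin.
Qed.

Lemma lebesgue_measure_shift (a : R) (A : set (measurableTypeR R)) :
  measurable A ->
  leb A = pushforward leb (fun t : measurableTypeR R => (a + t : measurableTypeR R)) A.
Proof.
have mf : measurable_fun setT (fun t : measurableTypeR R => (a + t : measurableTypeR R)).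
  by apply: measurable_funD.
move=> mA; pose nu : {measure set (measurableTypeR R) -> \bar R} :=
  measure_function_pushforward__canonical__measure_function_Measure leb mf.
apply: (lebesgue_measure_unique (mu := nu)) => // _ [[x y]] _ <-.
rewrite /nu /= /pushforward.
rewrite [X in _ = leb X](_ : _ = `]x - a, y - a]%classic); last first.
  by apply/seteqP; split => t /=; rewrite !in_itv/= ltrBlDl lerBrDl.
rewrite !lebesgue_measure_itv/= !lte_fin ltrD2r; case: ifPn => // _.
by rewrite !EFinB; rewrite -!EFinB; congr EFin; ring.
Qed.

Lemma lebn_ge0_integral_shift n (a : 'rV[R]_n) (F : borel_mx R 1 n -> \bar R) :
  measurable_fun setT F -> (forall x, (0 <= F x)%E) ->
  (\int[lebn n]_x F (a + x)%R = \int[lebn n]_x F x)%E.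
Proof.
elim: n => [|n IH] in a F *; move=> mF F0.
  by apply: eq_integral => x _; congr F; apply/rowP; case.
have maddn m (b : 'rV[R]_m) : measurable_fun setT
    (fun x : borel_mx R 1 m => (b + x : borel_mx R 1 m)).
  apply: measurable_borel_mx => i j.
  under eq_fun do rewrite mxE.
  by apply: measurable_funD => //; exact: measurable_coord_mx.
pose a' : 'rV[R]_n := \row_j a 0 (lift ord0 j).
have aE t y : a + cons_row (t, y) = cons_row (a 0 ord0 + t, a' + y).
  apply/rowP => j; rewrite mxE; case: (unliftP ord0 j) => [j'|] ->.
    by rewrite !cons_rowS /= !mxE.
  by rewrite !cons_row0.
rewrite lebn_ge0_integralS//; last exact: measurableT_comp mF (maddn _ _).
under eq_integral do under eq_integral do rewrite aE.
rewrite [RHS]lebn_ge0_integralS//.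
have mFt t : measurable_fun setT (fun y : borel_mx R 1 n => F (cons_row (t, y))).
  apply: measurableT_comp mF _.
  exact: (measurableT_comp (@measurable_cons_row n) (pair1_measurable t)).
under eq_integral => t _.
  rewrite (IH a' (fun y => F (cons_row (a 0 ord0 + t, y))) (mFt _))//.
  over.
have mG : measurable_fun setT
    (fun t : measurableTypeR R => (\int[lebn n]_y F (cons_row (t, y)))%E).
  apply: (measurable_fun_fubini_tonelli_F (m2 := lebn n)
    (F \o (@cons_row n : measurableTypeR R * borel_mx R 1 n -> borel_mx R 1 n.+1))).
    exact: (measurableT_comp mF (@measurable_cons_row n)).
  by move=> z; exact: F0.
have mf : measurable_fun setT
    (fun t : measurableTypeR R => (a 0 ord0 + t : measurableTypeR R)).
  by apply: measurable_funD.
rewrite [RHS](eq_measure_integral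
  (measure_function_pushforward__canonical__measure_function_Measure leb mf));
  last first.
  by move=> A mA _; apply: (lebesgue_measure_shift (a 0 ord0)).
rewrite (ge0_integral_pushforward mf leb)//.
by move=> t _; apply: integral_ge0.
Qed.

Lemma lebn_shift n (a : 'rV[R]_n) (A : set (borel_mx R 1 n)) : measurable A ->
  lebn n A = pushforward (lebn n)
    (fun x : borel_mx R 1 n => (a + x : borel_mx R 1 n)) A.
Proof.
move=> mA; rewrite -[LHS]integral_indicT//.
have mf : measurable_fun setT (fun x : borel_mx R 1 n => (a + x : borel_mx R 1 n)).
  apply: measurable_borel_mx => i j.
  under eq_fun do rewrite mxE.
  by apply: measurable_funD => //; exact: measurable_coord_mx.
rewrite -(lebn_ge0_integral_shift a)//; last first.
  by apply/measurable_EFinP; exact: measurable_indic.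
rewrite /pushforward -[RHS]integral_indicT//.
by rewrite -[X in measurable X]setTI; exact: mf.
Qed.

Lemma integrable_bounded_support d (T : measurableType d)
    (mu : {measure set T -> \bar R}) (A : set T) (f : T -> R) (C : R) :
  measurable A -> (mu A < +oo)%E -> measurable_fun setT f ->
  (forall x, `|f x| <= C) -> (forall x, ~ A x -> f x = 0) ->
  mu.-integrable setT (EFin \o f).
Proof.
move=> mA Aoo mf fC f0.
have -> : EFin \o f = (EFin \o f) \_ A.
  apply/funext => x; rewrite patchE; case: ifPn => // /negP xA /=.
  by rewrite f0// => Ax; apply: xA; rewrite inE.
apply/(integrable_mkcond _ mA).1; apply: measurable_bounded_integrable => //.
  exact: measurable_funTS.
by exists C; split => [|M CM]; [exact: num_real|move=> x _ /=; rewrite (le_trans (fC x))// ltW].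
Qed.

Definition cube n (M : R) : set 'rV[R]_n := [set x | forall j, `|x 0 j| <= M].
Arguments cube : clear implicits.

Lemma measurable_cube n M : measurable (cube n M : set (borel_mx R 1 n)).
Proof.
rewrite [X in measurable X](_ : _ = \bigcap_(j in [set: 'I_n])
  [set x : borel_mx R 1 n | `|(x : 'rV[R]_n) 0 j| <= M]).
  apply: fin_bigcap_measurable => // j _; rewrite -[X in measurable X]setTI.
  apply: measurable_fun_ler => //; apply: measurableT_comp => //.
  exact: measurable_coord_mx.
by apply/seteqP; split => x /= h j; [move=> _|]; exact: h.
Qed.

Lemma lebn_cube n (M : R) : 0 <= M -> lebn n (cube n M) = ((M *+ 2) ^+ n)%:E.
Proof.
move=> M0; elim: n => [|n IH].
  by rewrite /= diracE mem_set//= => -[].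
have -> : lebn n.+1 (cube n.+1 M) = (leb \x lebn n)%E (`[- M, M] `*` cube n M).
  rewrite /= /cons_measure /pushforward; congr (_ _).
  apply/seteqP; split => [[t y] h|[t y] []]; rewrite /= ?in_itv/=.
    split; first by have := h ord0; rewrite cons_row0 /= ler_norml.
    by move=> j; have := h (lift ord0 j); rewrite cons_rowS.
  move=> ht hy j.
  case: (unliftP ord0 j) => [j'|] ->; first by rewrite cons_rowS; exact: hy.
  by rewrite cons_row0 ler_norml.
rewrite product_measure1E//; last exact: measurable_cube.
have lebM : leb `[- M, M]%classic = (M *+ 2)%:E.
  rewrite lebesgue_measure_itv/= lte_fin.
  case: (ltrP (- M) M) => hM; first by rewrite -EFinB opprK -mulr2n.
  by have -> : M = 0; [lra|rewrite mul0rn].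
by rewrite [X in (X * _)%E]lebM [X in (_ * X)%E]IH -EFinM exprS.
Qed.

Lemma lebn_cube_fin n M : (lebn n (cube n M) < +oo)%E.
Proof.
have [M0|M0] := leP 0 M; first by rewrite lebn_cube// ltry.
apply: (@le_lt_trans _ _ (lebn n (cube n 0))); last by rewrite lebn_cube// ltry.
rewrite le_measure ?inE//; [exact: measurable_cube|exact: measurable_cube|].
by move=> x h j; rewrite (le_trans (h j))// ltW.
Qed.

(** The iterated integral is the integral for the measure [lebn n], at least for
    bounded functions with bounded support: these are closed under taking
    sections, so that Fubini applies at every level. *)
Lemma leb_intE n (f : 'rV[R]_n -> R) (M C : R) :
  measurable_fun setT (f : borel_mx R 1 n -> R) ->
  (forall x, `|f x| <= C) -> (forall x, ~ cube n M x -> f x = 0) ->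
  leb_int (fun x => (f x)%:E) = (\int[lebn n]_x (f x)%:E)%E.
Proof.
elim: n => [|n IH] in f *; move=> mf fC f0.
  by rewrite /= integral_dirac// ?diracE ?mem_set ?mul1e//; apply/measurable_EFinP.
pose g : measurableTypeR R * borel_mx R 1 n -> R := f \o (@cons_row n).
have mg : measurable_fun setT g.
  exact: (measurableT_comp mf (@measurable_cons_row n)).
have mI : measurable ((@cons_row n : measurableTypeR R * borel_mx R 1 n ->
    borel_mx R 1 n.+1) @^-1` cube n.+1 M).
  rewrite -[X in measurable X]setTI; apply: measurable_cons_row => //.
  exact: measurable_cube.
have gint : (leb \x lebn n)%E.-integrable setT (EFin \o g).
  apply: (integrable_bounded_support mI) => //.
  - exact: (lebn_cube_fin n.+1 M).
  - by move=> z; exact: fC.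
  - by move=> z; exact: f0.
rewrite /= [RHS](integral_pushforward (@measurable_cons_row n)
  (mu := (leb \x lebn n)%E) (D := setT) (f := EFin \o f))//; last first.
  by apply/measurable_EFinP.
rewrite preimage_setT -(integral12_prod_meas1 (m1 := leb) (m2 := lebn n))//.
apply: eq_integral => t _ /=.
apply: (IH (fun y => g (t, y))).
- exact: (measurableT_comp mg (pair1_measurable t)).
- by move=> y; exact: fC.
- move=> y h; apply: f0; apply: contra_not h => h j.
  by have := h (lift ord0 j); rewrite cons_rowS.
Qed.

Lemma lebn_integral_shift n (a : 'rV[R]_n) (f : borel_mx R 1 n -> R) :
  (lebn n).-integrable setT (EFin \o f) ->
  (\int[lebn n]_x (f x)%:E = \int[lebn n]_x (f (a + x)%R)%:E)%E.
Proof.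
move=> fi; have mE := measurable_int _ fi.
have mf : measurable_fun setT (fun x : borel_mx R 1 n => (a + x : borel_mx R 1 n)).
  apply: measurable_borel_mx => i j.
  under eq_fun do rewrite mxE.
  by apply: measurable_funD => //; exact: measurable_coord_mx.
rewrite (eq_measure_integral
  (measure_function_pushforward__canonical__measure_function_Measure (lebn n) mf));
  last by move=> A mA _; exact: lebn_shift.
rewrite [LHS](integral_pushforward mf (mu := lebn n) (f := EFin \o f))//.
apply/integrableP; split; first exact: measurableT_comp mE mf.
rewrite preimage_setT (lebn_ge0_integral_shift a (F := fun x => `|(f x)%:E|%E))//.
  by have /integrableP[] := fi.
exact: measurableT_comp.
Qed.

Lemma lebn_integrable_insert n (i : 'I_n.+1) (f : borel_mx R 1 n.+1 -> R) :
  (lebn n.+1).-integrable setT (EFin \o f) ->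
  (lebn n \x leb)%E.-integrable setT (EFin \o f \o
    (insert_row i : borel_mx R 1 n * measurableTypeR R -> borel_mx R 1 n.+1)).
Proof.
move=> fi; have mE := measurable_int _ fi.
have mEI := measurableT_comp mE (measurable_insert_row i).
apply/integrableP; split => //.
rewrite (fubini_tonelli1 (m1 := lebn n) (m2 := leb)
  (fun z => `|(EFin \o f \o (insert_row i : borel_mx R 1 n * measurableTypeR R ->
     borel_mx R 1 n.+1)) z|%E))//; last exact: measurableT_comp.
rewrite /fubini_F /= -(lebn_ge0_integral_insert i (F := fun x => `|(f x)%:E|%E))//.
  by have /integrableP[] := fi.
exact: measurableT_comp.
Qed.

Lemma lebn_integral_insert n (i : 'I_n.+1) (f : borel_mx R 1 n.+1 -> R) :
  (lebn n.+1).-integrable setT (EFin \o f) ->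
  (\int[lebn n.+1]_x (f x)%:E =
   \int[lebn n]_y \int[leb]_t (f (insert_row i (y, t)))%:E)%E.
Proof.
move=> fi; have mE := measurable_int _ fi.
have mI := measurable_insert_row i.
have fI := lebn_integrable_insert i fi.
rewrite [LHS](eq_measure_integral
  (measure_function_pushforward__canonical__measure_function_Measure
    (lebn n \x leb)%E mI)); last by move=> A mA _; exact: lebn_insert.
rewrite [LHS](integral_pushforward mI (mu := (lebn n \x leb)%E) (f := EFin \o f))//.
by rewrite preimage_setT -(integral12_prod_meas1 (m1 := lebn n) (m2 := leb)).
Qed.

End LebesgueRow.
Arguments cube {R} n M.

Lemma continuous_mxP {R : realType} m n (f : 'M[R]_(m, n) -> R) :
  continuous f <-> forall x e, 0 < e -> exists2 d, 0 < d &
    forall y, `|x - y| < d -> `|f x - f y| < e.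
Proof.
split=> [cf x e e0|h x A /= /(nbhs_ballP (f x))[e /= e0 eA]].
  have /cvgrPdist_lt/(_ e e0)/nbhs_ballP[d /= d0 hd] := cf x.
  by exists d => // y xy; apply: hd; rewrite -ball_normE.
have [r r0 hr] := h x e e0.
apply/nbhs_ballP; exists r => //= y; rewrite -ball_normE /= => xy.
by apply: eA; rewrite -ball_normE /=; exact: hr.
Qed.

(** * Euclidean geometry of row vectors *)

Section EuclideanGeometry.
Context {R : realType}.
Implicit Types n : nat.

Lemma dotE n (x y : 'rV[R]_n) : dot x y = (x *m y^T) 0 0.
Proof. by rewrite mxE; apply: eq_bigr => i _; rewrite mxE. Qed.

Lemma dotC n (x y : 'rV[R]_n) : dot x y = dot y x.
Proof. by apply: eq_bigr => i _; rewrite mulrC. Qed.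

Lemma dotDl n (x y z : 'rV[R]_n) : dot (x + y) z = dot x z + dot y z.
Proof. by rewrite !dotE mulmxDl mxE. Qed.

Lemma dotDr n (x y z : 'rV[R]_n) : dot x (y + z) = dot x y + dot x z.
Proof. by rewrite dotC dotDl !(dotC x). Qed.

Lemma dotZl n c (x y : 'rV[R]_n) : dot (c *: x) y = c * dot x y.
Proof. by rewrite !dotE -scalemxAl mxE. Qed.

Lemma dotZr n c (x y : 'rV[R]_n) : dot x (c *: y) = c * dot x y.
Proof. by rewrite dotC dotZl dotC. Qed.

Lemma dotNl n (x y : 'rV[R]_n) : dot (- x) y = - dot x y.
Proof. by rewrite -scaleN1r dotZl mulN1r. Qed.

Lemma dotNr n (x y : 'rV[R]_n) : dot x (- y) = - dot x y.
Proof. by rewrite dotC dotNl dotC. Qed.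

Lemma dotBl n (x y z : 'rV[R]_n) : dot (x - y) z = dot x z - dot y z.
Proof. by rewrite dotDl dotNl. Qed.

Lemma dotBr n (x y z : 'rV[R]_n) : dot x (y - z) = dot x y - dot x z.
Proof. by rewrite dotDr dotNr. Qed.

Lemma dot0l n (x : 'rV[R]_n) : dot 0 x = 0.
Proof. by rewrite dotE mul0mx mxE. Qed.

Lemma dot0r n (x : 'rV[R]_n) : dot x 0 = 0.
Proof. by rewrite dotC dot0l. Qed.

Lemma dot_suml n I (r : seq I) P (F : I -> 'rV[R]_n) (y : 'rV[R]_n) :
  dot (\sum_(i <- r | P i) F i) y = \sum_(i <- r | P i) dot (F i) y.
Proof. by rewrite dotE mulmx_suml summxE; apply: eq_bigr => i _; rewrite dotE. Qed.

Lemma dot_sumr n I (r : seq I) P (F : I -> 'rV[R]_n) (x : 'rV[R]_n) :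
  dot x (\sum_(i <- r | P i) F i) = \sum_(i <- r | P i) dot x (F i).
Proof. by rewrite dotC dot_suml; apply: eq_bigr => i _; rewrite dotC. Qed.

Lemma dot_ge0 n (x : 'rV[R]_n) : 0 <= dot x x.
Proof. by apply: sumr_ge0 => i _; rewrite -expr2 sqr_ge0. Qed.

Lemma dot_eq0 n (x : 'rV[R]_n) : dot x x = 0 -> x = 0.
Proof.
move=> /eqP; rewrite psumr_eq0; last by move=> i _; rewrite -expr2 sqr_ge0.
move=> /allP h; apply/rowP => i; rewrite mxE; apply/eqP.
by have := h i (mem_index_enum _); rewrite -expr2 sqrf_eq0.
Qed.

Lemma l2norm_ge0 n (x : 'rV[R]_n) : 0 <= l2norm x.
Proof. exact: sqrtr_ge0. Qed.

Lemma l2norm_sqr n (x : 'rV[R]_n) : l2norm x ^+ 2 = dot x x.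
Proof. by rewrite sqr_sqrtr ?dot_ge0. Qed.

Lemma l2norm0 n : l2norm (0 : 'rV[R]_n) = 0.
Proof. by rewrite /l2norm dot0l sqrtr0. Qed.

Lemma l2normN n (x : 'rV[R]_n) : l2norm (- x) = l2norm x.
Proof. by rewrite /l2norm dotNl dotNr opprK. Qed.

Lemma l2norm_le n (x : 'rV[R]_n) r : 0 <= r -> (l2norm x <= r) = (dot x x <= r ^+ 2).
Proof.
by move=> r0; rewrite -l2norm_sqr ler_pXn2r// nnegrE// l2norm_ge0.
Qed.

Lemma cauchy_schwarz n (x y : 'rV[R]_n) : `|dot x y| <= l2norm x * l2norm y.
Proof.
rewrite -ler_sqr ?nnegrE ?mulr_ge0 ?l2norm_ge0// exprMn !l2norm_sqr.
rewrite -normrX ger0_norm ?sqr_ge0//.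
have [y0|y0] := eqVneq (dot y y) 0.
  by rewrite (dot_eq0 y0) !dot0r expr0n mulr0.
have yy : 0 < dot y y by rewrite lt_neqAle eq_sym y0 dot_ge0.
have := dot_ge0 (x - (dot x y / dot y y) *: y).
rewrite dotBl !dotBr !dotZl !dotZr (dotC y x) divfK// subrr subr0 -mulrA mulrC.
by rewrite subr_ge0 -mulrA -expr2 mulrC ler_pdivrMr.
Qed.

Lemma dot_le n (x y : 'rV[R]_n) : dot x y <= l2norm x * l2norm y.
Proof. exact: le_trans (ler_norm _) (cauchy_schwarz x y). Qed.

Lemma l2norm_triangle n (x y : 'rV[R]_n) : l2norm (x + y) <= l2norm x + l2norm y.
Proof.
rewrite l2norm_le ?addr_ge0 ?l2norm_ge0// dotDl !dotDr (dotC y x) sqrrD !l2norm_sqr.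
have := dot_le x y; lra.
Qed.

Lemma l2norm_distC n (x y : 'rV[R]_n) : l2norm (x - y) = l2norm (y - x).
Proof. by rewrite -opprB l2normN. Qed.

Lemma norm_le_l2norm n (x : 'rV[R]_n) : `|x| <= l2norm x.
Proof.
apply: le_mx_norm; first exact: l2norm_ge0.
move=> i j; rewrite ord1 -sqrtr_sqr ler_wsqrtr// /dot (bigD1 j)//= -expr2.
by rewrite lerDl sumr_ge0// => k _; rewrite -expr2 sqr_ge0.
Qed.

Lemma l2norm_le_norm n (x : 'rV[R]_n) : l2norm x <= n%:R * `|x|.
Proof.
rewrite l2norm_le ?mulr_ge0// exprMn.
apply: (@le_trans _ _ (\sum_(i < n) `|x| ^+ 2)).
  apply: ler_sum => i _; rewrite -expr2 -real_normK ?num_real//.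
  by rewrite lerXn2r ?nnegrE// coord_le_norm.
rewrite sumr_const card_ord -[leLHS]mulr_natl ler_wpM2r ?exprn_ge0//.
by rewrite -natrX ler_nat; case: n x => // n x; rewrite leq_pmulr.
Qed.

Lemma l2norm_lip n (x y : 'rV[R]_n) : `|l2norm x - l2norm y| <= l2norm (x - y).
Proof.
rewrite ler_norml; apply/andP; split.
  have := l2norm_triangle (y - x) x; rewrite subrK (l2norm_distC y); lra.
have := l2norm_triangle (x - y) y; rewrite subrK; lra.
Qed.

Lemma continuous_l2dist n (a : 'rV[R]_n) : continuous (fun x : 'rV[R]_n => l2norm (x - a)).
Proof.
apply/continuous_mxP => x e e0; exists (e / n.+1%:R); first by rewrite divr_gt0.
move=> y xy; apply: le_lt_trans (l2norm_lip _ _) _.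
rewrite opprB addrA subrK (le_lt_trans (l2norm_le_norm _))//.
apply: (@le_lt_trans _ _ (n.+1%:R * `|x - y|)).
  by rewrite ler_wpM2r// ler_nat.
by rewrite mulrC -ltr_pdivlMr.
Qed.

Lemma closed_l2ball n (x : 'rV[R]_n) r : closed (l2ball x r).
Proof.
have -> : l2ball x r = (fun y => l2norm (y - x)) @^-1` [set t | t <= r] by [].
apply: preimage_closed; last exact: closed_le.
by move=> y _; exact: continuous_l2dist.
Qed.

Lemma measurable_l2ball n (x : 'rV[R]_n) r :
  measurable (l2ball x r : set (borel_mx R 1 n)).
Proof. by apply: closed_borel_mx; exact: closed_l2ball. Qed.

Lemma l2norm_insert n (i : 'I_n.+1) (y : 'rV[R]_n) t :
  dot (insert_row i (y, t)) (insert_row i (y, t)) = dot y y + t ^+ 2.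
Proof.
rewrite /dot (bigD1_ord i)//= insert_row_at addrC -expr2; congr (_ + _).
by apply: eq_bigr => j _; rewrite insert_row_lift.
Qed.

End EuclideanGeometry.

(** * Smoothing by ball averages *)

Lemma integrable_cst_fin {R : realType} d (T : measurableType d)
    (mu : {measure set T -> \bar R}) (D : set T) (c : R) :
  measurable D -> (mu D < +oo)%E -> mu.-integrable D (EFin \o (fun=> c)).
Proof.
move=> mD Doo; apply: measurable_bounded_integrable => //.
exists `|c|; split => [|N cN u _ /=]; first exact: num_real.
exact: ltW.
Qed.

Section Averages.
Context {R : realType} (n : nat).

Lemma compact_mx_ball (M : R) : compact [set x : 'rV[R]_n | `|x| <= M].
Proof.
apply: bounded_closed_compact.
  by exists M; split => [|N MN x /= xM]; [exact: num_real|rewrite (le_trans xM)// ltW].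
have := @closed_closed_ball_ R 'rV[R]_n 0 M; rewrite /closed_ball_ /=.
by under eq_set do rewrite sub0r normrN.
Qed.

Lemma continuous_bounded_ball (f : 'rV[R]_n -> R) (M : R) :
  continuous f -> exists C, forall x, `|x| <= M -> `|f x| <= C.
Proof.
move=> cf.
have /compact_bounded[C [_ hC]] : compact (f @` [set x | `|x| <= M]).
  apply: continuous_compact; last exact: compact_mx_ball.
  exact: continuous_subspaceT.
exists (C + 1) => x xM; apply: (hC (C + 1)); first by rewrite ltrDl.
by exists x.
Qed.

Lemma uniformly_continuous_ball (f : 'rV[R]_n -> R) (M e : R) :
  continuous f -> 0 < e -> exists2 d, 0 < d &
    forall x y, `|x| <= M -> `|x - y| < d -> `|f x - f y| < e.
Proof.
move=> cf e0.
have /compact_near_coveringP/(_ R (at_right 0)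
   (fun d x => forall y, `|x - y| < d -> `|f x - f y| < e)) H := @compact_mx_ball M.
have [|d /= d0 hd] := H _.
- move=> x _; have e2 : 0 < e / 2 by rewrite divr_gt0.
  have /continuous_mxP/(_ x _ e2)[r r0 hr] := cf.
  exists ([set y | `|x - y| < r / 2], [set d | d < r / 2]) => /=.
    split; last by apply: nbhs_right_lt; rewrite divr_gt0.
    by apply/nbhs_ballP; exists (r / 2); rewrite /= ?divr_gt0// -ball_normE.
  move=> [z d] [/= xz dr] y zy.
  rewrite -(subrKA (f x)) (le_lt_trans (ler_normD _ _))// [e]splitr ltrD//.
    by rewrite distrC; apply: hr; rewrite (lt_trans xz)// ltr_pdivrMr// ltr_pMr// ltr1n.
  apply: hr; rewrite -(subrKA z) (le_lt_trans (ler_normD _ _))// [r]splitr.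
  by rewrite ltrD// (lt_trans zy).
- exists (d / 2); first by rewrite divr_gt0.
  move=> x y xM xy; apply: (hd (d / 2)) => //=; last by rewrite divr_gt0.
  rewrite sub0r normrN gtr0_norm ?divr_gt0//.
  by rewrite ltr_pdivrMr// ltr_pMr// ltr1n.
Qed.

Section Average.
Context d (T : measurableType d) (mu : {measure set T -> \bar R}).
Variables (D : set T) (a : T -> 'rV[R]_n) (M : R).
Hypothesis mD : measurable D.
Hypothesis Doo : (mu D < +oo)%E.
Hypothesis ma : measurable_fun setT (a : T -> borel_mx R 1 n).
Hypothesis aM : forall u, D u -> `|a u| <= M.

(** Translates of [f], averaged over any finite measure: the instances are the
    ball, and the caps of the sphere that appear when the ball is differentiated. *)
Definition average (f : 'rV[R]_n -> R) (x : 'rV[R]_n) : R :=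
  \int[mu]_(u in D) f (x + a u).

Lemma average_integrable (f : 'rV[R]_n -> R) x : continuous f ->
  mu.-integrable D (EFin \o (fun u => f (x + a u))).
Proof.
move=> cf; have [C hC] := continuous_bounded_ball (`|x| + M) cf.
apply: measurable_bounded_integrable => //.
  apply: measurable_funTS.
  have m2 : measurable_fun setT (fun u => x + a u : borel_mx R 1 n).
    apply: measurable_borel_mx => i j; under eq_fun do rewrite mxE.
    by apply: measurable_funD => //; apply: measurable_entry.
  exact: (measurableT_comp (continuous_borel_mx cf) m2).
exists C; split => [|N CN u Du /=]; first exact: num_real.
apply: le_trans (ltW CN); apply: hC.
by rewrite (le_trans (ler_normD _ _))// lerD2l aM.
Qed.

Lemma average_continuous (f : 'rV[R]_n -> R) :
  continuous f -> continuous (average f).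
Proof.
move=> cf; apply/continuous_mxP => x e e0.
have muD : 0 <= fine (mu D) by apply: fine_ge0.
have k0 : 0 < e / (fine (mu D) + 1) by rewrite divr_gt0// ltr_wpDl.
have [r r0 hr] := uniformly_continuous_ball (`|x| + M) cf k0.
exists r => // y xy.
rewrite /average -RintegralB//; [|exact: average_integrable..].
apply: le_lt_trans (le_normr_Rintegral _ _) _ => //.
  have := integrableB mD (average_integrable x cf) (average_integrable y cf).
  by apply: eq_integrable.
apply: (@le_lt_trans _ _ (\int[mu]_(u in D) (e / (fine (mu D) + 1)))).
  apply: le_Rintegral => //.
  - have := integrableB mD (average_integrable x cf) (average_integrable y cf).
    by move=> /integrable_abse; apply: eq_integrable.
  - exact: integrable_cst_fin.
  - move=> u Du; apply/ltW/hr; last by rewrite opprD addrACA subrr addr0.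
    by rewrite (le_trans (ler_normD _ _))// lerD2l aM.
rewrite Rintegral_cst// -mulrA gtr_pMr// mulrC ltr_pdivrMr ?ltr_wpDl//.
by rewrite mul1r ltrDl.
Qed.

End Average.
End Averages.

Section Derivatives.
Context {R : realType} (n : nat).

Lemma line_quotient (f : 'rV[R]_n -> R) (v y : 'rV[R]_n) (h0 : R) :
  (fun h : R => h^-1 *: (((fun t : R => f (t *: v + y)) \o shift h0) (h *: (1 : R))
    - f (h0 *: v + y))) =
  (fun h : R => h^-1 *: ((f \o shift (h0 *: v + y)) (h *: v) - f (h0 *: v + y))).
Proof.
apply/funext => h /=; congr (_ *: (f _ - _)).
by rewrite scalerDl [h *: 1]mulr1 addrA.
Qed.

Lemma derivable_line (f : 'rV[R]_n -> R) (v y : 'rV[R]_n) (h0 : R) :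
  derivable f (h0 *: v + y) v -> derivable (fun t : R => f (t *: v + y)) h0 1.
Proof. by rewrite /derivable line_quotient. Qed.

Lemma derive_line (f : 'rV[R]_n -> R) (v y : 'rV[R]_n) (h0 : R) :
  'D_1 (fun t : R => f (t *: v + y)) h0 = 'D_v f (h0 *: v + y).
Proof. by rewrite /derive line_quotient. Qed.

Section DeriveAverage.
Context d (T : measurableType d) (mu : {measure set T -> \bar R}).
Variables (D : set T) (a : T -> 'rV[R]_n) (M : R).
Hypothesis mD : measurable D.
Hypothesis Doo : (mu D < +oo)%E.
Hypothesis ma : measurable_fun setT (a : T -> borel_mx R 1 n).
Hypothesis aM : forall u, D u -> `|a u| <= M.

Lemma average_derive (f : 'rV[R]_n -> R) (v x : 'rV[R]_n) :
  continuous f -> (forall y, derivable f y v) -> continuous (fun y => 'D_v f y) ->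
  derivable (average mu D a f) x v /\
  'D_v (average mu D a f) x = average mu D a (fun y => 'D_v f y) x.
Proof.
move=> cf df cdf.
have [C hC] := continuous_bounded_ball (`|v| + (`|x| + M)) cdf.
pose F (h : R) u := f (h *: v + (x + a u)).
have FE h : F h = (fun u => f ((h *: v + x) + a u)).
  by apply/funext => u; rewrite /F addrA.
have : h^-1 *: (\int[mu]_(u in D) F (h + 0) u - \int[mu]_(u in D) F 0 u) @[h --> 0^'] -->
    \int[mu]_(u in D) partial1of2 F 0 u.
  apply: (@cvg_differentiation_under_integral _ _ _ mu F D mD 0 (-1) 1 _ _ _
    (fun=> Num.max C 0)).
  - by rewrite /= in_itv/= ltrN10 ltr01.
  - by move=> h _; rewrite FE; exact: (average_integrable mD Doo ma aM).
  - by move=> h u _ _; apply: derivable_line.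
  - by move=> _; rewrite le_max lexx orbT.
  - exact: integrable_cst_fin.
  - move=> h u; rewrite /= in_itv/= => /andP[h1 h2] Du.
    rewrite partial1of2E derive_line le_max hC//.
    rewrite (le_trans (ler_normD _ _))// lerD//.
      by rewrite normrZ ler_piMl// ler_norml !ltW.
    by rewrite (le_trans (ler_normD _ _))// lerD2l aM.
have -> : (fun h : R => h^-1 *: (\int[mu]_(u in D) F (h + 0) u -
      \int[mu]_(u in D) F 0 u)) =
    (fun h : R => h^-1 *: ((average mu D a f \o shift x) (h *: v) -
       average mu D a f x)).
  apply/funext => h /=; congr (_ *: (_ - _)); apply: eq_Rintegral => u _.
    by rewrite /F addr0 addrA.
  by rewrite /F scale0r add0r.
have -> : \int[mu]_(u in D) partial1of2 F 0 u = average mu D a (fun y => 'D_v f y) x.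
  by apply: eq_Rintegral => u _; rewrite partial1of2E derive_line scale0r add0r.
by move=> cv; split; [apply/cvg_ex; eexists; exact: cv|exact: cvg_lim cv].
Qed.

End DeriveAverage.

(** The class C^m, for partial derivatives along the coordinate axes. *)
Fixpoint Ck (m : nat) (f : 'rV[R]_n -> R) : Prop :=
  continuous f /\
  if m is m'.+1 then
    forall i : 'I_n, (forall x, derivable f x (delta_mx 0 i)) /\
      Ck m' (fun x => 'D_(delta_mx 0 i) f x)
  else True.

Lemma Ck_continuous m f : Ck m f -> continuous f.
Proof. by case: m => [|m] []. Qed.

Lemma Ck_partials m (s : seq 'I_n) f : (size s <= m)%N -> Ck m f ->
  Ck (m - size s) (partials s f).
Proof.
elim: s => [|i s IH] /= sm hf; first by rewrite subn0.
have := IH (ltnW sm) hf; rewrite -(prednK (n := m - size s)) ?subn_gt0//.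
by move=> [_ /(_ i)[_]]; rewrite subnS.
Qed.

Lemma derivable_partials m (s : seq 'I_n) i f x : (size s < m)%N -> Ck m f ->
  derivable (partials s f) x (delta_mx 0 i).
Proof.
move=> sm hf; have := Ck_partials (ltnW sm) hf.
by rewrite -(prednK (n := m - size s)) ?subn_gt0// => -[_ /(_ i)[]].
Qed.

Lemma Ck_linear m (c : R) f g : Ck m f -> Ck m g ->
  Ck m (fun x => c * (f x - g x)).
Proof.
have clin (f' g' : 'rV[R]_n -> R) : continuous f' -> continuous g' ->
    continuous (fun x => c * (f' x - g' x)).
  move=> cf cg x; have := continuousB (cf x) (cg x).
  exact: (@continuousM _ _ (fun=> c) _ x (@cst_continuous _ _ c x)).
elim: m f g => [|m IH] f g [cf hf] [cg hg]; first by split => //; exact: clin.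
split=> [|i]; first exact: clin.
have [df hdf] := hf i; have [dg hdg] := hg i.
have E : (fun x => c * (f x - g x)) = c \*: (f - g) by apply/funext.
split=> [x|]; first by rewrite E; apply/derivableZ/derivableB.
rewrite [X in Ck m X](_ : _ = fun x => c * ('D_(delta_mx 0 i) f x - 'D_(delta_mx 0 i) g x)).
  exact: IH.
apply/funext => x; rewrite E deriveZ; last exact: derivableB.
by rewrite deriveB.
Qed.

Lemma Ck_average d (T : measurableType d) (mu : {measure set T -> \bar R})
    (D : set T) (a : T -> 'rV[R]_n) (M : R) m f :
  measurable D -> (mu D < +oo)%E ->
  measurable_fun setT (a : T -> borel_mx R 1 n) ->
  (forall u, D u -> `|a u| <= M) ->
  Ck m f -> Ck m (average mu D a f).
Proof.
move=> mD Doo ma aM; elim: m f => [|m IH] f [cf hf].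
  by split => //; exact: (average_continuous mD Doo ma aM).
split; first exact: (average_continuous mD Doo ma aM).
move=> i; have [df hdf] := hf i.
have H x := average_derive mD Doo ma aM x cf df (Ck_continuous hdf).
split=> [x|]; first by have [] := H x.
rewrite [X in Ck m X](_ : _ = average mu D a (fun x => 'D_(delta_mx 0 i) f x)).
  exact: IH.
by apply/funext => x; have [] := H x.
Qed.

End Derivatives.

Section SegmentIntegral.
Context {R : realType}.
Notation leb := (@lebesgue_measure R).

Let window (q : R -> R) (a z : R) : R := \int[leb]_(t in `[a, z]) q t.

Let window_derive (q : R -> R) (a z : R) : continuous q -> a < z ->
  is_derive z 1 (window q a) (q z).
Proof.
move=> cq az.
have [] := @continuous_FTC1_closed R q a z (z + 1) _ _ az (cq z).
- by rewrite ltrDl.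
- apply: continuous_compact_integrable; first exact: segment_compact.
  exact: continuous_subspaceT.
by move=> dq Eq; apply: DeriveDef => //; rewrite -derive1E.
Qed.

(** The fundamental theorem of calculus, at both ends of a sliding segment. *)
Lemma is_derive_segment (q : R -> R) (s h : R) : continuous q -> 0 <= s ->
  is_derive h 1 (fun h => \int[leb]_(t in `[- s, s]) q (h + t))
    (q (h + s) - q (h - s)).
Proof.
move=> cq s0; pose Q := window q (h - s - 2).
have dQ z : h - s - 2 < z -> is_derive z 1 Q (q z) by exact: window_derive.
have dQs k u : h - s - 2 < k + u -> is_derive k 1 (fun k => Q (k + u)) (q (k + u)).
  move=> ku; have sh : is_derive k (1 : R) (shift u) 1 by exact: is_derive_shift.
  by have := @is_derive1_comp R Q (shift u) k _ _ (dQ _ ku) sh; rewrite mulr1.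
have E k : h - 1 < k -> \int[leb]_(t in `[- s, s]) q (k + t) = Q (k + s) - Q (k - s).
  move=> hk; have [s1|s1] := eqVneq s 0.
    by rewrite s1 oppr0 addr0 subrr set_itv1 /Rintegral integral_set1.
  have s2 : 0 < s by rewrite lt_neqAle eq_sym s1.
  have dF t : -s <= t -> is_derive t 1 (fun t => Q (k + t)) (q (k + t)).
    move=> st; have kt : h - s - 2 < t + k by lra.
    have := dQs t k kt; rewrite (addrC t).
    by under [X in is_derive _ _ X _]eq_fun do rewrite addrC.
  have cF t : -s <= t -> {for t, continuous (fun t => Q (k + t))}.
    move=> st; apply/differentiable_continuous/derivable1_diffP.
    by have [] := dF t st.
  rewrite /Rintegral (@continuous_FTC2 _ _ (fun t => Q (k + t)) (- s) s) //=.
  - lra.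
  - apply: continuous_subspaceT => t; apply: (continuous_comp (f := fun t => k + t)).
      by apply: continuousD; [exact: cst_continuous|exact: cvg_id].
    exact: cq.
  - split => [t||].
    + rewrite in_itv/= => /andP[t1 t2]; have := dF t (ltW t1).
      by move=> [].
    + exact/cvg_at_right_filter/(cF _ (lexx _)).
    + by apply/cvg_at_left_filter/cF; lra.
  - move=> t; rewrite in_itv/= => /andP[t1 t2]; rewrite derive1E.
    by have [] := dF t (ltW t1).
have dE : is_derive h 1 (fun k => Q (k + s) - Q (k - s)) (q (h + s) - q (h - s)).
  apply: is_deriveB; apply: dQs; lra.
apply: (near_eq_is_derive _ dE).
near=> k; rewrite /= E//; near: k.
by apply: lt_nbhsr; lra.
Unshelve. all: by end_near. Qed.

End SegmentIntegral.

Section BallAverage.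
Context {R : realType}.
Notation leb := (@lebesgue_measure R).

Lemma continuous_line n (f : 'rV[R]_n -> R) (v w : 'rV[R]_n) :
  continuous f -> continuous (fun t : R => f (t *: v + w)).
Proof.
move=> cf t; apply: (continuous_comp (f := fun t : R => t *: v + w)); last exact: cf.
apply: continuousD; last exact: cst_continuous.
by apply: continuousZ; [exact: cvg_id|exact: cst_continuous].
Qed.

Lemma l2ball0P n (u : 'rV[R]_n) r : l2ball 0 r u <-> l2norm u <= r.
Proof. by rewrite /l2ball /= subr0. Qed.

Lemma l2ball0_bound n (u : 'rV[R]_n) r : l2ball 0 r u -> `|u| <= r.
Proof. by move=> /l2ball0P; apply: le_trans; exact: norm_le_l2norm. Qed.

Lemma lebn_l2ball_fin n (x : 'rV[R]_n) r : (lebn n (l2ball x r) < +oo)%E.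
Proof.
apply: (@le_lt_trans _ _ (lebn n (cube n (r + `|x|)))); last exact: lebn_cube_fin.
rewrite le_measure ?inE//; [exact: measurable_l2ball|exact: measurable_cube|].
move=> y /= yr j; rewrite (le_trans (coord_le_norm _ _ _))//.
rewrite -(subrK x y) (le_trans (ler_normD _ _))// lerD2r.
exact: le_trans (norm_le_l2norm _) yr.
Qed.

Lemma lebn_l2ball_gt0 n r : 0 < r -> 0 < fine (lebn n (l2ball (0 : 'rV[R]_n) r)).
Proof.
move=> r0; rewrite fine_gt0// lebn_l2ball_fin andbT.
have s0 : 0 < r / n.+1%:R by rewrite divr_gt0.
apply: (@lt_le_trans _ _ (lebn n (cube n (r / n.+1%:R)))).
  by rewrite lebn_cube ?ltW// lte_fin exprn_gt0// mulrn_wgt0.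
rewrite le_measure ?inE//; [exact: measurable_cube|exact: measurable_l2ball|].
move=> y hy; apply/l2ball0P; rewrite (le_trans (l2norm_le_norm _))//.
apply: (@le_trans _ _ (n%:R * (r / n.+1%:R))).
  apply: ler_wpM2l => //; apply: le_mx_norm => [|i j]; first exact: ltW.
  by rewrite ord1; exact: hy.
by rewrite mulrCA ger_pMr// ler_pdivrMr// mul1r ler_nat.
Qed.

Definition ball_average n r := average (lebn n) (l2ball 0 r) (@id 'rV[R]_n).

Lemma ball_average_integrable n r (f : 'rV[R]_n -> R) x : continuous f ->
  (lebn n).-integrable (l2ball 0 r) (EFin \o (fun u => f (x + u))).
Proof.
have mid : measurable_fun setT (id : borel_mx R 1 n -> borel_mx R 1 n).
  exact: measurable_id.
move=> cf; exact: (average_integrable (measurable_l2ball 0 r)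
  (lebn_l2ball_fin 0 r) mid (fun u => @l2ball0_bound n u r) x cf).
Qed.

(** The translation to the ball at the origin makes the domain of integration
    independent of [x]. *)
Lemma smoothE n r (f : 'rV[R]_n -> R) x : continuous f ->
  smooth r f x = ball_average r f x / fine (lebn n (l2ball 0 r)).
Proof.
move=> cf; rewrite /smooth.
have mB y := @measurable_l2ball _ n y r.
have key (g : 'rV[R]_n -> R) : continuous g ->
    fine (leb_int (fun y => (\1_(l2ball x r) y * g y)%:E)) = ball_average r g x.
  move=> cg; pose M := r + `|x|.
  have BM y : l2ball x r y -> `|y| <= M.
    move=> yr; rewrite -(subrK x y) (le_trans (ler_normD _ _))// lerD2r.
    exact: le_trans (norm_le_l2norm _) yr.
  have [C hC] := continuous_bounded_ball M cg.
  have mF : measurable_fun setT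
      (fun y : borel_mx R 1 n => \1_(l2ball x r) y * g y).
    by apply: measurable_funM; [exact: measurable_indic|exact: continuous_borel_mx].
  have FC y : `|\1_(l2ball x r) y * g y| <= Num.max C 0.
    rewrite indicE; case: (boolP (y \in _)) => [/[!inE] yr|_].
      by rewrite mul1r le_max hC// BM.
    by rewrite mul0r normr0 le_max lexx orbT.
  have F0 y : ~ cube n M y -> \1_(l2ball x r) y * g y = 0.
    move=> yM; rewrite indicE; case: (boolP (y \in _)) => [/[!inE] yr|_].
      by exfalso; apply: yM => j; rewrite (le_trans (coord_le_norm _ _ _))// BM.
    by rewrite mul0r.
  rewrite (leb_intE mF FC F0) (lebn_integral_shift x); last first.
    apply: (@integrable_bounded_support R _ _ (lebn n) (cube n M) _ (Num.max C 0)) => //.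
      exact: measurable_cube.
    exact: lebn_cube_fin.
  rewrite /ball_average /average /Rintegral [in RHS]integral_mkcond.
  congr fine; apply: eq_integral => u _; rewrite patchE indicE.
  have -> : (x + u \in l2ball x r) = (u \in l2ball 0 r).
    have BE : l2ball x r (x + u) = l2ball 0 r u.
      by rewrite /l2ball /= subr0 addrAC subrr add0r.
    by apply/idP/idP => /set_mem h; apply/mem_set; move: h; rewrite BE.
  by case: (u \in _) => /=; rewrite ?mul1r ?mul0r.
congr (_ / _); first exact: key.
have c1 : continuous ((fun=> 1) : 'rV[R]_n -> R) by move=> y; exact: cst_continuous.
have := key (fun=> 1) c1.
under eq_fun do rewrite mulr1; move=> ->.
by rewrite /ball_average /average Rintegral_cst// mul1r.
Qed.

Let half_chord n r (y : 'rV[R]_n) : R := Num.sqrt (r ^+ 2 - dot y y).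

Let in_ball_insert n (i : 'I_n.+1) r (y : 'rV[R]_n) t : 0 <= r ->
  l2ball 0 r (insert_row i (y, t)) <->
  l2ball 0 r y /\ t \in `[- half_chord r y, half_chord r y].
Proof.
move=> r0; rewrite !l2ball0P !l2norm_le// l2norm_insert in_itv/= -ler_norml.
have -> : `|t| = Num.sqrt (t ^+ 2) by rewrite sqrtr_sqr.
split=> [h|[yr]].
  have yr : dot y y <= r ^+ 2 by rewrite (le_trans _ h)// lerDl sqr_ge0.
  by split => //; rewrite ler_wsqrtr// lerBrDl.
by rewrite /half_chord ler_sqrt ?subr_ge0// lerBrDl.
Qed.

Let insert_line n (i : 'I_n.+1) (x : 'rV[R]_n.+1) (y : 'rV[R]_n) t :
  x + insert_row i (y, t) = t *: delta_mx 0 i + (x + insert_row i (y, 0)).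
Proof.
apply/rowP => j; rewrite !mxE; case: (unliftP i j) => [j'|] -> /=.
  by rewrite eq_sym (negPf (neq_lift i j')) mulr0 add0r.
by rewrite eqxx mulr1 addr0 addrC.
Qed.

Let chord n (i : 'I_n.+1) r (f : 'rV[R]_n.+1 -> R) (y : 'rV[R]_n) x : R :=
  \int[leb]_(t in `[- half_chord r y, half_chord r y]) f (x + insert_row i (y, t)).

(** The ball is the union of its chords in the direction [i]. *)
Let ball_average_chord n (i : 'I_n.+1) r (f : 'rV[R]_n.+1 -> R) x :
  0 <= r -> continuous f ->
  (lebn n).-integrable (l2ball 0 r) (EFin \o (fun y => chord i r f y x)) /\
  ball_average r f x = \int[lebn n]_(y in l2ball 0 r) chord i r f y x.
Proof.
move=> r0 cf.
pose F (u : borel_mx R 1 n.+1) := \1_(l2ball 0 r) u * f (x + u).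
have FE : (EFin \o (fun u => f (x + u))) \_ (l2ball 0 r) = EFin \o F.
  apply/funext => u; rewrite patchE /F /= indicE.
  by case: (u \in _); rewrite ?mul1r ?mul0r.
have Fi : (lebn n.+1).-integrable setT (EFin \o F).
  rewrite -FE; apply/(integrable_mkcond _ (measurable_l2ball 0 r)).1.
  exact: (ball_average_integrable r x cf).
have inner y : (\int[leb]_t (F (insert_row i (y, t)))%:E)%E =
    ((fun y => (chord i r f y x)%:E) \_ (l2ball 0 r)) y.
  rewrite patchE; case: ifPn => [/[!inE] yr|yr]; last first.
    apply: integral0_eq => t _; rewrite /F indicE memNset ?mul0r//.
    by move=> /(in_ball_insert i y t r0)[yb _]; move/negP: yr; apply; exact/mem_set.
  rewrite /chord /Rintegral fineK; last first.
    apply: integrable_fin_num => //.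
    apply: continuous_compact_integrable; first exact: segment_compact.
    apply: continuous_subspaceT => t.
    under eq_fun do rewrite insert_line.
    exact: continuous_line.
  rewrite [RHS]integral_mkcond; apply: eq_integral => t _.
  rewrite patchE /F indicE.
  have -> : (insert_row i (y, t) \in l2ball 0 r) =
      (t \in [set` `[- half_chord r y, half_chord r y]]).
    apply/idP/idP; rewrite !inE => h; first by case/(in_ball_insert i y t r0) : h.
    by apply/(in_ball_insert i y t r0).
  by case: (t \in _); rewrite ?mul1r ?mul0r.
split.
  apply/(integrable_mkcond _ (measurable_l2ball 0 r)).2.
  have mI := measurable_insert_row i.
  have fI : (lebn n \x leb)%E.-integrable setT (EFin \o F \o
    (insert_row i : borel_mx R 1 n * measurableTypeR R -> borel_mx R 1 n.+1)).
    exact: lebn_integrable_insert.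
  have := integrable_fubini_F (m1 := lebn n) (m2 := leb) fI.
  by apply: eq_integrable => // y _; rewrite -inner.
rewrite /ball_average /average /Rintegral integral_mkcond.
rewrite [X in fine (integral _ _ X)]FE.
rewrite (lebn_integral_insert i Fi) [in RHS]integral_mkcond; congr fine.
by apply: eq_integral => y _; exact: inner.
Qed.

Let half_chord_le n r (y : 'rV[R]_n) : 0 <= r -> half_chord r y <= r.
Proof.
move=> r0; rewrite -[leRHS]ger0_norm// -sqrtr_sqr ler_wsqrtr//.
by rewrite gerBl dot_ge0.
Qed.

Let measurable_half_chord n r :
  measurable_fun setT (fun y : borel_mx R 1 n => half_chord r y).
Proof.
have E y : half_chord r y = Num.sqrt (r ^+ 2 - l2norm (y - (0 : 'rV[R]_n)) ^+ 2).
  by rewrite subr0 l2norm_sqr.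
under eq_fun do rewrite E.
have ms : measurable_fun setT (@Num.sqrt R).
  by apply: continuous_measurable_fun; exact: sqrt_continuous.
have mn : measurable_fun setT
    (fun y : borel_mx R 1 n => r ^+ 2 - l2norm (y - (0 : 'rV[R]_n)) ^+ 2).
  apply: measurable_funB => //; apply: measurable_funX.
  exact: (continuous_borel_mx (@continuous_l2dist R n 0)).
exact: (measurableT_comp ms mn).
Qed.

(** The end points of the chords of the ball in direction [i], over the shadow
    of the ball in the coordinate hyperplane. *)
Let endpoint n (i : 'I_n.+1) (c r : R) (y : 'rV[R]_n) : 'rV[R]_n.+1 :=
  insert_row i (y, c * half_chord r y).

Let measurable_endpoint n (i : 'I_n.+1) c r :
  measurable_fun setT (endpoint i c r : borel_mx R 1 n -> borel_mx R 1 n.+1).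
Proof.
apply: (measurableT_comp (@measurable_insert_row R n i)).
apply: measurable_fun_pair => //.
by apply: measurable_funM => //; exact: measurable_half_chord.
Qed.

Let endpoint_bound n (i : 'I_n.+1) c r (y : 'rV[R]_n) :
  0 <= r -> `|c| = 1 -> l2ball 0 r y -> `|endpoint i c r y| <= r.
Proof.
move=> r0 c1 yr; apply: le_mx_norm => // i' j; rewrite ord1.
case: (unliftP i j) => [j'|] ->.
  by rewrite insert_row_lift (le_trans (coord_le_norm _ _ _))//; exact: l2ball0_bound.
rewrite insert_row_at /= normrM c1 mul1r ger0_norm ?sqrtr_ge0//.
exact: half_chord_le.
Qed.

(** When the ball moves in the direction [i], each of its chords slides along
    itself. The rate of change only involves values of [f] on the sphere, not its
    derivatives, which is why averaging gains one derivative. *)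
Lemma ball_average_derive n (i : 'I_n.+1) r (f : 'rV[R]_n.+1 -> R) x :
  0 <= r -> continuous f ->
  let cap c := average (lebn n) (l2ball 0 r) (endpoint i c r) f in
  derivable (ball_average r f) x (delta_mx 0 i) /\
  'D_(delta_mx 0 i) (ball_average r f) x = cap 1 x - cap (-1) x.
Proof.
move=> r0 cf cap; set v : 'rV[R]_n.+1 := delta_mx 0 i.
have [C hC] := continuous_bounded_ball (`|v| + (`|x| + r)) cf.
pose F (h : R) y := chord i r f y (h *: v + x).
have mD := @measurable_l2ball R n 0 r.
have Doo := @lebn_l2ball_fin n 0 r.
have dF (h : R) (y : 'rV[R]_n) : is_derive h (1 : R) (F ^~ y)
    (f (h *: v + x + endpoint i 1 r y) - f (h *: v + x + endpoint i (-1) r y)).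
  pose q t := f (t *: v + (x + insert_row i (y, 0))).
  have cq : continuous q by exact: continuous_line.
  have E k t : f (k *: v + x + insert_row i (y, t)) = q (k + t).
    by rewrite /q (insert_line i _ y t) -/v scalerDl -!addrA; congr f; exact: addrCA.
  have := is_derive_segment h cq (sqrtr_ge0 (r ^+ 2 - dot y y)).
  rewrite -!E -/(half_chord r y) /endpoint mul1r mulN1r.
  by under [X in is_derive _ _ X _]eq_fun do
    (under eq_Rintegral do rewrite -E).
have capC c h u : `|c| = 1 -> `|h| <= 1 -> l2ball 0 r u ->
    `|f (h *: v + x + endpoint i c r u)| <= C.
  move=> c1 h1 Du; apply: hC.
  rewrite -addrA (le_trans (ler_normD _ _))// lerD ?normrZ ?ler_piMl//.
  by rewrite (le_trans (ler_normD _ _))// lerD2l endpoint_bound.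
have : h^-1 *: (\int[lebn n]_(y in l2ball 0 r) F (h + 0) y -
      \int[lebn n]_(y in l2ball 0 r) F 0 y) @[h --> 0^'] -->
    \int[lebn n]_(y in l2ball 0 r) partial1of2 F 0 y.
  apply: (@cvg_differentiation_under_integral _ _ _ (lebn n) F (l2ball 0 r) mD 0 (-1) 1
    _ _ _ (fun=> Num.max (C + C) 0)).
  - by rewrite /= in_itv/= ltrN10 ltr01.
  - by move=> h _; have [] := ball_average_chord i (h *: v + x) r0 cf.
  - by move=> h y _ _; have [] := dF h y.
  - by move=> _; rewrite le_max lexx orbT.
  - exact: integrable_cst_fin.
  - move=> h u; rewrite /= in_itv/= => /andP[h1 h2] Du.
    have hh : `|h| <= 1 by rewrite ler_norml !ltW.
    rewrite partial1of2E (@derive_val _ _ _ _ _ _ _ (dF h u)) le_max.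
    apply/orP; left; apply: le_trans (ler_normB _ _) _.
    by apply: lerD; apply: capC => //; rewrite ?normrN1 ?normr1.
have -> : (fun h : R => h^-1 *: (\int[lebn n]_(y in l2ball 0 r) F (h + 0) y -
      \int[lebn n]_(y in l2ball 0 r) F 0 y)) =
    (fun h : R => h^-1 *: ((ball_average r f \o shift x) (h *: v) -
       ball_average r f x)).
  apply/funext => h /=; congr (_ *: (_ - _)).
    by have [_ ->] := ball_average_chord i (h *: v + x) r0 cf; rewrite /F addr0.
  by have [_ ->] := ball_average_chord i x r0 cf; rewrite /F scale0r add0r.
have -> : \int[lebn n]_(y in l2ball 0 r) partial1of2 F 0 y = cap 1 x - cap (-1) x.
  rewrite /cap /average -RintegralB//.
  - apply: eq_Rintegral => y _; rewrite partial1of2E (@derive_val _ _ _ _ _ _ _ (dF 0 y)).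
    by rewrite scale0r add0r.
  - apply: (average_integrable mD Doo (measurable_endpoint i 1 r) (M := r)) => // u Du.
    by apply: endpoint_bound => //; rewrite normr1.
  - apply: (average_integrable mD Doo (measurable_endpoint i (-1) r) (M := r)) => // u Du.
    by apply: endpoint_bound => //; rewrite normrN1.
by move=> cv; split; [apply/cvg_ex; eexists; exact: cv|exact: cvg_lim cv].
Qed.

Lemma Ck_ball_average n r m (f : 'rV[R]_n -> R) : 0 <= r ->
  Ck m f -> Ck m.+1 (ball_average r f).
Proof.
move=> r0 hf; have cf := Ck_continuous hf.
have mid : measurable_fun setT (id : borel_mx R 1 n -> borel_mx R 1 n).
  exact: measurable_id.
have mD := @measurable_l2ball R n 0 r.
have Doo := @lebn_l2ball_fin n 0 r.
split; first exact: (average_continuous mD Doo mid (fun u => @l2ball0_bound n u r)).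
case: n f hf cf mid mD Doo => [|n] f hf cf mid mD Doo i; first by case: i.
have H x := ball_average_derive i x r0 cf.
split=> [x|]; first by have [] := H x.
have mD' := @measurable_l2ball R n 0 r.
have Doo' := @lebn_l2ball_fin n 0 r.
pose cap c := average (lebn n) (l2ball 0 r) (endpoint i c r) f.
rewrite [X in Ck m X](_ : _ = fun x => 1 * (cap 1 x - cap (-1) x)); last first.
  by apply/funext => x; have [_ ->] := H x; rewrite mul1r.
apply: Ck_linear; apply: (Ck_average mD' Doo' (measurable_endpoint i _ r) (M := r)) => //.
  by move=> u Du; apply: endpoint_bound => //; rewrite normr1.
by move=> u Du; apply: endpoint_bound => //; rewrite normrN1.
Qed.

Lemma Ck_smooth n r m (f : 'rV[R]_n -> R) : 0 <= r ->
  Ck m f -> Ck m.+1 (smooth r f).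
Proof.
move=> r0 hf; have cf := Ck_continuous hf.
have h0 : Ck m.+1 ((fun=> 0) : 'rV[R]_n -> R).
  elim: m.+1 => [|k IH].
    by split => // y; exact: cst_continuous.
  split=> [y|i]; first exact: cst_continuous.
  split=> [y|]; first exact: derivable_cst.
  rewrite [X in Ck k X](_ : _ = fun=> 0)//.
  by apply/funext => y; exact: derive_cst.
rewrite [X in Ck _ X](_ : _ = fun x =>
  (fine (lebn n (l2ball 0 r)))^-1 * (ball_average r f x - 0)).
  by apply: Ck_linear => //; exact: Ck_ball_average.
by apply/funext => x; rewrite smoothE// subr0 mulrC.
Qed.

Lemma Ck_multi_smooth n b m (f : 'rV[R]_n -> R) : 0 <= b ->
  continuous f -> Ck m (multi_smooth b m f).
Proof.
move=> b0 cf; elim: m => [|m IH] //=.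
by apply: Ck_smooth => //; rewrite divr_ge0// exprn_ge0.
Qed.

End BallAverage.

Section SmoothOrder.
Context {R : realType} (n : nat).
Implicit Types f g : 'rV[R]_n -> R.

Lemma smooth_local r f g x :
  (forall y, l2norm (y - x) <= r -> f y = g y) -> smooth r f x = smooth r g x.
Proof.
move=> fg; rewrite /smooth; congr (fine (leb_int _) / _).
apply/funext => y; rewrite indicE; case: (boolP (y \in _)) => [/set_mem yr|_].
  by rewrite fg.
by rewrite !mul0r.
Qed.

Lemma smooth_le r f g c x : 0 < r -> continuous f -> continuous g ->
  (forall y, l2norm (y - x) <= r -> f y <= g y + c) ->
  smooth r f x <= smooth r g x + c.
Proof.
move=> r0 cf cg fg; rewrite !smoothE// -lerBlDl -mulrBl.
have vol0 := @lebn_l2ball_gt0 R n r r0.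
have mD := @measurable_l2ball R n 0 r.
have Doo := @lebn_l2ball_fin R n 0 r.
have fi := ball_average_integrable r x cf.
have gi := ball_average_integrable r x cg.
rewrite ler_pdivrMr// /ball_average /average -RintegralB// -Rintegral_cst//.
apply: le_Rintegral => //.
- by have := integrableB mD fi gi; apply: eq_integrable.
- exact: integrable_cst_fin.
- move=> u /l2ball0P ur; rewrite lerBlDl; apply: fg.
  by rewrite [x + u]addrC addrK.
Qed.

(** The radii [b / 2 ^ i] of the successive averages add up to less than [b]. *)
Lemma multi_smooth_radius (b : R) m (x z y : 'rV[R]_n) :
  l2norm (z - x) <= b / 2 ^+ m.+1 -> l2norm (y - z) <= b * (1 - 2 ^- m) ->
  l2norm (y - x) <= b * (1 - 2 ^- m.+1).
Proof.
move=> zx yz; rewrite -(subrKA z) (le_trans (l2norm_triangle _ _))//.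
apply: le_trans (lerD yz zx) _; rewrite -mulrDr.
have -> : 1 - 2 ^- m + 2 ^- m.+1 = 1 - 2 ^- m.+1 :> R.
  by rewrite exprS invfM; lra.
exact: lexx.
Qed.

Lemma multi_smooth_local b m f g x :
  (forall y, l2norm (y - x) <= b * (1 - 2 ^- m) -> f y = g y) ->
  multi_smooth b m f x = multi_smooth b m g x.
Proof.
elim: m x => [|m IH] x fg /=.
  by apply: fg; rewrite subrr l2norm0 expr0 invr1 subrr mulr0.
apply: smooth_local => z zx; apply: IH => y yz; apply: fg.
exact: multi_smooth_radius yz.
Qed.

Lemma multi_smooth_le b m f g c x : 0 < b -> continuous f -> continuous g ->
  (forall y, l2norm (y - x) <= b * (1 - 2 ^- m) -> f y <= g y + c) ->
  multi_smooth b m f x <= multi_smooth b m g x + c.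
Proof.
move=> b0 cf cg; elim: m x => [|m IH] x fg /=.
  by apply: fg; rewrite subrr l2norm0 expr0 invr1 subrr mulr0.
apply: smooth_le => [||| z zx].
- by rewrite divr_gt0// exprn_gt0.
- exact: Ck_continuous (Ck_multi_smooth m (ltW b0) cf).
- exact: Ck_continuous (Ck_multi_smooth m (ltW b0) cg).
- apply: IH => y yz; apply: fg; exact: multi_smooth_radius yz.
Qed.

Let continuous0 : continuous ((fun=> 0) : 'rV[R]_n -> R).
Proof. by move=> y; exact: cst_continuous. Qed.

Let multi_smooth0 b m x : multi_smooth b m ((fun=> 0) : 'rV[R]_n -> R) x = 0.
Proof.
elim: m x => [//|m IH] x /=.
rewrite (_ : multi_smooth b m _ = fun=> 0); last exact/funext.
rewrite smoothE// /ball_average /average Rintegral_cst ?mul0r//.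
exact: measurable_l2ball.
Qed.

Let radius_le (b : R) m : 0 < b -> b * (1 - 2 ^- m) <= b.
Proof. by move=> b0; rewrite ger_pMr// gerBl invr_ge0 exprn_ge0. Qed.

Lemma multi_smooth_le_cst b m f c x : 0 < b -> continuous f ->
  (forall y, l2norm (y - x) <= b -> f y <= c) -> multi_smooth b m f x <= c.
Proof.
move=> b0 cf fc; have := @multi_smooth_le b m f (fun=> 0) c x b0 cf continuous0.
rewrite multi_smooth0 add0r; apply=> y yx; apply: fc.
exact: le_trans yx (radius_le m b0).
Qed.

Lemma multi_smooth_ge_cst b m f c x : 0 < b -> continuous f ->
  (forall y, l2norm (y - x) <= b -> c <= f y) -> c <= multi_smooth b m f x.
Proof.
move=> b0 cf fc.
have := @multi_smooth_le b m (fun=> 0) f (- c) x b0 continuous0 cf.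
rewrite multi_smooth0 subr_ge0; apply=> y yx; rewrite subr_ge0; apply: fc.
exact: le_trans yx (radius_le m b0).
Qed.

Lemma multi_smooth_near b m f g (x : 'rV[R]_n) : 0 < b ->
  (forall y, l2norm (y - x) <= b *+ 2 -> f y = g y) ->
  \forall z \near x, multi_smooth b m f z = multi_smooth b m g z.
Proof.
move=> b0 fg; apply/nbhs_ballP; exists (b / n.+1%:R); first by rewrite /= divr_gt0.
move=> z; rewrite -ball_normE /= => xz.
apply: multi_smooth_local => y yz; apply: fg.
rewrite -(subrKA z) (le_trans (l2norm_triangle _ _))// mulr2n lerD//.
  exact: le_trans yz (radius_le m b0).
rewrite l2norm_distC (le_trans (l2norm_le_norm _))//.
apply: (@le_trans _ _ (n.+1%:R * `|x - z|)); first by rewrite ler_wpM2r// ler_nat.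
by rewrite mulrC -ler_pdivlMr// ltW.
Qed.

Lemma partials_near s f g (x : 'rV[R]_n) :
  (\forall z \near x, f z = g z) -> \forall z \near x, partials s f z = partials s g z.
Proof.
elim: s => [//|i s IH] /= fg; have := nbhs_interior (IH fg).
apply: filterS => z hz; apply: near_eq_derive => //.
Qed.

Lemma jet_near p f g (x : 'rV[R]_n) : (\forall z \near x, f z = g z) -> jet p f x = jet p g x.
Proof.
move=> fg; apply/rowP => a; rewrite !mxE.
exact: nbhs_singleton (partials_near _ fg).
Qed.

End SmoothOrder.

(** * The hard function *)

Lemma row_dot {R : realType} k n (V : 'M[R]_(k, n)) i j :
  dot (row i V) (row j V) = (V *m V^T) i j.
Proof. by rewrite mxE; apply: eq_bigr => l _; rewrite !mxE. Qed.

Section HardFunction.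
Context {R : realType}.
Variables (c : R) (p n : nat).
Local Notation k := (dimk c n).
Local Notation gam := (gamma c n).
Local Notation rho := (@rho R c p n).
Local Notation bet := (beta c n).
Implicit Types V : 'M[R]_(k, n).

(** In contrast with [h_fun], this only depends on the first [r] rows: it is what
    an algorithm can know after [r] rounds. *)
Definition h_upto V (r : nat) (x : 'rV[R]_n) : R :=
  \big[Num.max/f_part p V 1 x]_(1 <= i < r.+1) f_part p V i x.

Definition g_upto V (r : nat) : 'rV[R]_n -> R := multi_smooth bet p (h_upto V r).

Lemma h_uptoP V r x a : (0 < r)%N ->
  h_upto V r x <= a <-> forall i, (0 < i <= r)%N -> f_part p V i x <= a.
Proof.
move=> r0; rewrite /h_upto big_nat_cond; split=> [h i ir|h].
  apply: le_trans h; rewrite -big_nat_cond.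
  apply: (@le_bigmax_seq _ R _ (index_iota 1 r.+1) (f_part p V 1 x) i xpredT
    (fun i => f_part p V i x)) => //.
  by rewrite mem_index_iota ltnS.
apply: (big_ind (fun y => y <= a)) => [|y z ya za|i /andP[]]; first by apply: h; rewrite r0.
  by rewrite ge_max ya za.
by rewrite ltnS => ir _; apply: h.
Qed.

Lemma f_part_le_h_upto V r i x : (0 < i <= r)%N -> f_part p V i x <= h_upto V r x.
Proof.
by move=> ir; apply: (@h_uptoP V r x (h_upto V r x) _).1 => //; case/andP: ir; lia.
Qed.

Section Positive.
Hypothesis k0 : (0 < k)%N.
Hypothesis rho0 : 0 < rho.

Let expo V (j : 'I_k) (x : 'rV[R]_n) : R :=
  expR ((dot (row j V) x + (k - j.+1)%:R * gam) / rho).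

Lemma f_part_sum_gt0 V i x : (0 < i)%N ->
  0 < \sum_(j < k | (j < i)%N) expo V j x.
Proof.
move=> i0; rewrite (bigD1 (Ordinal k0))//= ltr_pwDl ?expR_gt0//.
by apply: sumr_ge0 => j _; exact: expR_ge0.
Qed.

Lemma f_part_le V V' i x x' e : (0 < i)%N ->
  (forall j : 'I_k, (j < i)%N -> dot (row j V) x <= dot (row j V') x' + e) ->
  f_part p V i x <= f_part p V' i x' + e.
Proof.
move=> i0 h; rewrite /f_part addrAC lerD2r.
have -> : e = rho * (e / rho) by rewrite mulrC divfK// gt_eqF.
rewrite -mulrDr ler_pM2l// -[e / rho]expRK -lnM ?posrE ?expR_gt0 ?f_part_sum_gt0//.
rewrite ler_ln ?posrE ?mulr_gt0 ?expR_gt0 ?f_part_sum_gt0//.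
rewrite mulrC mulr_sumr; apply: ler_sum => j ji; rewrite -expRD ler_expR.
by rewrite -mulrDl ler_pM2r ?invr_gt0// addrA lerD2r addrC h.
Qed.

Lemma h_upto_le V V' r x x' e : (0 < r)%N ->
  (forall j : 'I_k, (j < r)%N -> dot (row j V) x <= dot (row j V') x' + e) ->
  h_upto V r x <= h_upto V' r x' + e.
Proof.
move=> r0 h; apply/h_uptoP => // i /andP[i0 ir].
apply: (@le_trans _ _ (f_part p V' i x' + e)).
  by apply: f_part_le => // j ji; apply: h; exact: leq_trans ji ir.
by rewrite lerD2r f_part_le_h_upto// i0.
Qed.

Lemma l2norm_row_le V V' j : l2norm (row j V - row j V') <= n%:R * `|V - V'|.
Proof.
rewrite (le_trans (l2norm_le_norm _))// ler_wpM2l//; apply: le_mx_norm => // i l.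
rewrite !mxE (le_trans _ (coord_le_norm (V - V') j l))//.
by rewrite !mxE.
Qed.

Lemma continuous_h_upto V r : (0 < r)%N -> continuous (h_upto V r).
Proof.
move=> r0; pose B := n%:R * `|V|.
have B0 : 0 <= B by rewrite mulr_ge0.
have hB x y : h_upto V r x <= h_upto V r y + B * l2norm (x - y).
  apply: h_upto_le => // j _; rewrite -lerBlDl -dotBr (le_trans (dot_le _ _))//.
  rewrite ler_wpM2r ?l2norm_ge0//.
  have := l2norm_row_le V 0 j; rewrite subr0 (_ : row j 0 = 0) ?subr0//.
  by apply/rowP => l; rewrite !mxE.
apply/continuous_mxP => x e e0; exists (e / ((B + 1) * n.+1%:R)).
  by rewrite divr_gt0// mulr_gt0// ltr_wpDl.
move=> y; rewrite ltr_pdivlMr ?mulr_gt0 ?ltr_wpDl// => xy.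
apply: le_lt_trans xy; apply: (@le_trans _ _ (B * l2norm (x - y))).
  rewrite ler_norml; apply/andP; split.
    have := hB y x; rewrite l2norm_distC; lra.
  have := hB x y; lra.
rewrite mulrCA ler_pM// ?l2norm_ge0 ?lerDl//.
rewrite mulrC (le_trans (l2norm_le_norm _))// ler_wpM2r// ler_nat//.
Qed.

Lemma g_upto_le V V' r x : (0 < r)%N -> 0 < bet ->
  g_upto V r x <= g_upto V' r x + n%:R * `|V - V'| * (l2norm x + bet).
Proof.
move=> r0 b0; apply: multi_smooth_le => //; [exact: continuous_h_upto..|].
move=> y yx; apply: h_upto_le => // j _.
rewrite -lerBlDl -dotBl (le_trans (dot_le _ _))//.
rewrite ler_pM ?l2norm_ge0 ?l2norm_row_le//.
rewrite -(subrK x y) (le_trans (l2norm_triangle _ _))// addrC lerD2l.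
by rewrite (le_trans yx)// ger_pMr// gerBl invr_ge0 exprn_ge0.
Qed.

End Positive.

Section Regime.
Hypothesis hc : 40 <= c.
Hypothesis hL : 40 <= ln (n%:R : R).
Hypothesis k0 : (0 < k)%N.

Let L : R := ln n%:R.

Lemma dim_gt0 : (0 < n)%N.
Proof. by move: hL; case: n => // ; rewrite ln0//; lra. Qed.

Let n0 : 0 < n%:R :> R. Proof. by rewrite ltr0n dim_gt0. Qed.
Let L0 : 0 < L. Proof. by rewrite /L; move: hL; lra. Qed.
Let c0 : 0 < c. Proof. by move: hc; lra. Qed.

Lemma gamma_gt0 : 0 < gam.
Proof. by rewrite mulr_gt0// sqrtr_gt0 divr_gt0. Qed.

Let a0 : 0 < (alpha p)%:R :> R. Proof. by rewrite ltr0n. Qed.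

Lemma rho_gt0 : 0 < rho.
Proof. by rewrite divr_gt0 ?gamma_gt0// mulr_gt0// mulr_gt0. Qed.

Lemma beta_gt0 : 0 < bet.
Proof. by rewrite divr_gt0 ?gamma_gt0. Qed.

Let beta_le : 40 * bet <= gam.
Proof.
rewrite /beta -/L mulrA ler_pdivrMr// mulrC ler_pM2l ?gamma_gt0//.
Qed.

Let rhoE : rho * (100 * (alpha p)%:R * L) = gam.
Proof. by rewrite /rho divfK// gt_eqF// mulr_gt0// mulr_gt0. Qed.

Let gapE : n%:R ^- (alpha p) = expR (- ((alpha p)%:R * L)) :> R.
Proof. by rewrite expRN mulrC expRM_natr lnK ?posrE. Qed.

(** By the choice of [rho], a gap comparable to [gamma] is many times
    [alpha * rho * ln n]. *)
Let decay e : gam * (2 / 5) <= e -> expR (- e / rho) <= n%:R ^- (alpha p).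
Proof.
move=> he; rewrite gapE ler_expR mulNr lerN2 ler_pdivlMr ?rho_gt0//.
apply: le_trans he; rewrite -rhoE mulrC; have := rho_gt0; have := mulr_gt0 a0 L0.
set A := (alpha p)%:R; set r := rho => AL r0.
have := mulr_gt0 r0 AL; rewrite -!mulrA; lra.
Qed.

Section Step.
Variable V : 'M[R]_(k, n).
Hypothesis V1 : forall j, l2norm (row j V) <= 1.
Variables (r : nat) (rk : (r < k)%N) (x y : 'rV[R]_n).
Hypothesis xV : forall j : 'I_k, (r <= j)%N -> `|dot (row j V) x| <= gam / 4.
Hypothesis xy : l2norm (y - x) <= bet *+ 2.

Let yV (j : 'I_k) : (r <= j)%N -> `|dot (row j V) y| <= gam * (3 / 10).
Proof.
move=> rj; have -> : y = x + (y - x) by rewrite addrC subrK.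
rewrite dotDr (le_trans (ler_normD _ _))//.
have h1 := xV rj.
have h2 : `|dot (row j V) (y - x)| <= bet *+ 2.
  rewrite (le_trans (cauchy_schwarz _ _))// -[leRHS]mul1r.
  by rewrite ler_pM ?l2norm_ge0.
have := beta_le; rewrite mulr2n in h2; lra.
Qed.

(** Beyond the first unknown row, adding a row to the soft maximum gains less
    than the bonus that the previous piece has. *)
Let f_part_step i : (r < i < k)%N -> f_part p V i.+1 y <= f_part p V i y.
Proof.
move=> /andP[ri ik]; pose ii := Ordinal ik; pose rr := Ordinal rk.
rewrite /f_part.
pose E (j : 'I_k) := expR ((dot (row j V) y + (k - j.+1)%:R * gam) / rho).
have S0 : 0 < \sum_(j < k | (j < i)%N) E j.
  by apply: f_part_sum_gt0 => //; apply: leq_ltn_trans ri.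
have -> : \sum_(j < k | (j < i.+1)%N) E j = E ii + \sum_(j < k | (j < i)%N) E j.
  rewrite (bigD1 ii)//=; congr (_ + _); apply: eq_bigl => j.
  by rewrite ltnS [RHS]ltn_neqAle andbC.
have ES : E rr <= \sum_(j < k | (j < i)%N) E j.
  rewrite (bigD1 rr)//= lerDl; apply: sumr_ge0 => j _; exact: expR_ge0.
have Eii : E ii <= E rr * n%:R ^- (alpha p).
  pose N (j : 'I_k) := dot (row j V) y + (k - j.+1)%:R * gam.
  have -> : E ii = E rr * expR (- (N rr - N ii) / rho).
    rewrite -[E ii]/(expR (N ii / rho)) -[E rr]/(expR (N rr / rho)) -expRD.
    by rewrite -[N rr / rho + _]mulrDl opprB addrC subrK.
  rewrite ler_pM2l ?expR_gt0//; apply: decay.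
  have := yV (leqnn r : (r <= rr)%N); have := yV (ltnW ri : (r <= ii)%N).
  rewrite !ler_norml => /andP[_ h1] /andP[h2 _].
  have h3 : (k - i.+1)%:R + 1 <= (k - r.+1)%:R :> R.
    by rewrite natr1 ler_nat subnSK// leq_sub2l.
  have h4 : (k - i.+1)%:R * gam + gam <= (k - r.+1)%:R * gam.
    by rewrite -[X in _ + X]mul1r -mulrDl ler_wpM2r// ltW// gamma_gt0.
  rewrite /N /=; lra.
have d0 : 0 < n%:R ^- (alpha p) :> R by rewrite invr_gt0 exprn_gt0.
have -> : (k - i)%:R = (k - i.+1)%:R + 1 :> R by rewrite natr1 subnSK.
set S := \sum_(j < k | (j < i)%N) E j.
have : ln (E ii + S) <= ln S + n%:R ^- (alpha p).
  have -> : ln S + n%:R ^- alpha p = ln S + ln (expR (n%:R ^- alpha p)) by rewrite expRK.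
  rewrite -lnM ?posrE ?expR_gt0// ler_ln ?posrE ?mulr_gt0 ?addr_gt0 ?expR_gt0//.
  apply: (@le_trans _ _ (S * (1 + n%:R ^- alpha p))).
    rewrite mulrDr mulr1 addrC lerD2l (le_trans Eii)// ler_pM2r//.
  by rewrite ler_pM2l// expR_ge1Dx.
rewrite -(ler_pM2l rho_gt0) mulrDr => h.
apply: le_trans (lerD h (lexx _)) _.
rewrite -!addrA lerD2l mulrDr mulrDl mulr1 addrC.
exact: lexx.
Qed.

Lemma h_upto_local : h_fun p V y = h_upto V r.+1 y.
Proof.
apply/eqP; rewrite eq_le; apply/andP; split.
  apply/h_uptoP => // i /andP[i0 ik].
  have [ir|ri] := leqP i r.+1; first by apply: f_part_le_h_upto; rewrite i0.
  apply: (@le_trans _ _ (f_part p V r.+1 y)); last by apply: f_part_le_h_upto; rewrite ltnSn.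
  elim: i ri ik {i0} => // i IH; rewrite ltnS leq_eqVlt => /predU1P[<-//|ri] ik.
    by apply: f_part_step; rewrite ltnSn ik.
  apply: le_trans (IH ri (ltnW ik)); apply: f_part_step.
  by rewrite (ltnW ri).
apply/h_uptoP => // i /andP[i0 ir].
by apply: f_part_le_h_upto; rewrite i0 (leq_trans ir).
Qed.

End Step.

(** By [h_upto_local] the unsmoothed functions agree on a ball around [x] that
    contains all that the smoothed ones see near [x]. *)
Lemma jet_g_upto V (V1 : forall j, l2norm (row j V) <= 1) r (rk : (r < k)%N) x :
  (forall j : 'I_k, (r <= j)%N -> `|dot (row j V) x| <= gam / 4) ->
  jet p (g_fun p V) x = jet p (g_upto V r.+1) x.
Proof.
move=> xV; apply: jet_near; apply: multi_smooth_near; first exact: beta_gt0.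
by move=> y xy; exact: (h_upto_local V1 rk xV xy).
Qed.

(** The reason for the exponent [2 / 3] in the dimension: the bonuses, at most
    [k * gamma], stay below a tenth of the depth [1 / sqrt k] of the minimum. *)
Lemma dim_gamma_le : k%:R * Num.sqrt k%:R * gam <= 1 / 10.
Proof.
have g0 := gamma_gt0.
have k1 : (0 : R) < k%:R by rewrite ltr0n.
have ge0 : 0 <= (1 / 10) / gam by rewrite divr_ge0// ltW.
rewrite -ler_pdivlMr//.
have h1 : k%:R <= ((1 / 10) / gam) `^ (2 / 3).
  by rewrite /dimk truncn_le// powR_ge0.
have -> : k%:R * Num.sqrt k%:R = k%:R `^ (3 / 2) :> R.
  have -> : (3 / 2 : R) = 1 + 2^-1 by lra.
  rewrite powRD; last by apply/implyP => _; rewrite gt_eqF.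
  by rewrite powRr1 ?ltW// powR12_sqrt// ltW.
have -> : (1 / 10) / gam = (((1 / 10) / gam) `^ (2 / 3)) `^ (3 / 2).
  rewrite -powRrM (_ : 2 / 3 * (3 / 2) = 1 :> R) ?powRr1//.
  by field.
apply: ge0_ler_powR => //; rewrite ?nnegrE ?powR_ge0//; lra.
Qed.

Lemma double_dim_le : (k * 2 <= n)%N.
Proof.
have g0 := gamma_gt0.
have hg : (Num.sqrt n%:R)^-1 <= gam.
  have n1 := ltW n0; rewrite -sqrtrV//; apply: (@le_trans _ _ (Num.sqrt (L / n%:R))).
    by rewrite ler_wsqrtr// ler_peMl ?invr_ge0// /L; move: hL; lra.
  by rewrite /gamma ler_peMl ?sqrtr_ge0//; move: hc; lra.
have s0 : 0 < Num.sqrt n%:R :> R by rewrite sqrtr_gt0.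
have k1 : (1 : R) <= k%:R by rewrite ler1n.
have h1 : k%:R * Num.sqrt k%:R <= 1 / 10 * Num.sqrt n%:R :> R.
  rewrite -ler_pdivrMr//; apply: le_trans dim_gamma_le.
  by rewrite ler_wpM2l ?mulr_ge0 ?sqrtr_ge0.
have h2 : (k%:R * Num.sqrt k%:R) ^+ 2 <= (1 / 10 * Num.sqrt n%:R) ^+ 2 :> R.
  by rewrite ler_pXn2r// nnegrE ?mulr_ge0 ?sqrtr_ge0.
rewrite !exprMn !sqr_sqrtr// in h2.
have h3 : k%:R <= k%:R ^+ 2 * k%:R :> R by rewrite ler_peMl// exprn_ege1.
rewrite -(ler_nat R) natrM; lra.
Qed.

Lemma dim_le : (k <= n)%N.
Proof. exact: leq_trans (leq_pmulr _ _) double_dim_le. Qed.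

Let last : 'I_k := Ordinal (eq_ind _ (fun m => k.-1 < m)%N (ltnSn _) _ (prednK k0)).

Let h_ge V y : dot (row last V) y <= h_fun p V y.
Proof.
apply: (@le_trans _ _ (f_part p V k y)); last first.
  by apply: (f_part_le_h_upto V (r := k)); rewrite k0 leqnn.
have r0 := rho_gt0.
rewrite /f_part subnn mulr0 mul0r addr0.
have -> : dot (row last V) y = rho * (dot (row last V) y / rho) by rewrite mulrC divfK// gt_eqF.
rewrite ler_pM2l// -[leLHS]expRK ler_ln ?posrE ?expR_gt0 ?f_part_sum_gt0//.
rewrite (bigD1 last)//= prednK// subnn mul0r addr0 lerDl.
by apply: sumr_ge0 => j _; exact: expR_ge0.
Qed.

Section Optimum.
Variable V : 'M[R]_(k, n).
Hypothesis VO : V *m V^T = 1%:M.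

Lemma l2norm_row j : l2norm (row j V) = 1.
Proof. by rewrite /l2norm row_dot VO mxE eqxx sqrtr1. Qed.

(** A unit vector with the inner product [- 1 / sqrt k] with every row. *)
Let z : 'rV[R]_n := - (Num.sqrt k%:R)^-1 *: \sum_j row j V.

Let dot_z j : dot (row j V) z = - (Num.sqrt k%:R)^-1.
Proof.
rewrite /z dotZr dot_sumr (bigD1 j)//= big1 ?addr0 => [|i ij].
  by rewrite row_dot VO mxE eqxx mulr1.
by rewrite row_dot VO mxE eq_sym (negPf ij).
Qed.

Let kR : (0 : R) < k%:R. Proof. by rewrite ltr0n. Qed.
Let sk0 : 0 < Num.sqrt (k%:R : R). Proof. by rewrite sqrtr_gt0. Qed.

Let z1 : l2norm z = 1.
Proof.
rewrite /l2norm {1}/z dotZl dot_suml (eq_bigr (fun=> - (Num.sqrt k%:R)^-1)) => [|j _].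
  rewrite sumr_const card_ord -[X in _ * X]mulr_natr mulrA mulrNN -invfM -expr2.
  by rewrite sqr_sqrtr ?ltW// mulVf ?sqrtr1// gt_eqF.
exact: dot_z.
Qed.

(** At [z] the [k] terms of the soft maximum exceed the largest one by at most
    [rho * ln n], and the bonus of each piece is at most [rho]. *)
Let g_z : g_fun p V z <= - (Num.sqrt k%:R)^-1 + k%:R * gam - gam * (9 / 10).
Proof.
have r0 := rho_gt0; have g0 := gamma_gt0; have b0 := beta_gt0.
apply: multi_smooth_le_cst => //; first exact: continuous_h_upto.
move=> y yz; apply/h_uptoP => // i /andP[i0 ik].
pose M := - (Num.sqrt k%:R)^-1 + bet + (k%:R - 1) * gam.
have S0 := @f_part_sum_gt0 k0 V i y i0.
have SM : \sum_(j < k | (j < i)%N)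
    expR ((dot (row j V) y + (k - j.+1)%:R * gam) / rho) <= k%:R * expR (M / rho).
  apply: (@le_trans _ _ (\sum_(j < k) expR (M / rho))); last first.
    by rewrite sumr_const card_ord mulr_natl.
  rewrite big_mkcond; apply: ler_sum => j _; case: ifP => _; last exact: expR_ge0.
  rewrite ler_expR ler_pM2r ?invr_gt0// /M; apply: lerD.
    rewrite -[y](subrK z) dotDr dot_z addrC lerD2l (le_trans (dot_le _ _))//.
    by rewrite l2norm_row mul1r.
  apply: ler_wpM2r; first exact: ltW.
  by rewrite -[X in _ <= _ - X]/(1%:R) -natrB// ler_nat leq_sub2l.
have lnS : ln (\sum_(j < k | (j < i)%N)
    expR ((dot (row j V) y + (k - j.+1)%:R * gam) / rho)) <= L + M / rho.
  apply: (@le_trans _ _ (ln (k%:R * expR (M / rho)))).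
    by rewrite ler_ln ?posrE ?mulr_gt0 ?expR_gt0.
  rewrite lnM ?posrE ?expR_gt0// expRK lerD2r ler_ln ?posrE// ler_nat.
  exact: dim_le.
have bonus : rho * (k - i)%:R * n%:R ^- alpha p <= rho.
  rewrite -mulrA ger_pMr// ler_pdivrMr ?exprn_gt0// mul1r -natrX ler_nat.
  rewrite (@leq_trans n)//; first exact: leq_trans (leq_subr _ _) dim_le.
  by rewrite -{1}(expn1 n) leq_pexp2l// dim_gt0.
rewrite /f_part; apply: le_trans (lerD _ bonus) _.
  by apply: (ler_wpM2l _ lnS); exact: ltW.
rewrite mulrDr (mulrC rho (M / rho)) divfK ?gt_eqF// /M.
have h1 : rho * L <= gam / 100.
  rewrite ler_pdivlMr// -[leRHS]rhoE -[leLHS]mulrA ler_pM2l// mulrC.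
  rewrite ler_pM2r// ler_peMr// ler1n//.
have h2 : rho <= gam / 100.
  by apply: le_trans h1; rewrite ler_peMr ?ltW// /L; move: hL; lra.
have := beta_le; lra.
Qed.

Let eps_optimal_last x : eps_optimal (g_fun p V) (epsilon c n) x ->
  dot (row last V) x < - (gam / 4).
Proof.
move=> [x1 xe]; rewrite ltNge; apply/negP => hx.
have r0 := rho_gt0; have g0 := gamma_gt0; have b0 := beta_gt0.
have gx a w : a <= dot (row last V) w -> a - bet <= g_fun p V w.
  move=> aw; apply: multi_smooth_ge_cst => //; first exact: continuous_h_upto.
  move=> y yw; apply: le_trans (h_ge V y).
  rewrite -[y](subrK w) dotDr addrC lerD//.
  have := cauchy_schwarz (row last V) (y - w); rewrite l2norm_row mul1r.
  by rewrite ler_norml => /andP[+ _]; apply: le_trans; rewrite lerN2.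
have gxx := gx _ _ hx.
have lb : has_lbound [set g_fun p V w | w in l2ball 0 1].
  exists (- 1 - bet) => _ [w /l2ball0P w1 <-]; apply: gx.
  have := cauchy_schwarz (row last V) w; rewrite l2norm_row mul1r ler_norml => /andP[+ _].
  by apply: le_trans; rewrite lerN2.
have infz : inf [set g_fun p V w | w in l2ball 0 1] <= g_fun p V z.
  by apply: ge_inf => //; exists z => //; apply/l2ball0P; rewrite z1.
have hz := g_z.
have hk : k%:R * gam <= 1 / 10 * (Num.sqrt k%:R)^-1.
  by rewrite ler_pdivlMr// mulrAC dim_gamma_le.
have s0 : 0 < (Num.sqrt (k%:R : R))^-1 by rewrite invr_gt0.
move: xe; rewrite /epsilon; have := beta_le; lra.
Qed.

(** An [epsilon]-optimal point correlates with the last row: elsewhere the value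
    is almost [0], whereas the infimum is about [- 1 / sqrt k]. *)
Lemma eps_optimal_dot x (j : 'I_k) : j.+1 = k ->
  eps_optimal (g_fun p V) (epsilon c n) x -> dot (row j V) x < - (gam / 4).
Proof.
move=> jk /eps_optimal_last; suff -> : last = j by [].
by apply/val_inj; exact: esym (congr1 predn jk).
Qed.

End Optimum.
End Regime.
End HardFunction.

(** * Orthogonal maps and random signs *)

Section Orthogonal.
Context {R : realType}.

Lemma dot_orth n (O : 'M[R]_n) (x y : 'rV[R]_n) : O *m O^T = 1%:M ->
  dot (x *m O) (y *m O) = dot x y.
Proof. by move=> OO; rewrite !dotE trmx_mul mulmxA -(mulmxA x) OO mulmx1. Qed.

Lemma l2norm_orth n (O : 'M[R]_n) (x : 'rV[R]_n) : O *m O^T = 1%:M ->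
  l2norm (x *m O) = l2norm x.
Proof. by move=> OO; rewrite /l2norm dot_orth. Qed.

Lemma orth_mul n (O U : 'M[R]_n) : O *m O^T = 1%:M -> U *m U^T = 1%:M ->
  (O *m U) *m (O *m U)^T = 1%:M.
Proof. by move=> OO UU; rewrite trmx_mul mulmxA -(mulmxA O) UU mulmx1. Qed.

Lemma orth_tr n (O : 'M[R]_n) : O *m O^T = 1%:M -> O^T *m O^T^T = 1%:M.
Proof. by move=> OO; rewrite trmxK; exact: mulmx1C. Qed.

(** The reflection in the hyperplane orthogonal to [u - v]. *)
Lemma householder n (u v : 'rV[R]_n) : dot u u = dot v v ->
  exists2 O : 'M[R]_n, O *m O^T = 1%:M &
    u *m O = v /\ forall w, dot w u = dot w v -> w *m O = w.
Proof.
move=> uv; pose a := u - v; have [a0|a0] := eqVneq (dot a a) 0.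
  exists 1%:M; first by rewrite trmx1 mulmx1.
  split=> [|w _]; rewrite mulmx1//; apply/eqP; rewrite -subr_eq0.
  by apply/eqP; exact: dot_eq0.
pose t := 2 / dot a a; pose O : 'M[R]_n := 1%:M - t *: (a^T *m a).
have OE w : w *m O = w - (t * dot w a) *: a.
  rewrite /O mulmxBr mulmx1 -scalemxAr mulmxA; congr (_ - _).
  rewrite [w *m a^T]mx11_scalar -dotE mul_scalar_mx scalerA//.
exists O.
  have OT : O^T = O by rewrite /O linearB /= linearZ /= trmx1 trmx_mul trmxK.
  rewrite OT; apply/row_matrixP => i; rewrite row_mul.
  have -> : row i O = row i 1%:M *m O by rewrite -row_mul mul1mx.
  set w := row i _; rewrite !OE dotBl dotZl.
  have -> : dot w a - t * dot w a * dot a a = - dot w a.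
    by rewrite /t; field.
  by rewrite mulrN scaleNr opprK subrK.
have aw w : dot w u = dot w v -> dot w a = 0 by move=> h; rewrite dotBr h subrr.
split=> [|w /aw h]; last by rewrite OE h mulr0 scale0r subr0.
have -> : u *m O = u - a.
  rewrite OE (_ : t * dot u a = 1) ?scale1r// /t.
  have -> : dot u a = dot a a / 2.
    by rewrite /a !dotBl !dotBr (dotC v u) -uv; field.
  by field.
by rewrite /a opprB addrC subrK.
Qed.

(** The reflection that treats the row [r] fixes the coordinate vectors reached
    before, which are orthogonal to both vectors that it exchanges. *)
Lemma orth_standard k n (V : 'M[R]_(k, n)) (kn : (k <= n)%N) r : (r <= k)%N ->
  V *m V^T = 1%:M ->
  exists2 U : 'M[R]_n, U *m U^T = 1%:M &
    forall i : 'I_k, (i < r)%N -> row i V *m U = delta_mx 0 (widen_ord kn i).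
Proof.
move=> + VV; elim: r => [_|r IH rk]; first by exists 1%:M => //; rewrite trmx1 mulmx1.
have [U UU hU] := IH (ltnW rk); pose s := Ordinal rk.
have rd (i j : 'I_k) : dot (row i V) (row j V) = (i == j)%:R.
  by rewrite row_dot VV mxE.
have dd (x : 'rV[R]_n) l : dot x (delta_mx 0 l) = x 0 l.
  rewrite /dot (bigD1 l)//= big1 ?addr0 => [|m /negPf ml].
    by rewrite mxE !eqxx mulr1.
  by rewrite mxE ml andbF mulr0.
have [|H HH [Hs Hw]] := @householder n (row s V *m U) (delta_mx 0 (widen_ord kn s)).
  by rewrite dot_orth// rd eqxx dd mxE !eqxx.
exists (U *m H); first exact: orth_mul.
move=> i; rewrite ltnS leq_eqVlt mulmxA => /orP[/eqP ir|ir].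
  by have -> : i = s by exact/val_inj.
rewrite hU// Hw// -hU// dot_orth// rd hU// dotC dd mxE eqxx/=.
by rewrite -!val_eqE.
Qed.

(** One more reflection, inside the last [n - r] coordinates, spreads a vector
    evenly over them: this makes the coefficients of the signed sums small. *)
Lemma orth_flat k n (V : 'M[R]_(k, n)) (kn : (k <= n)%N) r (x : 'rV[R]_n) :
  (r <= k)%N -> (r < n)%N -> V *m V^T = 1%:M ->
  exists2 U : 'M[R]_n, U *m U^T = 1%:M &
    (forall i : 'I_k, (i < r)%N -> row i V *m U = delta_mx 0 (widen_ord kn i)) /\
    exists b, forall l : 'I_n, (r <= l)%N -> (x *m U) 0 l = b.
Proof.
move=> rk rn VV; have [U UU hU] := orth_standard kn rk VV.
pose y := x *m U.
pose S := \sum_(l < n | (r <= l)%N) y 0 l ^+ 2.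
pose m := (\sum_(l < n | (r <= l)%N) 1 : R).
have m0 : 0 < m.
  rewrite /m (bigD1 (Ordinal rn))//=.
  by rewrite ltr_pwDl// sumr_ge0.
have S0 : 0 <= S by apply: sumr_ge0 => l _; rewrite sqr_ge0.
pose b := Num.sqrt (S / m).
pose z : 'rV[R]_n := \row_l if (r <= l)%N then b else y 0 l.
have zE l : z 0 l = if (r <= l)%N then b else y 0 l by rewrite mxE.
have [|H HH [Hy Hw]] := @householder n y z.
  rewrite /dot (bigID (fun l : 'I_n => r <= l)%N)//= [RHS](bigID (fun l : 'I_n => r <= l)%N)/=.
  congr (_ + _); last by apply: eq_bigr => l /negPf rl; rewrite zE rl.
  rewrite (eq_bigr (fun l => y 0 l ^+ 2)) => [|//].
  rewrite [RHS](eq_bigr (fun l => b ^+ 2 * 1)) => [|l rl]; last first.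
    by rewrite zE rl mulr1.
  by rewrite -mulr_sumr sqr_sqrtr ?divr_ge0// ?ltW// -/m divfK ?gt_eqF.
exists (U *m H); first exact: orth_mul.
split=> [i ir|]; last by exists b => l rl; rewrite mulmxA -/y Hy zE rl.
rewrite mulmxA hU// Hw// !(dotC (delta_mx _ _)) /dot.
apply: eq_bigr => l _; rewrite [delta_mx _ _ _ _]mxE eqxx /=.
by case: eqVneq => [->|_]; rewrite ?mulr0// zE /= leqNgt ir.
Qed.

(** For [1 <= y] the right-hand side dominates [expR y]; for [y <= 1] the bound
    [expR z <= (1 - z / 2) ^- 2] leaves an inequality between polynomials. *)
Lemma cosh_le (y : R) : (expR y + expR (- y)) / 2 <= expR (y ^+ 2).
Proof.
wlog y0 : y / 0 <= y => [h|].
  have [/h//|/ltW y0] := lerP 0 y.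
  by have := h (- y); rewrite oppr_ge0 opprK sqrrN addrC; exact.
have [y1|y1] := lerP y 1; last first.
  apply: (@le_trans _ _ (expR y)).
    have : expR (- y) <= expR y by rewrite ler_expR; lra.
    lra.
  by rewrite ler_expR expr2 ler_peMl// ltW.
have half (z : R) : -1 <= z <= 1 -> expR z <= ((1 - z / 2) ^+ 2)^-1.
  move=> z1; have h : 0 < 1 - z / 2 by lra.
  have -> : expR z = (expR (- (z / 2)) ^+ 2)^-1.
    rewrite -expRM_natr -expRN; congr expR; lra.
  rewrite lef_pV2 ?posrE ?exprn_gt0 ?expR_gt0//.
  rewrite ler_pXn2r ?nnegrE ?expR_ge0 ?(ltW h)//.
  exact: expR_ge1Dx.
have h1 : expR y <= ((1 - y / 2) ^+ 2)^-1 by apply: half; lra.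
have h2 : expR (- y) <= ((1 - - y / 2) ^+ 2)^-1 by apply: half; lra.
pose u := y ^+ 2 / 4.
have u0 : 0 <= u by rewrite divr_ge0// sqr_ge0.
have u1 : u <= 1 / 4 by rewrite /u ler_pM2r// expr_le1.
apply: (@le_trans _ _ ((1 + 2 * u) ^+ 2)); last first.
  have -> : y ^+ 2 = 2 * (2 * u) by rewrite /u; lra.
  by rewrite (expRM_natl 2) ler_pXn2r ?nnegrE ?expR_ge0 ?expR_ge1Dx//; lra.
apply: (@le_trans _ _ ((((1 - y / 2) ^+ 2)^-1 + ((1 - - y / 2) ^+ 2)^-1) / 2)).
  by rewrite ler_pM2r//; lra.
have a0 : 0 < 1 - y / 2 by lra.
have b0 : 0 < 1 - - y / 2 by lra.
have uE : 1 - u = (1 - y / 2) * (1 - - y / 2) by rewrite /u; field.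
have -> : (((1 - y / 2) ^+ 2)^-1 + ((1 - - y / 2) ^+ 2)^-1) / 2 = (1 + u) / (1 - u) ^+ 2.
  have -> : 1 + u = ((1 - y / 2) ^+ 2 + (1 - - y / 2) ^+ 2) / 2 by rewrite /u; field.
  rewrite uE; move: a0 b0; set a := 1 - y / 2; set b := 1 - - y / 2 => a0 b0.
  by field; rewrite !gt_eqF.
have {uE a0 b0} u2 : 0 < 1 - u by lra.
rewrite ler_pdivrMr ?exprn_gt0//.
nra.
Qed.

End Orthogonal.

Section Signs.
Context {R : realType}.

(** Markov's inequality for the exponential moment, which is a product over the
    signs, and [cosh_le] for each factor. *)
Lemma sign_count n (y : 'I_n -> R) (s lam : R) : 0 <= lam ->
  #|[pred e : {ffun 'I_n -> bool} | s <= \sum_l (-1) ^+ e l * y l]|%:R <=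
  2 ^+ n * expR (- (lam * s) + lam ^+ 2 * \sum_l y l ^+ 2).
Proof.
move=> lam0; rewrite -sum1_card natr_sum.
apply: (@le_trans _ _ (\sum_(e : {ffun 'I_n -> bool})
    expR (- (lam * s)) * \prod_l expR (lam * ((-1) ^+ e l * y l)))).
  rewrite big_mkcond; apply: ler_sum => e _; rewrite inE.
  have E0 : 0 <= expR (- (lam * s)) * \prod_l expR (lam * ((-1) ^+ e l * y l)).
    by rewrite mulr_ge0 ?expR_ge0// prodr_ge0// => l _; exact: expR_ge0.
  case: ifP => // h; rewrite -expR_sum -expRD -mulr_sumr -[leLHS]expR0 ler_expR.
  by rewrite addrC -mulrBr mulr_ge0// subr_ge0.
rewrite -mulr_sumr -(bigA_distr_bigA (fun (l : 'I_n) (b : bool) => expR (lam * ((-1) ^+ b * y l)))).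
rewrite expRD mulrCA ler_pM2l ?expR_gt0//.
have -> : 2 ^+ n = \prod_(l < n) 2 :> R by rewrite prodr_const card_ord.
rewrite mulr_sumr expR_sum -big_split /=.
apply: ler_prod => l _; rewrite big_bool /= expr0 expr1 mul1r mulN1r mulrN.
rewrite addr_ge0 ?expR_ge0//= -exprMn addrC.
have := cosh_le (lam * y l); by rewrite ler_pdivrMr// [leRHS]mulrC.
Qed.

(** Double counting: the sum is the integral of the number of sets [E i] that
    contain the point. *)
Lemma sum_measure_le d (T : measurableType d) (mu : {measure set T -> \bar R})
    (I : finType) (S : set T) (E : I -> set T) (a : R) :
  measurable S -> (forall i, measurable (E i)) -> 0 <= a ->
  (forall x, S x -> #|[pred i | `[<E i x>]]|%:R <= a) ->
  (\sum_i mu (S `&` E i) <= a%:E * mu S)%E.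
Proof.
move=> mS mE a0 h.
have -> : (\sum_i mu (S `&` E i) = \int[mu]_(x in S) \sum_i (\1_(E i) x)%:E)%E.
  rewrite ge0_integral_sum//.
    by apply: eq_bigr => i _; rewrite integral_indic// setIC.
  by move=> i; apply/measurable_EFinP; exact: measurable_funTS.
rewrite -integral_cst//; apply: ge0_le_integral => //.
- by move=> x _; apply: sume_ge0 => i _; rewrite lee_fin.
- by apply: emeasurable_sum => i; apply/measurable_EFinP; exact: measurable_funTS.
move=> x /h; rewrite sumEFin /cst lee_fin; apply: le_trans.
rewrite -sum1_card natr_sum [leRHS]big_mkcond; apply: ler_sum => i _.
by rewrite indicE [X in if X then _ else _](_ : _ = (x \in E i))//; case: (x \in E i).
Qed.

End Signs.

(** * Concentration for Haar random frames *)

Lemma section_swap {R : realType} d1 d2 (T1 : measurableType d1) (T2 : measurableType d2)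
    (P : probability T1 R) (Q : probability T2 R) (S : set (T1 * T2)) : measurable S ->
  (\int[P]_x Q (xsection S x) = \int[Q]_y P (ysection S y))%E.
Proof.
move=> mS; have := @indic_fubini_tonelli _ _ _ _ R P Q S mS.
by rewrite indic_fubini_tonelli_FE// indic_fubini_tonelli_GE.
Qed.

Section RowDistance.
Context {R : realType}.
Variables k n : nat.
Implicit Types Y Z : 'M[R]_(k, n).

(** A distance that right multiplication by an orthogonal matrix preserves. *)
Definition rdist Y Z : R := \sum_i l2norm (row i Y - row i Z).

Lemma rdistC Y Z : rdist Y Z = rdist Z Y.
Proof. by apply: eq_bigr => i _; rewrite l2norm_distC. Qed.

Lemma rdist_triangle X Y Z : rdist X Z <= rdist X Y + rdist Y Z.
Proof.
rewrite /rdist -big_split /=; apply: ler_sum => i _.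
by rewrite (le_trans _ (l2norm_triangle _ _))// addrA subrK.
Qed.

Lemma rdistxx Y : rdist Y Y = 0.
Proof. by rewrite /rdist big1// => i _; rewrite subrr l2norm0. Qed.

Lemma rdist_orth (O : 'M[R]_n) Y Z : O *m O^T = 1%:M ->
  rdist (Y *m O) (Z *m O) = rdist Y Z.
Proof.
by move=> OO; apply: eq_bigr => i _; rewrite !row_mul -mulmxBl l2norm_orth.
Qed.

Lemma row_le_rdist Y Z i : l2norm (row i Y - row i Z) <= rdist Y Z.
Proof.
by rewrite /rdist (bigD1 i)//= lerDl sumr_ge0// => j _; exact: l2norm_ge0.
Qed.

Lemma norm_le_rdist Y Z : `|Y - Z| <= rdist Y Z.
Proof.
apply: le_mx_norm => [|i j]; first by apply: sumr_ge0 => i _; exact: l2norm_ge0.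
apply: le_trans (row_le_rdist Y Z i); apply: le_trans (norm_le_l2norm _).
by have := coord_le_norm (row i Y - row i Z) 0 j; rewrite !mxE.
Qed.

Lemma rdist_le_norm Y Z : rdist Y Z <= (k * n)%:R * `|Y - Z|.
Proof.
apply: (@le_trans _ _ (\sum_(i < k) n%:R * `|Y - Z|)); last first.
  by rewrite sumr_const card_ord natrM -mulrA [leRHS]mulr_natl.
apply: ler_sum => i _; rewrite (le_trans (l2norm_le_norm _))// ler_wpM2l//.
apply: le_mx_norm => // a j; have := coord_le_norm (Y - Z) i j; by rewrite !mxE.
Qed.

Variable r : nat.
Notation D := (pid_mx r : 'M[R]_k).

Lemma row_pid Y i : row i (D *m Y) = if (i < r)%N then row i Y else 0.
Proof.
apply/rowP => j; rewrite !mxE (bigD1 i)//= big1 => [|l /negPf li]; last first.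
  by rewrite mxE val_eqE eq_sym li mul0r.
rewrite mxE eqxx addr0; case: ifP => _; rewrite ?mul1r ?mul0r !mxE//.
Qed.

Lemma rdist_pid_le Y Z : rdist (D *m Y) (D *m Z) <= rdist Y Z.
Proof.
apply: ler_sum => i _; rewrite !row_pid; case: ifP => // _.
by rewrite subrr l2norm0 l2norm_ge0.
Qed.

Lemma continuous_rdist_pid Z : continuous (fun Y => rdist (D *m Y) (D *m Z)).
Proof.
apply/continuous_mxP => Y e e0; exists (e / (k * n).+1%:R); first by rewrite divr_gt0.
move=> X; rewrite ltr_pdivlMr// => h; apply: le_lt_trans h.
apply: (@le_trans _ _ (rdist Y X)).
  have := rdist_triangle (D *m Y) (D *m X) (D *m Z).
  have := rdist_triangle (D *m X) (D *m Y) (D *m Z).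
  have := rdist_pid_le Y X; rewrite (rdistC (D *m X) (D *m Y)) ler_norml => *.
  by apply/andP; split; lra.
rewrite (le_trans (rdist_le_norm _ _))// mulrC ler_wpM2l// ler_nat//.
Qed.

End RowDistance.

Section Haar.
Context {R : realType}.
Variables (k n : nat).
Hypothesis kn : (k <= n)%N.
Variables (P : probability (borel_mx R k n) R).
Hypothesis haarP : haar_frame P.
Variable (r : nat).
Hypothesis rk : (r < k)%N.
Local Notation frames := [set V : 'M[R]_(k, n) | V *m V^T = 1%:M].
Local Notation D := (pid_mx r : 'M[R]_k).
Implicit Types V : 'M[R]_(k, n).

(** A neighbourhood to condition on, since for [0 < r] the event that the first
    [r] rows are equal to those of [V] may have probability zero. *)
Definition near_rows (d : R) V : set 'M[R]_(k, n) :=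
  [set Y | rdist (D *m Y) (D *m V) < d].

Let rn : (r < n)%N. Proof. exact: leq_trans rk kn. Qed.

Lemma measurable_near_rows d V : measurable (near_rows d V : set (borel_mx R k n)).
Proof.
apply: open_borel_mx.
have -> : near_rows d V = (fun Y => rdist (D *m Y) (D *m V)) @^-1` [set t | t < d] by [].
by apply: open_comp; [move=> ? _; exact: continuous_rdist_pid|exact: open_lt].
Qed.

Lemma measurable_mulmxr (O : 'M[R]_n) :
  measurable_fun setT (fun V : borel_mx R k n => (V : 'M[R]_(k, n)) *m O : borel_mx R k n).
Proof.
apply: measurable_borel_mx => i j.
rewrite [X in measurable_fun _ X](_ : _ =
    (fun V : borel_mx R k n => \sum_l (V : 'M[R]_(k, n)) i l * O l j)); last first.
  by apply/funext => V; rewrite mxE.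
apply: measurable_sum => l; apply: measurable_funM => //.
exact: measurable_coord_mx.
Qed.

Lemma continuous_row_dot (j : 'I_k) (x : 'rV[R]_n) :
  continuous (fun V => dot (row j V) x).
Proof.
apply/continuous_mxP => V e e0; pose B := n%:R * (l2norm x + 1).
have x1 : 0 < l2norm x + 1 by rewrite ltr_wpDl ?l2norm_ge0.
have n0 : 0 < n%:R :> R by rewrite ltr0n (leq_ltn_trans _ rn).
exists (e / B) => [|Y]; first by rewrite divr_gt0// mulr_gt0.
rewrite ltr_pdivlMr ?mulr_gt0// => h; apply: le_lt_trans h.
rewrite -dotBl (le_trans (cauchy_schwarz _ _))// /B mulrA.
rewrite ler_pM ?l2norm_ge0 ?lerDl// mulrC -linearB.
rewrite (le_trans (l2norm_le_norm _))// ler_wpM2l//.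
by apply: le_mx_norm => // a l; have := coord_le_norm (V - Y) j l; rewrite !mxE.
Qed.

Definition row_ge (j : 'I_k) (x : 'rV[R]_n) (s : R) : set 'M[R]_(k, n) :=
  [set V | s <= dot (row j V) x].

Lemma measurable_row_ge j x s : measurable (row_ge j x s : set (borel_mx R k n)).
Proof.
apply: closed_borel_mx.
have -> : row_ge j x s = (fun V => dot (row j V) x) @^-1` [set t | s <= t] by [].
by apply: preimage_closed; [move=> ? _; exact: continuous_row_dot|exact: closed_ge].
Qed.

Lemma closed_frames : closed frames.
Proof.
have -> : frames = \bigcap_(ij in [set: 'I_k * 'I_k])
    (fun V => dot (row ij.1 V) (row ij.2 V)) @^-1` [set (1%:M : 'M[R]_k) ij.1 ij.2].
  apply/seteqP; split=> V /=; first by move=> h [i j] _ /=; rewrite row_dot h.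
  by move=> h; apply/matrixP => i j; have := h (i, j) I; rewrite /= row_dot.
apply: closed_bigI => -[i j] _; apply: preimage_closed => [V _|]; last exact: closed_eq.
rewrite /dot /=.
have -> : (fun W : 'M[R]_(k, n) => \sum_l row i W 0 l * row j W 0 l) =
    (fun W => \sum_l W i l * W j l).
  by apply/funext => W; apply: eq_bigr => l _; rewrite !mxE.
apply: continuous_big => [|l _ W]; first exact: add_continuous.
by apply: continuousM; exact: coord_continuous.
Qed.

Lemma measurable_frames : measurable (frames : set (borel_mx R k n)).
Proof. exact: (closed_borel_mx closed_frames). Qed.

Lemma haar_frames (A : set (borel_mx R k n)) : measurable A -> P A = P (A `&` frames).
Proof.
move=> mA; have mF := measurable_frames.
have h0 : P (~` frames) = 0%E.
  by rewrite probability_setC//; have [-> _] := haarP; rewrite subee.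
rewrite (measureDI P mA mF) [X in (X + _)%E](_ : _ = 0%E) ?add0e//.
have mD : measurable (A `\` frames) by exact: measurableD.
apply: subset_measure0 h0 => //; first exact: measurableC.
Qed.

(** Reflecting the directions orthogonal to the first [r] rows of [V] moves the
    row [j] but not the neighbourhood of [V]; averaged over all sign patterns,
    the row behaves like a vector of random signs on [n - r] coordinates. *)
Lemma near_rows_tail V (j : 'I_k) (x : 'rV[R]_n) (s lam d : R) :
  V *m V^T = 1%:M -> (r <= j)%N -> l2norm x <= 1 -> 0 <= lam -> 0 < d ->
  (P (row_ge j x s `&` near_rows d V) <=
   (expR (- (lam * s) + lam * (n%:R * d) + lam ^+ 2 / (n - r)%:R))%:E *
     P (near_rows d V))%E.
Proof.
move=> VV rj x1 lam0 d0.
have [U UU [hU [b hb]]] := orth_flat kn x (ltnW rk) rn VV.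
pose sg (e : {ffun 'I_n -> bool}) : 'rV[R]_n :=
  \row_(l < n) if (l < r)%N then 1 else (-1) ^+ e l.
have sgE e l : sg e 0 l = if (l < r)%N then 1 else (-1) ^+ e l by rewrite mxE.
pose O e := U *m diag_mx (sg e) *m U^T.
have OO e : O e *m (O e)^T = 1%:M.
  apply: orth_mul (orth_tr UU); apply: orth_mul => //.
  rewrite tr_diag_mx mulmx_diag -diag_const_mx; congr diag_mx.
  apply/rowP => l; rewrite !mxE; case: ifP => _; rewrite ?mul1r//.
  by rewrite -expr2 sqrr_sign.
have UtU : U^T *m U = 1%:M by exact: mulmx1C.
have fixV e : D *m V *m O e = D *m V.
  apply/row_matrixP => i; rewrite row_mul row_pid; case: ifP => ir; last by rewrite mul0mx.
  rewrite /O !mulmxA hU//.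
  have -> : delta_mx 0 (widen_ord kn i) *m diag_mx (sg e) = row i V *m U.
    rewrite hU//; apply/rowP => l; rewrite mul_mx_diag !mxE/=.
    case: (eqVneq l (widen_ord kn i)) => [->|_]; last by rewrite mul0r.
    by rewrite /= ir mulr1.
  by rewrite -mulmxA UU mulmx1.
pose A := row_ge j x s.
have mA : measurable (A : set (borel_mx R k n)) by exact: measurable_row_ge.
pose E e := [set Y : 'M[R]_(k, n) | A (Y *m O e)].
pose S := near_rows d V `&` frames.
pose M := expR (- (lam * s) + lam * (n%:R * d) + lam ^+ 2 / (n - r)%:R).
have mN := measurable_near_rows d V.
have mE e : measurable (E e : set (borel_mx R k n)).
  by rewrite -[E e]setTI; exact: (measurable_mulmxr (O e)).
have mS : measurable (S : set (borel_mx R k n)).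
  by apply: measurableI => //; exact: measurable_frames.
(* Near [V] the row [j] has small coordinates on the first [r] rows of [V]; the
   signs act on the other coordinates. *)
have count Y : S Y -> #|[pred e | `[<E e Y>]]|%:R <= 2 ^+ n * M.
  move=> [YV YY]; pose a := row j Y *m U; pose z := x *m U.
  pose T := \sum_(l < n | (l < r)%N) a 0 l * z 0 l.
  pose y (l : 'I_n) : R := if (l < r)%N then 0 else a 0 l * z 0 l.
  have a1 : dot a a = 1 by rewrite dot_orth// row_dot YY mxE eqxx.
  have z1 : dot z z <= 1 by rewrite dot_orth// -(expr1n _ 2) -l2norm_le.
  have dE e : dot (row j (Y *m O e)) x = T + \sum_l (-1) ^+ e l * y l.
    rewrite -(dot_orth _ _ UU) row_mul /O !mulmxA -(mulmxA _ U^T) UtU mulmx1 -/a -/z.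
    rewrite /dot (eq_bigr (fun l : 'I_n => (if (l < r)%N then a 0 l * z 0 l else 0) +
      (-1) ^+ e l * y l)) => [|l _]; last first.
      rewrite mul_mx_diag mxE sgE /y; case: ifP => _.
        by rewrite mulr1 mulr0 addr0.
      by rewrite add0r mulrAC mulrC mulrA.
    by rewrite big_split /= -big_mkcond.
  have T_le : T <= n%:R * d.
    apply: (@le_trans _ _ (\sum_(l < n) d)); last by rewrite sumr_const card_ord mulr_natl.
    rewrite /T big_mkcond; apply: ler_sum => l _; case: ifPn => [lr|_]; last exact: ltW.
    pose i := Ordinal (ltn_trans lr rk).
    have aE : a 0 l = dot (row j Y) (row i V - row i Y).
      have -> : a 0 l = dot a (row i V *m U).
        have il : widen_ord kn i = l by exact/val_inj.
        rewrite hU// il /dot (bigD1 l)//= big1 => [|q /negPf ql].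
          by rewrite [delta_mx _ _ _ _]mxE !eqxx mulr1 addr0.
        by rewrite [delta_mx _ _ _ _]mxE ql andbF mulr0.
      rewrite dot_orth// dotBr [dot _ (row i Y)]row_dot YY mxE [j == i]negbTE ?subr0//.
      by rewrite -val_eqE /= gtn_eqF// (leq_trans lr).
    apply: le_trans (ler_norm _) _; rewrite normrM -[leRHS]mulr1 ler_pM//.
      rewrite aE (le_trans (cauchy_schwarz _ _))//.
      rewrite {1}/l2norm row_dot YY mxE eqxx sqrtr1 mul1r l2norm_distC.
      apply: le_trans (ltW YV); apply: le_trans (row_le_rdist _ _ i).
      by rewrite !row_pid lr.
    apply: le_trans (coord_le_norm z 0 l) _; apply: le_trans (norm_le_l2norm _) _.
    by rewrite l2norm_orth.
  have y_le : \sum_l y l ^+ 2 <= ((n - r)%:R)^-1.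
    have m0 : 0 < (n - r)%:R :> R by rewrite ltr0n subn_gt0.
    apply: (@le_trans _ _ (b ^+ 2)).
      rewrite -[leRHS]mulr1 -a1 /dot mulr_sumr; apply: ler_sum => l _.
      rewrite /y; case: ltnP => lr; last by rewrite hb// exprMn mulrC expr2.
      by rewrite expr0n mulr_ge0 ?sqr_ge0// -expr2 sqr_ge0.
    rewrite -[leRHS]mul1r ler_pdivlMr//; apply: le_trans z1.
    rewrite /dot (bigID (fun l : 'I_n => l < r)%N)/= -[leLHS]add0r lerD//.
      by apply: sumr_ge0 => l _; rewrite -expr2 sqr_ge0.
    rewrite (eq_bigr (fun=> b ^+ 2)) => [|l]; last by rewrite -leqNgt => /hb->.
    rewrite sumr_const mulr_natr.
    suff -> : #|[pred i : 'I_n | ~~ (i < r)%N]| = (n - r)%N by [].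
    rewrite -[RHS]muln1 -sum_nat_const_nat big_geq_mkord -sum1_card.
    by apply: eq_bigl => i; rewrite !inE -leqNgt.
  have -> : #|[pred e | `[<E e Y>]]| =
      #|[pred e : {ffun 'I_n -> bool} | s - T <= \sum_l (-1) ^+ e l * y l]|.
    apply: eq_card => e; rewrite !inE; apply/asboolP/idP; rewrite /E /A /row_ge /= dE; lra.
  apply: le_trans (sign_count _ _ lam0) _; rewrite ler_pM2l ?exprn_gt0// ler_expR.
  apply: lerD; last by rewrite ler_wpM2l// sqr_ge0.
  by rewrite mulrBr opprB addrC lerD2l ler_wpM2l.
have n2 : (0 : R) < 2 ^+ n by rewrite exprn_gt0.
rewrite -(@lee_pmul2l _ (2 ^+ n)%:E)// muleA -EFinM.
apply: (@le_trans _ _ (\sum_e P (S `&` E e))%E); last first.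
  apply: le_trans (sum_measure_le P mS mE _ count) _.
    by rewrite mulr_ge0 ?expR_ge0// ltW.
  rewrite lee_pmul2l//; last by rewrite lte_fin mulr_gt0 ?expR_gt0.
  by apply: le_measure; rewrite ?inE//; exact: subIsetl.
have mAN : measurable (A `&` near_rows d V : set (borel_mx R k n)) by exact: measurableI.
have -> : ((2 ^+ n)%:E * P (A `&` near_rows d V) =
    \sum_(e : {ffun 'I_n -> bool}) P (A `&` near_rows d V))%E.
  have <- := fineK (fin_num_measure P _ mAN).
  by rewrite sumEFin sumr_const card_ffun card_bool card_ord -EFinM; congr EFin;
    rewrite -[RHS]mulr_natl natrX.
apply: lee_sum => e _.
have [_ inv] := haarP.
rewrite -(inv _ (OO e))//.
have mAO : measurable ([set Y : 'M[R]_(k, n) | (A `&` near_rows d V) (Y *m O e)]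
    : set (borel_mx R k n)).
  by have := measurable_mulmxr (O e) measurableT mAN; rewrite setTI.
rewrite (haar_frames mAO); apply: le_measure; rewrite ?inE.
- by apply: measurableI => //; exact: measurable_frames.
- exact: measurableI.
move=> Y [[YA YN] YY]; split => //; split => //.
move: YN; rewrite /near_rows /= mulmxA -{1}(fixV e) rdist_orth//.
Qed.

Let E0 : 'M[R]_(k, n) := \matrix_i delta_mx 0 (widen_ord kn i).

(** A rotation carries the first [r] rows of any frame to coordinate vectors. *)
Let near_rows_cst d V : V *m V^T = 1%:M -> P (near_rows d V) = P (near_rows d E0).
Proof.
move=> VV; have [U UU hU] := orth_standard kn (ltnW rk) VV.
have [_ inv] := haarP; rewrite -(inv U UU _ (measurable_near_rows d E0)).
have DE : D *m E0 = D *m V *m U.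
  apply/row_matrixP => i; rewrite [RHS]row_mul !row_pid; case: ifP => ir.
    by rewrite hU// rowK.
  by rewrite mul0mx.
congr (P _); apply/seteqP; split=> Y; by rewrite /near_rows /= DE mulmxA rdist_orth.
Qed.

(** Countably many cells cover the frames, and each cell that meets the frames
    is contained in a neighbourhood of one of them. *)
Let near_rows_gt0 d : 0 < d -> (0 < P (near_rows d E0))%E.
Proof.
move=> d0; rewrite lt_neqAle measure_ge0 andbT eq_sym; apply/eqP => h0.
suff F0 : P frames = 0%E by have [+ _] := haarP; rewrite F0 => /eqP; rewrite eq_sym onee_eq0.
apply: measure_negligible; first exact: measurable_frames.
have N0 : 0 < (k * n).+1%:R :> R by rewrite ltr0n.
pose eta := d / (k * n).+1%:R; have eta0 : 0 < eta by rewrite divr_gt0.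
pose C (q : 'M[int]_(k, n)) :=
  [set Y : 'M[R]_(k, n) | frames Y /\ forall i j, Num.floor (Y i j / eta) = q i j].
pose F (m : nat) : set (borel_mx R k n) := if unpickle m is Some q then C q else set0.
apply: (@negligibleS _ _ _ P (\bigcup_m F m)).
  move=> Y YY; exists (pickle (\matrix_(i, j) Num.floor (Y i j / eta))) => //.
  by rewrite /F pickleK; split => // i j; rewrite mxE.
apply: negligible_bigcup => m; rewrite /F; case: unpickle => [q|]; last exact: negligible_set0.
have [[V [VV Vq]]|/forallNP h] := pselect (exists V, C q V); last first.
  have C0 : C q = set0 by apply/seteqP; split=> Y // /h.
  by rewrite C0; exact: negligible_set0.
apply: (@negligibleS _ _ _ P (near_rows d V : set (borel_mx R k n))); last first.
  exists (near_rows d V); split => //; first exact: measurable_near_rows.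
  exact: etrans (near_rows_cst d VV) h0.
move=> Y [_ Yq]; apply: le_lt_trans (rdist_pid_le _ _ _) _.
apply: le_lt_trans (rdist_le_norm _ _) _.
apply: (@le_lt_trans _ _ ((k * n)%:R * eta)); last first.
  by rewrite /eta mulrCA gtr_pMr// ltr_pdivrMr// mul1r ltr_nat.
rewrite ler_wpM2l//; apply: le_mx_norm => [|i j]; first exact: ltW.
rewrite !mxE; have := Yq i j; rewrite -(Vq i j) => fYV.
have /andP[y1 y2] := floor_itv (Y i j / eta); have /andP[v1 v2] := floor_itv (V i j / eta).
rewrite fYV in y1 y2; rewrite intrD in y2 v2.
have -> : Y i j - V i j = (Y i j / eta - V i j / eta) * eta.
  by rewrite mulrBl !divfK ?gt_eqF.
rewrite normrM (gtr0_norm eta0) ger_pMl// ler_norml; apply/andP; split; lra.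
Qed.

Let measurable_mulmxl :
  measurable_fun setT (fun V : borel_mx R k n => D *m (V : 'M[R]_(k, n)) : borel_mx R k n).
Proof.
apply: measurable_borel_mx => i j.
rewrite [X in measurable_fun _ X](_ : _ =
    (fun V : borel_mx R k n => \sum_l D i l * (V : 'M[R]_(k, n)) l j)); last first.
  by apply/funext => V; rewrite mxE.
apply: measurable_sum => l; apply: measurable_funM => //.
exact: measurable_coord_mx.
Qed.

Definition first_rows (B : set 'M[R]_(k, n)) : set 'M[R]_(k, n) :=
  [set V | B (D *m V)].

Lemma measurable_first_rows (B : set (borel_mx R k n)) : measurable B ->
  measurable (first_rows B : set (borel_mx R k n)).
Proof. by move=> mB; have := measurable_mulmxl measurableT mB; rewrite setTI. Qed.

Let thick d (B : set 'M[R]_(k, n)) : set 'M[R]_(k, n) :=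
  [set Y | exists2 b, B b & rdist Y b < d].

Let open_thick d B : open (thick d B).
Proof.
rewrite openE => Y [b Bb Yb]; have N0 : 0 < (k * n).+1%:R :> R by rewrite ltr0n.
have e0 : 0 < (d - rdist Y b) / (k * n).+1%:R by rewrite divr_gt0// subr_gt0.
apply/nbhs_ballP; exists ((d - rdist Y b) / (k * n).+1%:R) => //= Z.
rewrite -ball_normE /= => YZ; exists b => //.
apply: le_lt_trans (rdist_triangle Z Y b) _; rewrite -ltrBrDr rdistC.
apply: le_lt_trans (rdist_le_norm _ _) _; move: YZ; rewrite ltr_pdivlMr// mulrC.
by apply: le_lt_trans; rewrite ler_wpM2r// ler_nat.
Qed.

Section Tail.
Variables (j : 'I_k) (x : 'rV[R]_n) (s lam : R).
Hypotheses (rj : (r <= j)%N) (x1 : l2norm x <= 1) (lam0 : 0 <= lam).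
Local Notation A := (row_ge j x s).
Local Notation M d := (expR (- (lam * s) + lam * (n%:R * d) + lam ^+ 2 / (n - r)%:R)).
Local Notation T := (borel_mx R k n).

(** Both sides of the estimate, multiplied by the mass of a small
    neighbourhood, are measures of sets of pairs of frames whose first rows are
    close; integrating in the other order uses [near_rows_tail]. *)
Let thick_tail d C : 0 < d -> closed C ->
  (P (A `&` first_rows C) <= (M d)%:E * P (first_rows (thick d C)))%E.
Proof.
move=> d0 cC; have mF := measurable_frames.
have mA : measurable (A : set T) by exact: measurable_row_ge.
have mC : measurable (first_rows C : set T).
  by apply: measurable_first_rows; exact: closed_borel_mx.
have mT : measurable (first_rows (thick d C) : set T).
  by apply: measurable_first_rows; apply: open_borel_mx; exact: open_thick.
pose G : set T := A `&` first_rows C `&` frames.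
have mG : measurable G by apply: measurableI => //; exact: measurableI.
pose F (V : T) (Y : 'M[R]_(k, n)) := rdist (D *m Y) (D *m (V : 'M[R]_(k, n))).
pose S : set (T * T) := (G `*` frames) `&` [set z | F z.1 z.2 < d].
have mS : measurable S.
  apply: measurableI; first exact: measurableX.
  have mF2 : measurable_fun setT (fun z : T * T => F z.1 z.2).
    apply: measurable_caratheodory => [Y|V]; last exact: continuous_rdist_pid.
    rewrite (_ : F ^~ Y = fun V : T => rdist (D *m (V : 'M[R]_(k, n))) (D *m Y)).
      exact: continuous_borel_mx (@continuous_rdist_pid R k n r Y).
    by apply/funext => V; rewrite /F rdistC.
  rewrite -[X in measurable X]setTI.
  by apply: (mF2 measurableT [set t | t < d]); rewrite -set_itvNyo; exact: measurable_itv.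
have c0 := near_rows_gt0 d0.
have cf : P (near_rows d E0) \is a fin_num.
  by apply: fin_num_measure; exact: measurable_near_rows.
rewrite -(@lee_pmul2l _ (P (near_rows d E0)))//.
have -> : (P (near_rows d E0) * P (A `&` first_rows C) = \int[P]_V P (xsection S V))%E.
  rewrite (haar_frames (measurableI _ _ mA mC)) -/G.
  rewrite -[in LHS](setIT G) -integral_indic// -ge0_integralZl//; last first.
    by apply/measurable_EFinP; exact: measurable_indic.
  apply: eq_integral => V _; rewrite indicE.
  case: (boolP (V \in G)) => [|/negP] VG; last first.
    rewrite mule0 (_ : xsection S V = set0) ?measure0//; apply/seteqP; split=> Y //.
    by rewrite /xsection /= inE => -[[/mem_set]].
  have {VG} VG : G V by rewrite inE in VG.
  rewrite mule1; case: (VG) => _ VV.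
  rewrite -(near_rows_cst d VV) (haar_frames (measurable_near_rows d V)).
  congr (P _); apply/seteqP; split=> Y; rewrite /xsection /= inE.
    by move=> [YV YY].
  by move=> [[_ YY] YV].
rewrite section_swap//.
apply: (@le_trans _ _ (\int[P]_Y ((M d)%:E * P (near_rows d E0) *
   (\1_(first_rows (thick d C)) Y)%:E))%E).
  apply: ge0_le_integral => //.
  - by apply: measurable_fun_ysection.
  - apply: measurable_funeM; apply/measurable_EFinP; exact: measurable_indic.
  move=> Y _; have [YS|nYS] := pselect (exists V, S (V, Y)); last first.
    rewrite (_ : ysection S Y = set0).
      by rewrite measure0 !mule_ge0 ?lee_fin ?expR_ge0.
    apply/seteqP; split=> V //; rewrite /ysection /= inE => SVY.
    by case: nYS; exists V.
  case: YS => V [[[[_ VC] _] YY] YV].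
  have TY : first_rows (thick d C) Y by exists (D *m V).
  rewrite indicE mem_set// mule1 -(near_rows_cst d YY).
  apply: le_trans (near_rows_tail s YY rj x1 lam0 d0).
  apply: le_measure; rewrite ?inE.
  - exact: measurable_ysection.
  - by apply: measurableI => //; exact: measurable_near_rows.
  move=> W; rewrite /ysection /= inE => -[[[[WA _] _] _] WY]; split => //.
  by rewrite /near_rows /= rdistC.
rewrite ge0_integralZl//; last 2 first.
- by apply/measurable_EFinP; exact: measurable_indic.
- by rewrite mule_ge0 ?lee_fin ?expR_ge0.
by rewrite integral_indic// setIT muleAC [leRHS]muleC.
Qed.

Let M0 := expR (- (lam * s) + lam ^+ 2 / (n - r)%:R).

(** A closed set is the limit of its neighbourhoods. *)
Let closed_tail C : closed C ->
  (P (A `&` first_rows C) <= M0%:E * P (first_rows C))%E.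
Proof.
move=> cC; pose Td m := first_rows (thick (m.+1%:R^-1) C) : set T.
have mTd m : measurable (Td m).
  by apply: measurable_first_rows; apply: open_borel_mx; exact: open_thick.
have TC : \bigcap_m Td m = first_rows C.
  apply/seteqP; split=> V /= h; last first.
    by move=> m _; exists (D *m V) => //; rewrite rdistxx.
  suff : closure C (D *m V) by rewrite -(closure_id C).1.
  move=> B /nbhs_ballP[e /= e0 eB].
  have [m] := @ltr_add_invr R 0 e e0; rewrite add0r => me.
  have [b Cb hb] := h m I; exists b; split => //; apply: eB.
  rewrite -ball_normE /=; apply: le_lt_trans (norm_le_rdist _ _) _.
  exact: lt_trans hb me.
have cvT : (P \o Td) @ \oo --> P (first_rows C).
  rewrite -TC; apply: nonincreasing_cvg_mu => //.
  - by rewrite -ge0_fin_numE// fin_num_measure.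
  - exact: bigcapT_measurable.
  apply/nonincreasing_seqP => m; apply/subsetPset => V [b Cb hb]; exists b => //.
  by apply: lt_le_trans hb _; rewrite lef_pV2 ?posrE// ler_nat.
have cvM : (fun m => (M (m.+1%:R^-1))%:E) @ \oo --> M0%:E.
  apply: cvg_EFin; first by near=> m.
  apply: continuous_cvg; first exact: continuous_expR.
  rewrite /M0 -[X in _ --> X + _]addr0; apply: cvgD; last exact: cvg_cst.
  apply: cvgD; first exact: cvg_cst.
  rewrite -(mulr0 lam); apply: cvgMr; rewrite -(mulr0 n%:R); apply: cvgMr.
  exact: cvg_harmonic.
have cvMT : ((M (m.+1%:R^-1))%:E * P (Td m))%E @[m --> \oo] --> (M0%:E * P (first_rows C))%E.
  apply: cvgeM cvM cvT.
  by rewrite mule_def_fin// fin_num_measure//; exact: measurable_first_rows (closed_borel_mx cC).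
rewrite -(cvg_lim _ cvMT)//; apply: lime_ge; first by apply/cvg_ex; eexists; exact: cvMT.
by apply: nearW => m; apply: thick_tail.
Unshelve. all: by end_near. Qed.

(** Conditionally on the first [r] rows, the row [j] has the tail of a random sum
    of [n - r] signs. Closed sets suffice by inner regularity. *)
Lemma borel_tail (B : set (borel_mx R k n)) : measurable B ->
  (P (A `&` first_rows B) <= M0%:E * P (first_rows B))%E.
Proof.
move=> mB; apply/lee_addgt0Pr => e e0.
have mA : measurable (A : set T) by exact: measurable_row_ge.
have mD : measurable_fun setT (fun V : T => D *m (V : 'M[R]_(k, n)) : T).
  exact: measurable_mulmxl.
pose nu : {measure set T -> \bar R} :=
  measure_function_pushforward__canonical__measure_function_Measure P mD.
have nuT : (nu setT < +oo)%E.
  by rewrite /nu /= /pushforward preimage_setT probability_setT ltry.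
have [C cC [CB hC]] := inner_regular_mx nuT mB e0.
have mC : measurable (C : set T) by exact: closed_borel_mx.
have mfB := measurable_first_rows mB; have mfC := measurable_first_rows mC.
have mfD : measurable (first_rows (B `\` C) : set T).
  by apply: measurable_first_rows; exact: measurableD.
have sub : A `&` first_rows B `<=` (A `&` first_rows C) `|` first_rows (B `\` C).
  move=> V [AV BV]; have [VC|VC] := pselect (C (D *m V)); [left|right]; split => //.
apply: le_trans (le_measure P _ _ sub) _; rewrite ?inE.
- exact: measurableI.
- by apply: measurableU => //; exact: measurableI.
apply: le_trans (measureU2 _ _ _) _ => //; first exact: measurableI.
apply: leeD; last exact: ltW.
apply: le_trans (closed_tail cC) _; rewrite lee_wpmul2l ?lee_fin ?expR_ge0//.
by apply: le_measure; rewrite ?inE// => V; exact: CB.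
Qed.

End Tail.

(** The query depends on the first [r] rows in an arbitrary measurable way, but on
    nothing else. *)
Definition bad_query (X : borel_mx R k n -> borel_mx R 1 n) (j : 'I_k) (t : R) :
    set (borel_mx R k n) :=
  [set V | l2norm (X (D *m (V : 'M[R]_(k, n))) : 'rV[R]_n) <= 1 /\
           t <= `|dot (row j (V : 'M[R]_(k, n))) (X (D *m (V : 'M[R]_(k, n))))| ].

Section Query.
Variables (j : 'I_k) (X : borel_mx R k n -> borel_mx R 1 n) (s t lam : R).
Hypotheses (rj : (r <= j)%N) (mX : measurable_fun setT X) (lam0 : 0 <= lam).
Hypothesis st : s < t.
Local Notation T := (borel_mx R k n).
Local Notation Y V := (X (D *m (V : 'M[R]_(k, n))) : 'rV[R]_n).
Let M0 := expR (- (lam * s) + lam ^+ 2 / (n - r)%:R).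

Let G : set T := [set V | t <= `|dot (row j (V : 'M[R]_(k, n))) (Y V)| ].

Let mG : measurable G.
Proof.
have mY : measurable_fun setT (fun V : T => Y V : borel_mx R 1 n).
  exact: measurableT_comp mX measurable_mulmxl.
pose f (V : T) := `|\sum_l (V : 'M[R]_(k, n)) j l * Y V 0 l|.
have mf : measurable_fun setT f.
  apply: measurableT_comp => //; apply: measurable_sum => l.
  apply: measurable_funM; first exact: measurable_coord_mx.
  exact: measurable_entry mY.
have -> : G = setT `&` f @^-1` [set` `[t, +oo[].
  have fE V : f V = `|dot (row j (V : 'M[R]_(k, n))) (Y V)|.
    by congr (`| _ |); apply: eq_bigr => l _; rewrite [row _ _ _ _]mxE.
  by rewrite setTI; apply/seteqP; split=> V; rewrite /G /= in_itv /= andbT fE.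
exact: mf.
Qed.

Let cell (x : 'rV[R]_n) : set T := [set V | l2norm ((X V : 'rV[R]_n) - x) <= t - s].

Let mcell x : measurable (cell x).
Proof.
by have := mX measurableT (measurable_l2ball x (t - s)); rewrite setTI.
Qed.

(** On a cell where the query point is almost constant, the fixed-point tail
    bound applies; the cells are disjointified along a list of centres. *)
Let list_tail (xs : seq 'rV[R]_n) (B : set T) : measurable B ->
  (forall x, x \in xs -> l2norm x <= 1) ->
  (forall V, B V -> exists2 x, x \in xs & cell x V) ->
  (P (G `&` frames `&` first_rows B) <= (2 * M0)%:E * P (first_rows B))%E.
Proof.
elim: xs B => [|x xs IH] B mB xs1 hB.
  rewrite (_ : _ `&` _ = set0) ?measure0 ?mule_ge0 ?lee_fin ?mulr_ge0 ?expR_ge0//.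
  by apply/seteqP; split=> V // [_ /hB[]].
have mF := measurable_frames.
have x1 : l2norm x <= 1 by apply: xs1; rewrite mem_head.
have nx1 : l2norm (- x) <= 1 by rewrite l2normN.
pose B1 := B `&` cell x; pose B2 := B `\` cell x.
have mB1 : measurable B1 by exact: measurableI.
have mB2 : measurable B2 by exact: measurableD.
have mf1 := measurable_first_rows mB1; have mf2 := measurable_first_rows mB2.
have mf := measurable_first_rows mB.
have PB : P (first_rows B) = (P (first_rows B1) + P (first_rows B2))%E.
  rewrite -measureU//.
    congr (P _); apply/seteqP; split=> V; rewrite /first_rows /B1 /B2 /=; last by case=> -[].
    by move=> BV; have [c|c] := pselect (cell x (D *m V)); [left|right].
  by apply/seteqP; split=> V // [[_ c] [_]].
have mA1 : measurable (row_ge j x s `&` first_rows B1 : set T).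
  by apply: measurableI => //; exact: measurable_row_ge.
have mA2 : measurable (row_ge j (- x) s `&` first_rows B1 : set T).
  by apply: measurableI => //; exact: measurable_row_ge.
have mA3 : measurable (G `&` frames `&` first_rows B2 : set T).
  by apply: measurableI => //; exact: measurableI.
have sub : G `&` frames `&` first_rows B `<=`
    (row_ge j x s `&` first_rows B1) `|` (row_ge j (- x) s `&` first_rows B1) `|`
    (G `&` frames `&` first_rows B2).
  move=> V [[GV VV] BV]; have [c|c] := pselect (cell x (D *m V)); [left|by right].
  have h : `|dot (row j V) (Y V - x)| <= t - s.
    rewrite (le_trans (cauchy_schwarz _ _))// [l2norm (row j V)]/l2norm row_dot VV.
    by rewrite mxE eqxx sqrtr1 mul1r.
  have : s <= `|dot (row j V) x|.
    have : dot (row j V) (Y V) = dot (row j V) x + dot (row j V) (Y V - x).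
      by rewrite -dotDr addrC subrK.
    move=> e; move: GV; rewrite /G /= e => /le_trans/(_ (ler_normD _ _)); lra.
  rewrite ler_normr => /orP[h1|h1]; [left|right]; split => //.
  by rewrite /row_ge /= dotNr.
apply: le_trans (le_measure P _ _ sub) _; rewrite ?inE.
- by apply: measurableI => //; exact: measurableI.
- by apply: measurableU => //; exact: measurableU.
apply: le_trans (measureU2 _ _ _) _ => //; first exact: measurableU.
rewrite PB ge0_muleDr ?measure_ge0//; apply: leeD.
  apply: le_trans (measureU2 _ _ _) _ => //.
  rewrite mulrDl mul1r EFinD ge0_muleDl ?lee_fin ?expR_ge0//.
  by apply: leeD; exact: borel_tail.
apply: IH => // [y ys|V [/hB[y]]]; first by apply: xs1; rewrite inE ys orbT.
by rewrite inE => /orP[/eqP->//|ys c _]; exists y.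
Qed.

Let net : exists2 xs : seq 'rV[R]_n, forall x, x \in xs -> l2norm x <= 1 &
  forall y : 'rV[R]_n, l2norm y <= 1 ->
    exists2 x, x \in xs & l2norm (y - x) <= t - s.
Proof.
have cC : compact (l2ball (0 : 'rV[R]_n) 1).
  apply: (subclosed_compact _ (@compact_mx_ball R n 1)); first exact: closed_l2ball.
  by move=> y /l2ball0P; apply: le_trans; exact: norm_le_l2norm.
pose f (x : 'rV[R]_n) : set 'rV[R]_n := [set y | l2norm (y - x) < t - s].
have fo x : open (f x).
  have -> : f x = (fun y => l2norm (y - x)) @^-1` [set u | u < t - s] by [].
  by apply: open_comp; [move=> ? _; exact: continuous_l2dist|exact: open_lt].
rewrite compact_cover in cC.
have [|xs xsC cov] := cC 'rV[R]_n (l2ball 0 1) f (fun x _ => fo x).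
  by move=> y yC; exists y => //; rewrite /f /= subrr l2norm0 subr_gt0.
exists (finmap.enum_fset xs) => [x xxs|y y1].
  by have := xsC _ xxs; rewrite inE => /l2ball0P.
have /cov[x xxs fxy] : l2ball 0 1 y by apply/l2ball0P.
by exists x => //; exact: ltW.
Qed.

Let B : set T := X @^-1` l2ball 0 1.

Let mB : measurable B.
Proof. by have := mX measurableT (measurable_l2ball 0 1); rewrite setTI. Qed.

Let bad_queryE : bad_query X j t = G `&` first_rows B.
Proof. by apply/seteqP; split=> V [h1 h2]; split => //; apply/l2ball0P. Qed.

Lemma measurable_bad_query : measurable (bad_query X j t).
Proof.
by rewrite bad_queryE; apply: measurableI => //; exact: measurable_first_rows.
Qed.

Lemma query_tail : (P (bad_query X j t) <= (2 * M0)%:E)%E.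
Proof.
have [xs xs1 cov] := net; have mfB := measurable_first_rows mB.
rewrite bad_queryE haar_frames; last exact: measurableI.
rewrite setIAC; apply: le_trans (list_tail mB xs1 _) _.
  by move=> V /l2ball0P/cov[x xxs h]; exists x.
by rewrite -[leRHS]mule1 lee_wpmul2l ?probability_le1// lee_fin mulr_ge0 ?expR_ge0.
Qed.

End Query.

(** The moment parameter [s * n / 4] is optimal when all that is known about
    [n - r] is that it is at least [n / 2]. *)
Lemma moment_le (s : R) : (r * 2 <= n)%N ->
  - (s * n%:R / 4 * s) + (s * n%:R / 4) ^+ 2 / (n - r)%:R <= - (s ^+ 2 * n%:R / 8).
Proof.
move=> rn2; have n0 : 0 < n%:R :> R by rewrite ltr0n (leq_ltn_trans _ rn).
have m0 : 0 < (n - r)%:R :> R by rewrite ltr0n subn_gt0.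
have nm : n%:R <= 2 * (n - r)%:R :> R.
  rewrite -natrM ler_nat mulnBr leq_subRL; last by rewrite leq_mul2l ltnW.
  by rewrite (mulnC 2 r) (mul2n n) -addnn leq_add2r.
suff : (s * n%:R / 4) ^+ 2 / (n - r)%:R <= s ^+ 2 * n%:R / 8 by lra.
rewrite ler_pdivrMr//.
have -> : (s * n%:R / 4) ^+ 2 = s ^+ 2 * n%:R / 16 * n%:R by field.
have -> : s ^+ 2 * n%:R / 8 * (n - r)%:R = s ^+ 2 * n%:R / 16 * (2 * (n - r)%:R) by field.
by rewrite ler_wpM2l// divr_ge0// mulr_ge0 ?sqr_ge0// ltW.
Qed.

Lemma first_rows_tail (j : 'I_k) (X : borel_mx R k n -> borel_mx R 1 n) (s t : R) :
  (r <= j)%N -> measurable_fun setT X -> 0 <= s < t -> (r * 2 <= n)%N ->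
  (P (bad_query X j t) <= (2 * expR (- (s ^+ 2 * n%:R / 8)))%:E)%E.
Proof.
move=> rj mX /andP[s0 st] rn2.
have lam0 : 0 <= s * n%:R / 4 by rewrite divr_ge0// mulr_ge0.
apply: le_trans (query_tail rj mX lam0 st) _.
by rewrite lee_fin ler_pM2l// ler_expR moment_le.
Qed.

Lemma row_tail (j : 'I_k) (x : 'rV[R]_n) (s : R) (B : set (borel_mx R k n)) :
  (r <= j)%N -> l2norm x <= 1 -> 0 <= s -> (r * 2 <= n)%N -> measurable B ->
  (P ((row_ge j x s `|` row_ge j (- x) s) `&` first_rows B) <=
    (2 * expR (- (s ^+ 2 * n%:R / 8)))%:E * P (first_rows B))%E.
Proof.
move=> rj x1 s0 rn2 mB; have nx1 : l2norm (- x) <= 1 by rewrite l2normN.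
have lam0 : 0 <= s * n%:R / 4 by rewrite divr_ge0// mulr_ge0.
have mf := measurable_first_rows mB.
have bound y : l2norm y <= 1 -> (P (row_ge j y s `&` first_rows B) <=
    (expR (- (s ^+ 2 * n%:R / 8)))%:E * P (first_rows B))%E.
  move=> y1; apply: le_trans (borel_tail s rj y1 lam0 mB) _.
  by rewrite lee_wpmul2r// lee_fin ler_expR moment_le.
rewrite setIUl; apply: le_trans (measureU2 _ _ _) _.
- by apply: measurableI => //; exact: measurable_row_ge.
- by apply: measurableI => //; exact: measurable_row_ge.
rewrite mulrDl mul1r EFinD ge0_muleDl ?lee_fin ?expR_ge0//.
by apply: leeD; exact: bound.
Qed.

End Haar.

(** * Measurability of oracle answers *)

Section OracleMeasurable.
Context {R : realType} d (T : measurableType d).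
Variables (n p : nat) (F : T -> 'rV[R]_n -> R).
Hypothesis mF : forall x, measurable_fun setT (F ^~ x).
Hypothesis CF : forall t, Ck p (F t).

(** A partial derivative is a limit of difference quotients along a sequence. *)
Lemma measurable_partials (s : seq 'I_n) x : (size s <= p)%N ->
  measurable_fun setT (fun t => partials s (F t) x).
Proof.
elim: s x => [|i s IH] x /= sp; first exact: mF.
pose q (m : nat) (t : T) := (m.+1%:R^-1 : R)^-1 *
  (partials s (F t) (m.+1%:R^-1 *: delta_mx 0 i + x) - partials s (F t) x).
apply: (measurable_fun_cvg (h := q)) => [m|t _].
  apply: measurable_funM => //; apply: measurable_funB; exact: IH (ltnW sp).
have /cvg_ex[l hl] := derivable_partials (i := i) (x := x) sp (CF t).
have -> : 'D_(delta_mx 0 i) (partials s (F t)) x = l by exact: cvg_lim hl.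
have := hl; rewrite /q => h.
apply: (@cvg_comp _ _ _ (fun m : nat => (m.+1%:R^-1 : R))
  (fun h : R => h^-1 *: (partials s (F t) (h *: delta_mx 0 i + x) - partials s (F t) x))
  \oo (0 : R)^').
  move=> A [e /= e0 eA].
  have [m _ hm] := near_infty_natSinv_lt (PosNum e0).
  exists m => // m' /= mm'; apply: eA; last by rewrite invr_eq0 pnatr_eq0.
  by rewrite /= sub0r normrN ger0_norm//; exact: hm.
exact: hl.
Qed.

Lemma measurable_oracle (X : T -> 'rV[R]_n) :
  measurable_fun setT (X : T -> borel_mx R 1 n) ->
  measurable_fun setT (fun t => oracle p (F t) (X t) : borel_mx R 1 (jet_size n p)).
Proof.
move=> mX; apply: measurable_borel_mx => i a.
rewrite (_ : (fun t => _) = (fun t => \1_(X @^-1` l2ball 0 1) t *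
    partials (tval (tagged (enum_val a))) (F t) (X t))); last first.
  apply/funext => t; rewrite /oracle indicE; case: ifP => x1.
    by rewrite mem_set ?mul1r ?mxE//; apply/l2ball0P.
  by rewrite memNset ?mul0r ?mxE// => /l2ball0P; rewrite x1.
apply: measurable_funM.
  apply: measurable_indic; rewrite -[X in measurable X]setTI.
  by apply: mX => //; exact: measurable_l2ball.
set s := tval _; have sp : (size s <= p)%N by rewrite size_tuple -ltnS.
have mj : measurable_fun setT (fun z : T * borel_mx R 1 n => partials s (F z.1) z.2).
  apply: (@measurable_caratheodory R d T 1 n (fun t x => partials s (F t) x)) => [x|t].
     exact: measurable_partials.
  exact: Ck_continuous (Ck_partials sp (CF t)).
exact: (measurableT_comp mj (measurable_fun_pair (@measurable_id _ T setT) mX)).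
Qed.

End OracleMeasurable.

Section HardFunctionMeasurable.
Context {R : realType}.
Variables (c : R) (p n : nat).
Hypotheses (hc : 40 <= c) (hL : 40 <= ln (n%:R : R)) (k0 : (0 < dimk c n)%N).
Local Notation k := (dimk c n).
Local Notation T := (borel_mx R k n).

Lemma Ck_g_upto (V : 'M[R]_(k, n)) r : (0 < r)%N -> Ck p (g_upto p V r).
Proof.
move=> r0; apply: Ck_multi_smooth; first exact: ltW (beta_gt0 hc hL).
by apply: continuous_h_upto => //; exact: rho_gt0.
Qed.

Lemma continuous_param (f : 'M[R]_(k, n) -> R) (B : R) : 0 <= B ->
  (forall V V', f V <= f V' + B * `|V - V'|) -> continuous f.
Proof.
move=> B0 h; apply/continuous_mxP => V e e0; have B1 : 0 < B + 1 by rewrite ltr_wpDl.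
exists (e / (B + 1)); first by rewrite divr_gt0.
move=> V'; rewrite ltr_pdivlMr// mulrC => hV; apply: le_lt_trans hV.
apply: (@le_trans _ _ (B * `|V - V'|)); last by rewrite ler_wpM2r// lerDl.
have h1 := h V V'; have h2 := h V' V; rewrite distrC in h2.
by rewrite ler_norml; apply/andP; split; lra.
Qed.

Lemma measurable_g_upto r x : (0 < r)%N ->
  measurable_fun [set: T] (fun V : T => g_upto p (V : 'M[R]_(k, n)) r x).
Proof.
move=> r0; apply: continuous_borel_mx.
have b0 := beta_gt0 hc hL.
apply: (@continuous_param _ (n%:R * (l2norm x + beta c n))).
  by rewrite mulr_ge0// addr_ge0 ?l2norm_ge0// ltW.
move=> V V'; rewrite mulrAC; apply: g_upto_le => //; exact: rho_gt0.
Qed.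

(** The infimum over the unit ball is Lipschitz in the frame. *)
Lemma measurable_inf_g :
  measurable_fun [set: T] (fun V : T =>
    inf [set g_fun p (V : 'M[R]_(k, n)) z | z in l2ball 0 1]).
Proof.
apply: continuous_borel_mx; have b0 := beta_gt0 hc hL.
have ball1 : [set z | l2ball (0 : 'rV[R]_n) 1 z] 0 by apply/l2ball0P; rewrite l2norm0.
pose B : R := n%:R * (1 + beta c n).
have B0 : 0 <= B by rewrite mulr_ge0// addr_ge0// ltW.
have lip (V V' : 'M[R]_(k, n)) (x : 'rV[R]_n) : l2norm x <= 1 -> g_fun p V x <= g_fun p V' x + B * `|V - V'|.
  move=> x1; apply: (@le_trans _ _ (g_fun p V' x + n%:R * `|V - V'| * (l2norm x + beta c n))).
    by apply: g_upto_le => //; exact: rho_gt0.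
  by rewrite lerD2l /B mulrAC ler_wpM2r// ler_wpM2l// lerD2r.
have lb (V : 'M[R]_(k, n)) : has_lbound [set g_fun p V z | z in l2ball 0 1].
  have [M hM] := @continuous_bounded_ball R n (g_fun p V) 1
    (Ck_continuous (Ck_g_upto V k0)).
  exists (- M) => _ [z /l2ball0P z1 <-].
  have := hM z (le_trans (norm_le_l2norm _) z1).
  by rewrite ler_norml => /andP[].
apply: (continuous_param B0) => V V'.
rewrite -lerBlDr; apply: lb_le_inf; first by exists (g_fun p V' 0), 0.
move=> _ [z zb <-]; rewrite lerBlDr; have /l2ball0P z1 := zb.
by apply: le_trans (lip V V' z z1); apply: ge_inf => //; exists z.
Qed.

End HardFunctionMeasurable.

(** * Parallel algorithms *)

Lemma union_bound {R : realType} d' (S : measurableType d') (mu : {measure set S -> \bar R})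
    (I : finType) (B : set S) (E : I -> set S) (a : R) :
  measurable B -> (forall i, measurable (E i)) -> (forall i, mu (E i) <= a%:E)%E ->
  (forall x, B x -> exists i, E i x) -> (mu B <= (#|I|%:R * a)%:E)%E.
Proof.
move=> mB mE Ea BE.
have [mU muU] : measurable (\big[setU/set0]_(i : I) E i) /\
    (mu (\big[setU/set0]_(i : I) E i) <= (\sum_(i : I) a)%:E)%E.
  elim/big_rec2 : _ => [|i y1 y2 _ [m1 h1]]; first by rewrite measure0.
  split; first exact: measurableU.
  by apply: le_trans (measureU2 _ _ _) _ => //; rewrite EFinD; exact: leeD (Ea i) h1.
apply: (@le_trans _ _ (mu (\big[setU/set0]_(i : I) E i))).
  apply: le_measure; rewrite ?inE// => x /BE[i Ei].
  by rewrite (bigD1 i)//=; left.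
by apply: le_trans muU _; rewrite sumr_const mulr_natl.
Qed.

Section Parallel.
Context {R : realType}.
Variables (c : R) (p n K : nat) (d : measure_display) (W : measurableType d).
Hypotheses (hc : 40 <= c) (hL : 40 <= ln (n%:R : R)) (k0 : (0 < dimk c n)%N).
Local Notation k := (dimk c n).
Local Notation T := (borel_mx R k n).
Local Notation N := (jet_size n p).
Variable A : par_alg (R := R) n N K W.
Implicit Types V : 'M[R]_(k, n).

(** Like [par_history], but the function that answers may change with the round,
    as it does in the hybrid run. *)
Fixpoint history (G : nat -> 'rV[R]_n -> R) (w : W) (r : nat) :
    r.-tuple (borel_mx R K N) :=
  match r return r.-tuple (borel_mx R K N) with
  | 0%N => [tuple]
  | r'.+1 => [tuple of rcons (history G w r')
       (par_answers (oracle p (G r')) (par_query A (w, history G w r')))]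
  end.

Lemma par_historyE g w r : par_history A (oracle p g) w r = history (fun=> g) w r.
Proof. by elim: r => [//|r IH]; apply/val_inj; rewrite /= IH. Qed.

Lemma eq_history G G' w r : (forall i, (i < r)%N -> G i = G' i) ->
  history G w r = history G' w r.
Proof.
elim: r => [//|r IH] h; apply/val_inj; rewrite /= IH ?h// => i ir.
by apply: h; exact: ltnW.
Qed.

Lemma measurable_history d' (S : measurableType d') (F : nat -> S -> 'rV[R]_n -> R)
    (w : S -> W) r :
  (forall i x, measurable_fun setT (F i ^~ x)) -> (forall i t, Ck p (F i t)) ->
  measurable_fun setT w ->
  measurable_fun setT (fun t => history (F ^~ t) (w t) r).
Proof.
move=> mF CF mw; elim: r => [|r IH]; first exact: measurable_cst.
have mq : measurable_fun setT (fun t => par_query A (w t, history (F ^~ t) (w t) r)).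
  apply: measurableT_comp; first exact: par_query_meas.
  exact: measurable_fun_pair.
apply/measurable_fun_tnthP => i /=.
have [ir|ri] := ltnP i r.
  rewrite (_ : _ \o _ = fun t => tnth (history (F ^~ t) (w t) r) (Ordinal ir)).
    by have /measurable_fun_tnthP/(_ (Ordinal ir)) := IH.
  apply/funext => t /=; rewrite !(tnth_nth 0) /= nth_rcons size_tuple ir//.
have {ri} ri : val i = r by apply/eqP; rewrite eqn_leq ri -ltnS ltn_ord.
rewrite (_ : _ \o _ = fun t => par_answers (oracle p (F r t))
    (par_query A (w t, history (F ^~ t) (w t) r))); last first.
  by apply/funext => t /=; rewrite (tnth_nth 0) /= nth_rcons size_tuple ri ltnn eqxx.
apply: measurable_borel_mx => l a.
rewrite (_ : (fun t => _) = fun t => oracle p (F r t)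
    (row l (par_query A (w t, history (F ^~ t) (w t) r))) 0 a); last first.
  by apply/funext => t; rewrite mxE.
apply: measurable_entry; apply: measurable_oracle => //.
apply: measurable_borel_mx => i' b.
rewrite (_ : (fun t => _) = fun t => (par_query A (w t, history (F ^~ t) (w t) r)
  : 'M[R]_(K, n)) l b); last by apply/funext => t; rewrite mxE.
exact: measurable_entry.
Qed.

Local Notation gam := (gamma c n).

Lemma g_upto_first_rows V r i :
  (0 < i <= r)%N -> g_upto (c := c) p (pid_mx r *m V) i = g_upto p V i.
Proof.
move=> /andP[i0 ir]; rewrite /g_upto; congr multi_smooth; apply/funext => x.
have r0 := rho_gt0 p hc hL.
have h (j : 'I_k) : (j < i)%N -> row j (pid_mx r *m V) = row j V.
  by move=> ji; rewrite row_pid (leq_trans ji ir).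
apply/eqP; rewrite eq_le; apply/andP; split; rewrite -[leRHS]addr0;
  by apply: h_upto_le => // j ji; rewrite h// addr0.
Qed.

(** The queries of the round [r] are functions of the first [r] rows. *)
Let hybrid (V : T) w r := history (fun i => g_upto p (V : 'M[R]_(k, n)) i.+1) w r.

Let hybrid_first_rows V w r : hybrid (pid_mx r *m V) w r = hybrid V w r.
Proof. by apply: eq_history => i ir; exact: g_upto_first_rows. Qed.

Let query w r (l : 'I_K) (V : T) : borel_mx R 1 n :=
  row l (par_query A (w, hybrid V w r)).
Let output w (V : T) : borel_mx R 1 n :=
  par_output (p := A) (w, hybrid V w (par_rounds A)).

Let measurable_hybrid w r : measurable_fun setT (fun V : T => hybrid V w r).
Proof.
apply: (@measurable_history _ T (fun i (V : T) => g_upto p (V : 'M[R]_(k, n)) i.+1) (fun=> w)).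
- by move=> i x; exact: measurable_g_upto.
- by move=> i V; exact: Ck_g_upto.
- exact: measurable_cst.
Qed.

Let measurable_query w r l : measurable_fun setT (query w r l).
Proof.
apply: measurable_borel_mx => i b; rewrite (_ : (fun t => _) =
    fun V : T => (par_query A (w, hybrid V w r) : 'M[R]_(K, n)) l b); last first.
  by apply/funext => t; rewrite mxE.
apply: measurable_entry; apply: measurableT_comp; first exact: par_query_meas.
by apply: measurable_fun_pair; [exact: measurable_cst|exact: measurable_hybrid].
Qed.

Let measurable_output w : measurable_fun setT (output w).
Proof.
apply: measurableT_comp; first exact: par_output_meas.
by apply: measurable_fun_pair; [exact: measurable_cst|exact: measurable_hybrid].
Qed.

(** By induction on the rounds: equal histories give equal queries, and by
    [jet_g_upto] a query that correlates with no unknown row gets the same answer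
    in both runs. *)
Let history_hybrid V w r : V *m V^T = 1%:M -> (r < k)%N ->
  (forall i l (j : 'I_k), (i < r)%N -> (i <= j)%N -> ~ bad_query i (query w i l) j (gam / 4) V) ->
  history (fun=> g_fun p V) w r = hybrid V w r.
Proof.
move=> VV; elim: r => [//|r IH] rk good.
have e := IH (ltnW rk) (fun i l j ir => good i l j (ltnW ir)).
apply/val_inj; rewrite /= e; congr rcons; apply/matrixP => l a; rewrite !mxE.
rewrite /oracle; case: ifP => // x1.
suff -> : jet p (g_fun p V) (row l (par_query A (w, hybrid V w r))) =
  jet p (g_upto p V r.+1) (row l (par_query A (w, hybrid V w r))) by [].
apply: jet_g_upto => // [j||j rj]; [|exact: ltnW|]; first by rewrite l2norm_row.
rewrite leNgt; apply/negP => bad; apply: (good r l j (ltnSn r) rj).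
rewrite /bad_query /= /query hybrid_first_rows; split => //.
exact: ltW.
Qed.

Variables (P : probability T R) (Q : probability W R).
Hypothesis haarP : haar_frame P.
Hypothesis rounds_lt : (par_rounds A < k)%N.

Let success : set (T * W) := [set Vw |
  let g := g_fun p (Vw.1 : 'M[R]_(k, n)) in
  eps_optimal g (epsilon c n) (par_run A (oracle p g) Vw.2)].

(** Measurability in the pair allows the integral over the frame to be taken
    first, for fixed internal randomness. *)
Let measurable_success : measurable success.
Proof.
pose x (z : T * W) : 'rV[R]_n :=
  par_output (p := A) (z.2, history (fun=> g_fun p (z.1 : 'M[R]_(k, n))) z.2 (par_rounds A)).
have mg y : measurable_fun setT (fun z : T * W => g_fun p (z.1 : 'M[R]_(k, n)) y).
  exact: (measurableT_comp (measurable_g_upto p hc hL k0 y k0) measurable_fst).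
have Cg (z : T * W) : Ck p (g_fun p (z.1 : 'M[R]_(k, n))) by exact: (Ck_g_upto p hc hL k0 _ k0).
have mx : measurable_fun setT (x : T * W -> borel_mx R 1 n).
  apply: measurableT_comp; first exact: par_output_meas.
  apply: measurable_fun_pair; first exact: measurable_snd.
  exact: (@measurable_history _ _ (fun _ (z : T * W) => g_fun p (z.1 : 'M[R]_(k, n)))
    snd (par_rounds A) (fun _ y => mg y) (fun _ z => Cg z) measurable_snd).
have mgx : measurable_fun setT (fun z : T * W => g_fun p (z.1 : 'M[R]_(k, n)) (x z) -
    inf [set g_fun p (z.1 : 'M[R]_(k, n)) y | y in l2ball 0 1]).
  apply: measurable_funB.
    have mj : measurable_fun setT (fun z : T * borel_mx R 1 n =>
        g_fun p (z.1 : 'M[R]_(k, n)) z.2).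
      apply: (@measurable_caratheodory R _ T 1 n (fun V : T => g_fun p (V : 'M[R]_(k, n)))).
        by move=> y; exact: measurable_g_upto.
      by move=> V; apply: Ck_continuous (Ck_g_upto p hc hL k0 _ k0).
    exact: (measurableT_comp mj (measurable_fun_pair measurable_fst mx)).
  exact: (measurableT_comp (measurable_inf_g p hc hL k0) measurable_fst).
have -> : success = (x @^-1` l2ball 0 1) `&` (fun z : T * W => g_fun p (z.1 : 'M[R]_(k, n)) (x z) -
    inf [set g_fun p (z.1 : 'M[R]_(k, n)) y | y in l2ball 0 1]) @^-1` [set` `]-oo, epsilon c n]].
  apply/seteqP; split=> -[V w]; rewrite /success /eps_optimal /par_run /=
    par_historyE in_itv /= => -[x1 xe]; split => //; exact/l2ball0P.
apply: measurableI.
  by rewrite -[X in measurable X]setTI; apply: mx => //; exact: measurable_l2ball.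
by rewrite -[X in measurable X]setTI; apply: mgx => //; exact: measurable_itv.
Qed.

(** The threshold is slightly below the [1 / 4] of [bad_query]: the difference
    leaves room for replacing the query by a point of a finite net. *)
Let tail : R := 2 * expR (- ((gam * (24 / 100)) ^+ 2 * n%:R / 8)).

Let success_section w :
  (P [set V : T | success (V, w)] <= (((par_rounds A * K * k).+1)%:R * tail)%:E)%E.
Proof.
have kn := dim_le hc hL k0; have g0 := gamma_gt0 hc hL.
have mS : measurable [set V : T | success (V, w)].
  have := measurable_ysection w measurable_success.
  by congr measurable; apply/seteqP; split=> V; rewrite /ysection /= inE.
pose m := par_rounds A.
have lastP : (k.-1 < k)%N by rewrite prednK.
pose last := Ordinal lastP.
pose E (o : option ('I_m * 'I_K * 'I_k)) : set T :=
  if o is Some (r, l, j) then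
    if (r <= j)%N then bad_query r (query w r l) j (gam / 4) else set0
  else bad_query m (output w) last (gam / 4).
rewrite (haar_frames haarP)//.
have -> : (m * K * k).+1 = #|{: option ('I_m * 'I_K * 'I_k)}|.
  by rewrite card_option !card_prod !card_ord.
have kk r : (r < k)%N -> (r * 2 <= n)%N.
  by move=> rk; apply: leq_trans (double_dim_le hc hL k0); rewrite leq_mul2r ltnW.
have st : 0 <= gam * (24 / 100) < gam / 4 by apply/andP; split; lra.
apply: (union_bound (E := E)).
- by apply: measurableI => //; exact: measurable_frames.
- case=> [[[r l] j]|] /=; last exact: measurable_bad_query.
  case: ifP => // _; apply: measurable_bad_query => //; exact: ltn_trans (ltn_ord r) _.
- case=> [[[r l] j]|] /=; last first.
    apply: first_rows_tail => //; last exact: kk.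
    by rewrite /last /= -ltnS prednK.
  have rk : (r < k)%N by exact: ltn_trans (ltn_ord r) _.
  case: ifP => [rj|_]; last by rewrite measure0 lee_fin mulr_ge0 ?expR_ge0.
  by apply: first_rows_tail => //; exact: kk.
move=> V [[x1 xe] VV].
apply: contrapT => /forallNP nE.
have hE : history (fun=> g_fun p (V : 'M[R]_(k, n))) w m = hybrid V w m.
  apply: history_hybrid => // i l j im ij bad.
  by apply: (nE (Some (Ordinal im, l, j))); rewrite /= ij.
apply: (nE None); rewrite /= /bad_query /= /output hybrid_first_rows.
move: x1 xe; rewrite /par_run par_historyE hE => x1 xe; split => //.
have := eps_optimal_dot hc hL k0 VV (j := last) (prednK k0) (conj x1 xe).
by rewrite -ltrN2 opprK => h; apply: le_trans (ltW h) _; rewrite -normrN ler_norm.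
Qed.

Lemma parallel_success :
  ((P \x Q) success <= (((par_rounds A * K * k).+1)%:R * tail)%:E)%E.
Proof.
have mS := measurable_success.
rewrite [leLHS](_ : _ = \int[P]_V Q (xsection success V))%E// section_swap//.
apply: (@le_trans _ _ (\int[Q]_w cst (((par_rounds A * K * k).+1)%:R * tail)%:E w)%E).
  apply: ge0_le_integral => //.
  - exact: measurable_fun_ysection.
  - move=> w _; apply: le_trans (success_section w).
    suff -> : ysection success w = [set V | success (V, w)] by [].
    by apply/seteqP; split=> V; rewrite /ysection /= inE.
rewrite integral_cst// -[leRHS]mule1 lee_wpmul2l ?probability_le1//.
by rewrite lee_fin mulr_ge0// mulr_ge0 ?expR_ge0.
Qed.

End Parallel.

(** * Quantum query algorithms *)

Section Amplitudes.
Context {R : realType} (n N : nat) (A : quantum_alg (R := R) n N).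
Local Notation B := (qalg_basis A).
Local Notation C := R[i].
Local Notation X := (n.-tuple ((qalg_in_bits A).-tuple bool)).
Local Notation Y := (N.-tuple ((qalg_out_bits A).-tuple bool)).
Implicit Types (f g : X -> Y) (v u : 'cV[C]_#|{: B}|) (z : B).

Definition qpoint (x : X) : 'rV[R]_n := \row_i fixed_decode (qalg_in_frac A) (tnth x i).

(** The algorithm only sees the oracle through this finite table. *)
Definition qtable (O : 'rV[R]_n -> 'rV[R]_N) (x : X) : Y :=
  [tuple fixed_encode (qalg_out_bits A) (qalg_out_frac A) (O (qpoint x) 0 j) | j < N].

Definition qflip f z : B :=
  let: (x, b, w) := z in
  (x, [tuple [tuple tnth (tnth b j) i (+) tnth (tnth (f x) j) i
        | i < qalg_out_bits A] | j < N], w).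

Lemma qflipE O z : qoracle_basis O z = qflip (qtable O) z.
Proof.
case: z => -[x b] w; congr (_, _, _); apply: eq_from_tnth => j; rewrite !tnth_mktuple.
by apply: eq_from_tnth => i; rewrite !tnth_mktuple.
Qed.

Lemma qflipK f : involutive (qflip f).
Proof.
case=> -[x b] w; congr (_, _, _); apply: eq_from_tnth => j; rewrite !tnth_mktuple.
by apply: eq_from_tnth => i; rewrite !tnth_mktuple -addbA addbb addbF.
Qed.

Lemma qflip_reg f z : (qflip f z).1.1 = z.1.1.
Proof. by case: z => -[x b] w. Qed.

Lemma eq_qflip f g z : f z.1.1 = g z.1.1 -> qflip f z = qflip g z.
Proof. by case: z => -[x b] w /= e; rewrite e. Qed.

Definition qop f : 'M[C]_#|{: B}| :=
  \matrix_(r, s) (enum_val r == qflip f (enum_val s))%:R.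

Definition amp v z : C := v (enum_rank z) 0.

Lemma amp_qop f v z : amp (qop f *m v) z = amp v (qflip f z).
Proof.
rewrite /amp mxE (bigD1 (enum_rank (qflip f z)))//= big1 => [|s /eqP sz].
  by rewrite mxE !enum_rankK qflipK eqxx mul1r addr0.
rewrite mxE enum_rankK; case: eqP => [e|_]; last by rewrite mul0r.
by case: sz; rewrite e qflipK enum_valK.
Qed.

Definition sqnorm (a : C) : R := complex.Re a ^+ 2 + complex.Im a ^+ 2.

Lemma sqnorm_ge0 a : 0 <= sqnorm a.
Proof. by rewrite addr_ge0 ?sqr_ge0. Qed.

(** Weighted so that the errors of [t] steps add up to [t] times the sum of
    their squares. *)
Lemma sqnorm_add_le (t : R) a b : 0 <= t ->
  t * sqnorm (a + b) <= (t + 1) * sqnorm a + t * (t + 1) * sqnorm b.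
Proof.
move=> t0; case: a b => [a1 a2] [b1 b2]; rewrite /sqnorm /=.
have := sqr_ge0 (a1 - t * b1); have := sqr_ge0 (a2 - t * b2); nra.
Qed.

Lemma sqnorm_sub_le a b : sqnorm (a - b) <= 2 * sqnorm a + 2 * sqnorm b.
Proof.
case: a b => [a1 a2] [b1 b2]; rewrite /sqnorm /=.
have := sqr_ge0 (a1 + b1); have := sqr_ge0 (a2 + b2); nra.
Qed.

Definition nsq v : R := \sum_z sqnorm (amp v z).

Lemma nsq_qop f v : nsq (qop f *m v) = nsq v.
Proof.
rewrite /nsq [RHS](reindex_inj (inv_inj (qflipK f))) /=.
by apply: eq_bigr => z _; rewrite amp_qop.
Qed.

Lemma nsq_unitary (U : 'M[C]_#|{: B}|) v : U \is unitarymx -> nsq (U *m v) = nsq v.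
Proof.
move=> /unitarymxP UU.
have nsqE u : (nsq u)%:C%C = \sum_s (u s 0)^* * u s 0.
  rewrite /nsq rmorph_sum (reindex (@enum_rank {: B})) /=; last first.
    by exists enum_val => s _; rewrite ?enum_rankK ?enum_valK.
  apply: eq_bigr => z _; rewrite /amp; case: (u _ _) => a b.
  by rewrite /sqnorm; apply/eqP; rewrite eq_complex /=; apply/andP; split; apply/eqP; ring.
have dE u : \sum_s (u s 0)^* * u s 0 = ((u ^t*)%sesqui *m u) 0 0.
  by rewrite mxE; apply: eq_bigr => s _; rewrite !mxE.
apply: (@complexI R); rewrite !nsqE !dE trmx_mul map_mxM mulmxA.
by rewrite -(mulmxA (v ^t*)%sesqui) (mulmx1C UU) mulmx1.
Qed.

(** Like [qstate], but the answers may change from query to query. *)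
Fixpoint qrun (G : nat -> X -> Y) (t : nat) : 'cV[C]_#|{: B}| :=
  match t with
  | 0%N => qalg_U A 0 *m delta_mx (enum_rank (qzero _ _ _ _ _ : B)) 0
  | t'.+1 => qalg_U A t *m (qop (G t') *m qrun G t')
  end.

Lemma qstateE O t : qstate A O t = qrun (fun=> qtable O) t.
Proof.
have E : qoracle A O = qop (qtable O).
  by apply/matrixP => r s; rewrite !mxE qflipE.
elim: t => [|t IH]; first exact: erefl.
rewrite -[RHS]/(qalg_U A t.+1 *m (qop (qtable O) *m qrun (fun=> qtable O) t)) -IH -E.
exact: erefl.
Qed.

Lemma eq_qrun G G' t : (forall i, (i < t)%N -> G i = G' i) -> qrun G t = qrun G' t.
Proof.
elim: t => [|t IH] h; first exact: erefl.
rewrite -[LHS]/(qalg_U A t.+1 *m (qop (G t) *m qrun G t)).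
rewrite -[RHS]/(qalg_U A t.+1 *m (qop (G' t) *m qrun G' t)) h// IH// => i it.
by apply: h; exact: ltnW.
Qed.

Lemma nsq_qrun G t : nsq (qrun G t) = 1.
Proof.
elim: t => [|t IH].
  rewrite -[qrun G 0]/(qalg_U A 0 *m delta_mx (enum_rank (qzero _ _ _ _ _ : B)) 0).
  rewrite nsq_unitary ?qalg_unitary//.
  rewrite /nsq (bigD1 (qzero _ _ _ _ _ : B)) // big1 => [|z /negPf zz].
    by rewrite /amp mxE !eqxx /sqnorm /= expr1n expr0n !addr0.
  by rewrite /amp mxE (inj_eq enum_rank_inj) zz /sqnorm /= expr0n addr0.
rewrite -[qrun G t.+1]/(qalg_U A t.+1 *m (qop (G t) *m qrun G t)).
by rewrite nsq_unitary ?qalg_unitary// nsq_qop.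
Qed.

Definition qdiff f g v : R := \sum_(z : B | f z.1.1 != g z.1.1) sqnorm (amp v z).

Lemma nsq_qdiff f g v : nsq (qop f *m v - qop g *m v) <= 4 * qdiff f g v.
Proof.
have ampE z : amp (qop f *m v - qop g *m v) z = amp v (qflip f z) - amp v (qflip g z).
  by rewrite -!amp_qop /amp !mxE.
have half h : \sum_(z : B | f z.1.1 != g z.1.1) sqnorm (amp v (qflip h z)) = qdiff f g v.
  rewrite /qdiff [RHS](reindex_inj (inv_inj (qflipK h))) /=.
  by apply: eq_bigl => z; rewrite qflip_reg.
apply: (@le_trans _ _ (\sum_(z : B | f z.1.1 != g z.1.1)
    (2 * sqnorm (amp v (qflip f z)) + 2 * sqnorm (amp v (qflip g z))))).
  rewrite [leRHS]big_mkcond; apply: ler_sum => z _; rewrite ampE.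
  case: ifPn => [_|/negPn/eqP e]; first exact: sqnorm_sub_le.
  by rewrite (eq_qflip e) subrr /sqnorm /= expr0n addr0.
rewrite big_split /= -!mulr_sumr !half; lra.
Qed.

(** The hybrid argument: changing the answer to one query costs [nsq_qdiff], and
    the later steps, being unitary, do not amplify this error. *)
Lemma qrun_diff f G t :
  nsq (qrun (fun=> f) t - qrun G t) <=
  t%:R * \sum_(s < t) 4 * qdiff f (G s) (qrun G s).
Proof.
elim: t => [|t IH].
  rewrite subrr mul0r /nsq big1// => z _.
  by rewrite /amp mxE /sqnorm /= expr0n addr0.
rewrite -[qrun _ t.+1]/(qalg_U A t.+1 *m (qop f *m qrun (fun=> f) t)).
rewrite -[qrun G t.+1]/(qalg_U A t.+1 *m (qop (G t) *m qrun G t)).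
rewrite -mulmxBr nsq_unitary ?qalg_unitary//.
set a := qrun (fun=> f) t; set b := qrun G t.
have -> : qop f *m a - qop (G t) *m b = qop f *m (a - b) + (qop f *m b - qop (G t) *m b).
  by rewrite mulmxBr addrA subrK.
set u := qop f *m (a - b); set v := qop f *m b - _.
have vle : nsq v <= 4 * qdiff f (G t) b := nsq_qdiff _ _ _.
have ule : nsq u <= t%:R * \sum_(s < t) 4 * qdiff f (G s) (qrun G s).
  by rewrite /u nsq_qop.
rewrite big_ord_recr /=; set S := \sum_(s < t) _ in ule *.
have [t0|t0] := posnP t.
  have u0 : u = 0 by rewrite /u /a /b t0 /= subrr mulmx0.
  have S0 : S = 0 by rewrite /S big1// => s; have := ltn_ord s; rewrite {2}t0.
  rewrite u0 add0r S0 add0r; apply: le_trans vle _; rewrite ler_peMl ?ler1n//.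
  by rewrite mulr_ge0// sumr_ge0// => z _; exact: sqnorm_ge0.
have tR : 0 < t%:R :> R by rewrite ltr0n.
have key : t%:R * nsq (u + v) <= (t%:R + 1) * nsq u + t%:R * (t%:R + 1) * nsq v.
  rewrite /nsq !mulr_sumr -big_split /=; apply: ler_sum => z _.
  have -> : amp (u + v) z = amp u z + amp v z by rewrite /amp mxE.
  by apply: sqnorm_add_le; exact: ltW.
rewrite -(ler_pM2l tR); apply: le_trans key _.
have h1 : (t%:R + 1) * nsq u <= (t%:R + 1) * (t%:R * S).
  by rewrite ler_wpM2l// addr_ge0.
have h2 : t%:R * (t%:R + 1) * nsq v <= t%:R * (t%:R + 1) * (4 * qdiff f (G t) b).
  by rewrite ler_wpM2l// mulr_ge0// addr_ge0.
rewrite -natr1; apply: le_trans (lerD h1 h2) _.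
by rewrite le_eqVlt; apply/orP; left; apply/eqP; ring.
Qed.

Lemma qprob_event_le O G (S : set 'rV[R]_n) (F : pred B) :
  (forall z, S (qalg_output z) -> F z) ->
  qprob_event A O S <=
    2 * \sum_(z | F z) sqnorm (amp (qrun G (qalg_queries A)) z) +
    2 * ((qalg_queries A)%:R *
      \sum_(s < qalg_queries A) 4 * qdiff (qtable O) (G s) (qrun G s)).
Proof.
move=> SF; set T := qalg_queries A.
have := qrun_diff (qtable O) G T; rewrite -qstateE; set e := qstate _ _ _ - _ => he.
apply: (@le_trans _ _ (\sum_(z | F z) (2 * sqnorm (amp (qrun G T) z) + 2 * sqnorm (amp e z)))).
  rewrite /qprob_event [leLHS]big_mkcond [leRHS]big_mkcond; apply: ler_sum => z _.
  have g0 : 0 <= 2 * sqnorm (amp (qrun G T) z) + 2 * sqnorm (amp e z).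
    by rewrite addr_ge0// mulr_ge0// sqnorm_ge0.
  case: asboolP => [/SF->|_]; last by case: ifP.
  have ampE : amp e z = amp (qstate A O T) z - amp (qrun G T) z.
    by rewrite /amp /e !mxE.
  rewrite -[leLHS]/(sqnorm (amp (qstate A O T) z)).
  have -> : amp (qstate A O T) z = amp (qrun G T) z + amp e z.
    by rewrite ampE addrC subrK.
  by have := sqnorm_add_le (amp (qrun G T) z) (amp e z) ler01; rewrite !mul1r.
rewrite big_split /= -[X in X + _ <= _]mulr_sumr -[X in _ + X <= _]mulr_sumr lerD2l ler_pM2l//.
apply: le_trans he.
rewrite /nsq [leRHS](bigID F)/= lerDl; apply: sumr_ge0 => z _; exact: sqnorm_ge0.
Qed.

Lemma qprob_event_le1 O S : qprob_event A O S <= 1.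
Proof.
rewrite -(nsq_qrun (fun=> qtable O) (qalg_queries A)) -qstateE /nsq /qprob_event.
by rewrite big_mkcond; apply: ler_sum => z _; case: ifP => // _; exact: sqnorm_ge0.
Qed.

End Amplitudes.

(** * Quantum algorithms on random frames *)

Section QuantumAverage.
Context {R : realType}.

Lemma sum_option (I : finType) (F : option I -> R) :
  \sum_o F o = F None + \sum_i F (Some i).
Proof.
rewrite (bigD1 None)//=; congr (_ + _).
rewrite (reindex_omap (@Some I) id) => [|[i|]]//=.
by apply: eq_bigl => i; rewrite eqxx.
Qed.

(** The integral of a nonnegative function is a supremum over the simple
    functions below it, which also makes sense for the success probability of a
    quantum algorithm before any measurability is established. *)
Lemma nonneg_integral_le d (T : measurableType d) (mu : {measure set T -> \bar R})
    (f g : T -> \bar R) : (forall x, 0 <= f x)%E -> (forall x, f x <= g x)%E ->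
  (\int[mu]_x f x <= \int[mu]_x g x)%E.
Proof.
move=> f0 fg; rewrite !ge0_integralE => [|x _|x _]//; last first.
  exact: le_trans (f0 x) (fg x).
rewrite !patch_setT; apply: le_ereal_sup => _ [h /= hf <-]; exists h => //= x.
exact: le_trans (hf x) (fg x).
Qed.

Lemma measurable_floor_eq d (T : measurableType d) (f : T -> R) (E : set int) :
  measurable_fun setT f -> measurable [set t | E (Num.floor (f t))].
Proof.
move=> mf.
have -> : [set t | E (Num.floor (f t))] = \bigcup_(m : nat)
    (if unpickle m is Some z then [set t | E z /\ (z%:~R <= f t < (z + 1)%:~R)] else set0).
  apply/seteqP; split=> t /=.
    move=> Ef; exists (pickle (Num.floor (f t))) => //.
    by rewrite pickleK; split => //; exact: floor_itv.
  move=> [m _]; case: unpickle => // z [Ez zf].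
  by rewrite /= (floor_def zf).
apply: bigcupT_measurable => m; case: unpickle => [z|]//.
have [Ez|nEz] := pselect (E z); last first.
  by rewrite (_ : [set t | _] = set0)//; apply/seteqP; split=> t // [].
rewrite (_ : [set t | _] = setT `&` f @^-1` [set` `[z%:~R, (z + 1)%:~R[]).
  by apply: mf => //; exact: measurable_itv.
by rewrite setTI; apply/seteqP; split=> t /=; rewrite in_itv => //= -[].
Qed.

Lemma measurable_encode d (T : measurableType d) (f : T -> R) m s (b : m.-tuple bool) :
  measurable_fun setT f -> measurable [set t | fixed_encode m s (f t) = b].
Proof.
move=> mf; apply: (@measurable_floor_eq _ _ (fun t => f t * 2 ^+ s)
  [set z | bits_of_nat m `|(z %% (2 ^ m)%N%:Z)%Z|%N = b]).
exact: measurable_funM.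
Qed.

Variables (c : R) (p n : nat).
Hypotheses (hc : 40 <= c) (hL : 40 <= ln (n%:R : R)) (k0 : (0 < dimk c n)%N).
Local Notation k := (dimk c n).
Local Notation T := (borel_mx R k n).
Local Notation gam := (gamma c n).
Variables (P : probability T R) (A : quantum_alg (R := R) n (jet_size n p)).
Hypothesis haarP : haar_frame P.
Local Notation B := (qalg_basis A).
Local Notation X := (n.-tuple ((qalg_in_bits A).-tuple bool)).
Local Notation Y := ((jet_size n p).-tuple ((qalg_out_bits A).-tuple bool)).
Local Notation Th := {ffun 'I_k.+1 * X -> Y}.

(** A finite datum that determines the hybrid run, so that averages over the frame
    become finite sums. *)
Let tau (V : T) : Th :=
  [ffun ix : 'I_k.+1 * X => qtable (A := A) (oracle p (g_upto p (V : 'M[R]_(k, n)) (nat_of_ord ix.1).+1)) ix.2].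

Let tauE (V : T) i x :
  tau V (i, x) = qtable (A := A) (oracle p (g_upto p (V : 'M[R]_(k, n)) (nat_of_ord i).+1)) x.
Proof. by rewrite ffunE. Qed.

Let answer (th : Th) (s : nat) (x : X) : Y := th (inord s, x).

Let measurable_tau (th : Th) : measurable [set V | tau V = th].
Proof.
have -> : [set V | tau V = th] = \bigcap_(a in [set: 'I_k.+1 * X * 'I_(jet_size n p)])
    [set V : T | fixed_encode (qalg_out_bits A) (qalg_out_frac A)
      (oracle p (g_upto p (V : 'M[R]_(k, n)) (nat_of_ord a.1.1).+1) (qpoint (A := A) a.1.2) 0 a.2)
      = tnth (th a.1) a.2].
  apply/seteqP; split=> V /=.
    by move=> <- [[i x] j] _ /=; rewrite ffunE tnth_mktuple.
  move=> h; apply/ffunP => -[i x]; rewrite ffunE /=; apply: eq_from_tnth => j.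
  by rewrite tnth_mktuple; exact: (h (i, x, j) I).
apply: fin_bigcap_measurable => // -[[i x] j] _ /=.
apply: measurable_encode; apply: measurable_entry.
apply: (@measurable_oracle _ _ T _ _ (fun V : T => g_upto p (V : 'M[R]_(k, n)) i.+1)).
- by move=> y; exact: measurable_g_upto.
- by move=> V; exact: Ck_g_upto.
- exact: measurable_cst.
Qed.

Let tail : R := 2 * expR (- ((gam * (24 / 100)) ^+ 2 * n%:R / 8)).

Let corr (x : 'rV[R]_n) (j : 'I_k) : set T :=
  [set V | l2norm x <= 1 /\ gam / 4 <= `|dot (row j (V : 'M[R]_(k, n))) x| ].

Let measurable_corr x j : measurable (corr x j).
Proof.
have [x1|x1] := boolP (l2norm x <= 1); last first.
  by rewrite (_ : corr x j = set0)//; apply/seteqP; split=> V // [h]; rewrite h in x1.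
rewrite (_ : corr x j = row_ge j x (gam / 4) `|` row_ge j (- x) (gam / 4)).
  by apply: measurableU; exact: (measurable_row_ge (dim_le hc hL k0) k0).
apply/seteqP; split=> V; rewrite /corr /row_ge /= dotNr.
  by move=> [_]; rewrite ler_normr => /orP.
by move=> h; split => //; rewrite ler_normr; apply/orP.
Qed.

Let kk r : (r < k)%N -> (r * 2 <= n)%N.
Proof.
by move=> rk; apply: leq_trans (double_dim_le hc hL k0); rewrite leq_mul2r ltnW.
Qed.

Let corr_tail x (j : 'I_k) r (D : set T) : (r <= j)%N -> measurable D ->
  (P (corr x j `&` first_rows r D) <= tail%:E * P (first_rows r D))%E.
Proof.
move=> rj mD; have rk : (r < k)%N := leq_ltn_trans rj (ltn_ord j).
have g0 := gamma_gt0 hc hL; have kn := dim_le hc hL k0.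
have mf := measurable_first_rows (k := k) (n := n) r mD.
have [x1|x1] := boolP (l2norm x <= 1); last first.
  rewrite (_ : corr x j = set0); first by rewrite set0I measure0 mule_ge0// lee_fin mulr_ge0 ?expR_ge0.
  by apply/seteqP; split=> V // [h]; rewrite h in x1.
have s0 : 0 <= gam * (24 / 100) by rewrite mulr_ge0// ltW.
apply: le_trans (row_tail kn haarP rk rj x1 s0 (kk rk) mD).
apply: le_measure; rewrite ?inE.
- by apply: measurableI.
- by apply: measurableI => //; apply: measurableU; exact: (measurable_row_ge (dim_le hc hL k0) k0).
move=> V [[_ h] DV]; split => //; rewrite /row_ge /= dotNr.
have : gam * (24 / 100) <= `|dot (row j V) x| by apply: le_trans h; lra.
by rewrite ler_normr => /orP.
Qed.

Let integral_steps (I : finType) (a : I -> R) (E : I -> set T) :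
  (forall i, 0 <= a i) -> (forall i, measurable (E i)) ->
  (\int[P]_V (\sum_i a i * \1_(E i) V)%:E = \sum_i (a i)%:E * P (E i))%E.
Proof.
move=> a0 mE; under eq_integral do rewrite -sumEFin.
rewrite ge0_integral_sum//=.
- apply: eq_bigr => i _; under eq_integral do rewrite EFinM.
  rewrite ge0_integralZl//; first by rewrite integral_indic// setIT.
  - by apply/measurable_EFinP; exact: measurable_indic.
  - by rewrite lee_fin.
- move=> i; apply/measurable_EFinP; apply: measurable_funM => //; exact: measurable_indic.
- by move=> i V _; rewrite lee_fin mulr_ge0.
Qed.

Let known r (V : T) : Th := tau (pid_mx r *m (V : 'M[R]_(k, n))).

Let level r th : set T := first_rows r [set V : T | tau V = th].

Let measurable_level r th : measurable (level r th).
Proof. by apply: measurable_first_rows; exact: measurable_tau. Qed.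

Let weightE r (w : Th -> R) V : w (known r V) = \sum_th w th * \1_(level r th) V.
Proof.
rewrite (bigD1 (known r V))//= big1 => [|th /eqP thV].
  by rewrite indicE mem_set// mulr1 addr0.
by rewrite indicE memNset ?mulr0// => h; apply: thV; rewrite -h.
Qed.

Let measurable_weight r (w : Th -> R) : measurable_fun setT (fun V => w (known r V)).
Proof.
rewrite (_ : (fun V => _) = fun V => \sum_th w th * \1_(level r th) V).
  apply: measurable_sum => th; apply: measurable_funM => //; exact: measurable_indic.
by apply/funext => V; exact: weightE.
Qed.

(** Conditionally on the first [r] rows, hence on the amplitudes, a fixed point
    rarely correlates with a later row. *)
Let weight_tail x (j : 'I_k) r (w : Th -> R) : (r <= j)%N -> (forall th, 0 <= w th) ->
  (\int[P]_V (\1_(corr x j) V * w (known r V))%:E <=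
   tail%:E * \int[P]_V (w (known r V))%:E)%E.
Proof.
move=> rj w0.
have cwE (V : T) : \1_(corr x j) V * w (known r V) =
    \sum_th w th * \1_(corr x j `&` level r th) V.
  by rewrite weightE mulr_sumr; apply: eq_bigr => th _; rewrite indicI /= mulrCA.
under eq_integral do rewrite cwE.
under [X in (_ <= _ * X)%E]eq_integral do rewrite weightE.
rewrite (integral_steps w0); last first.
  by move=> th; apply: measurableI; [exact: measurable_corr|exact: measurable_level].
rewrite (integral_steps w0 (measurable_level r)).
rewrite ge0_sume_distrr; last first.
  by move=> th _; apply: mule_ge0; [rewrite lee_fin; exact: w0|exact: measure_ge0].
apply: lee_sum => th _; rewrite muleCA; apply: lee_wpmul2l; first by rewrite lee_fin; exact: w0.
exact: corr_tail rj (measurable_tau th).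
Qed.

Let weight r th z : R := sqnorm (amp (qrun (answer th) r : 'cV_#|{: B}|) z).

Let weight_ge0 r th z : 0 <= weight r th z. Proof. exact: sqnorm_ge0. Qed.

(** The point [pt z] is the one that is queried, or the one that is output. *)
Let bad_weight (pt : B -> 'rV[R]_n) (j : 'I_k) r (V : T) : R :=
  \sum_z \1_(corr (pt z) j) V * weight r (known r V) z.

Let bad_weight_ge0 pt j r V : 0 <= bad_weight pt j r V.
Proof. by apply: sumr_ge0 => z _; rewrite mulr_ge0. Qed.

Let measurable_bad_weight pt j r : measurable_fun setT (bad_weight pt j r).
Proof.
apply: measurable_sum => z; apply: measurable_funM; first exact: measurable_indic.
exact: (measurable_weight r (fun th => weight r th z)).
Qed.

Let bad_weight_tail pt (j : 'I_k) r : (r <= j)%N ->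
  (\int[P]_V (bad_weight pt j r V)%:E <= tail%:E)%E.
Proof.
move=> rj; under eq_integral do rewrite /bad_weight -sumEFin.
have mw z : measurable_fun setT (fun V => weight r (known r V) z).
  exact: (measurable_weight r (fun th => weight r th z)).
rewrite ge0_integral_sum//=; last 2 first.
- move=> z; apply/measurable_EFinP; apply: measurable_funM => //; exact: measurable_indic.
- by move=> z V _; rewrite lee_fin mulr_ge0.
apply: (@le_trans _ _ (\sum_z tail%:E * \int[P]_V (weight r (known r V) z)%:E)%E).
  apply: lee_sum => z _.
  exact: (weight_tail (pt z) (w := fun th => weight r th z) rj (fun th => weight_ge0 r th z)).
rewrite -ge0_sume_distrr; last first.
  by move=> z _; apply: integral_ge0 => V _; rewrite lee_fin.
rewrite -ge0_integral_sum//; last 2 first.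
- by move=> z; apply/measurable_EFinP.
- by move=> z V _; rewrite lee_fin.
rewrite (eq_integral (cst 1%E)) => [|V _]; last first.
  by rewrite sumEFin -[X in X%:E]/(nsq _) nsq_qrun.
rewrite integral_cst// mul1e -[leRHS]mule1 lee_wpmul2l ?probability_le1//.
by rewrite lee_fin mulr_ge0// expR_ge0.
Qed.

Hypothesis queries_lt : (qalg_queries A < k)%N.
Let q := qalg_queries A.

Let success (V : T) : R := qprob_event A (oracle p (g_fun p (V : 'M[R]_(k, n))))
  (eps_optimal (g_fun p (V : 'M[R]_(k, n))) (epsilon c n)).

Let known_answer r (V : T) i : (r < k)%N -> (i < r)%N ->
  answer (known r V) i = answer (tau V) i.
Proof.
move=> rk ir; apply/funext => x; rewrite /answer [LHS]tauE [RHS]tauE.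
have ik : (i < k.+1)%N by rewrite ltnS (leq_trans (ltnW ir) (ltnW rk)).
rewrite (inordK ik); congr (qtable (oracle p _) x).
by apply: g_upto_first_rows => //; rewrite ir.
Qed.

Let lastP : (k.-1 < k)%N. Proof. by rewrite prednK. Qed.
Let last := Ordinal lastP.

Let coef (o : option ('I_q * 'I_k)) : R :=
  if o is Some (s, j) then (if (s <= j)%N then 8 * q%:R else 0) else 2.

Let part (o : option ('I_q * 'I_k)) (V : T) : R :=
  if o is Some (s, j) then bad_weight (fun z => qpoint z.1.1) j s V
  else bad_weight (@qalg_output _ _ _ A) last q V.

(** A successful output correlates with the last row, and a query that the
    hybrid answers wrongly correlates with a row that the hybrid does not know yet. *)
Let success_le (V : T) : V *m V^T = 1%:M -> success V <= \sum_o coef o * part o V.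
Proof.
move=> VV; have g0 := gamma_gt0 hc hL.
have runE s : (s < k)%N -> qrun (A := A) (answer (tau V)) s = qrun (answer (known s V)) s.
  by move=> sk; apply: eq_qrun => i si; exact: esym (known_answer V sk si).
pose F := [pred z : B | `[<corr (qalg_output z) last V>]].
have hF z : eps_optimal (g_fun p (V : 'M[R]_(k, n))) (epsilon c n) (qalg_output z) -> F z.
  move=> opt; apply/asboolP; have [x1 _] := opt; split => //.
  have := eps_optimal_dot hc hL k0 VV (j := last) (prednK k0) opt.
  by rewrite -ltrN2 opprK => h; apply: le_trans (ltW h) _; rewrite -normrN ler_norm.
have := @qprob_event_le _ _ _ A (oracle p (g_fun p (V : 'M[R]_(k, n)))) (answer (tau V))
  _ F hF.
rewrite -/(success V) -/q => /le_trans; apply.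
rewrite sum_option /=; apply: lerD.
  rewrite ler_pM2l// /bad_weight big_mkcond; apply: ler_sum => z _.
  rewrite runE// /weight indicE.
  rewrite [X in if X then _ else _](_ : _ = (V \in corr (qalg_output z) last))//.
  by case: (V \in _); rewrite ?mul1r ?mul0r.
rewrite (eq_bigr (fun sj : 'I_q * 'I_k =>
  coef (Some (sj.1, sj.2)) * part (Some (sj.1, sj.2)) V)) => [|[s j] _]//.
rewrite -(pair_bigA _ (fun s j => coef (Some (s, j)) * part (Some (s, j)) V)) /=.
rewrite mulrA mulr_sumr; apply: ler_sum => s _.
have sk : (s < k)%N := ltn_trans (ltn_ord s) queries_lt.
rewrite (mulrCA _ 4).
apply: (@le_trans _ _ (8 * q%:R * qdiff (qtable (oracle p (g_fun p (V : 'M[R]_(k, n)))))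
    (answer (tau V) s) (qrun (A := A) (answer (tau V)) s))).
  by rewrite !mulrA le_eqVlt; apply/orP; left; apply/eqP; congr (_ * _); ring.
rewrite (bigID (fun j : 'I_k => s <= j)%N) /= [X in _ + X]big1 ?addr0 => [|j /negPf sj]; last first.
  by rewrite sj mul0r.
rewrite (eq_bigr (fun j => 8 * q%:R * bad_weight (fun z => qpoint z.1.1) j s V)) => [|j sj]; last first.
  by rewrite sj.
rewrite -mulr_sumr; apply: ler_wpM2l; first by rewrite mulr_ge0.
rewrite /qdiff /bad_weight exchange_big /= big_mkcond; apply: ler_sum => z _.
have w0 j : 0 <= \1_(corr (qpoint z.1.1) j) V * weight s (known s V) z by rewrite mulr_ge0.
case: ifPn => [diff|_]; last exact: sumr_ge0.
have [j sj hj] : exists2 j : 'I_k, (s <= j)%N & corr (qpoint (A := A) z.1.1) j V.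
  apply: contrapT => nex; move/eqP: diff; apply; apply: eq_from_tnth => a.
  have sk1 : (s < k.+1)%N by rewrite ltnS ltnW.
  rewrite /answer tauE (inordK sk1) !tnth_mktuple; congr (fixed_encode _ _ (_ 0 a)).
  rewrite /oracle; case: ifP => // x1.
  have V1 j : l2norm (row j (V : 'M[R]_(k, n))) <= 1 by rewrite l2norm_row.
  have jE : jet p (g_fun p (V : 'M[R]_(k, n))) (qpoint (A := A) z.1.1) =
      jet p (g_upto p (V : 'M[R]_(k, n)) s.+1) (qpoint (A := A) z.1.1).
    apply: (jet_g_upto p hc hL k0 V1 sk) => j sj.
    rewrite leNgt; apply/negP => bad; apply: nex; exists j => //; split => //.
    exact: ltW.
  by rewrite jE.
rewrite (bigD1 j)//= indicE mem_set// mul1r runE// lerDl.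
exact: sumr_ge0.
Qed.

Lemma quantum_success :
  (\int[P]_V (success V)%:E <= ((2 + 8 * q%:R * q%:R * k%:R) * tail)%:E)%E.
Proof.
have mF := @measurable_frames R k n.
have nonframes : P (~` [set V : 'M[R]_(k, n) | V *m V^T = 1%:M]) = 0%E.
  by rewrite probability_setC//; have [-> _] := haarP; rewrite subee.
have part0 o V : 0 <= part o V by case: o => [[s j]|]; exact: bad_weight_ge0.
have coef0 o : 0 <= coef o by case: o => [[s j]|] //=; case: ifP => // _; rewrite mulr_ge0.
have mpart o : measurable_fun setT (part o).
  by case: o => [[s j]|]; exact: measurable_bad_weight.
have tail0 : 0 <= tail by rewrite mulr_ge0// expR_ge0.
(* The success probability is at most 1 on the null set of the non-frames. *)
have bound V : success V <= \sum_o coef o * part o V +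
    \1_(~` [set V : 'M[R]_(k, n) | V *m V^T = 1%:M]) V.
  have [VV|nVV] := pselect (V *m V^T = 1%:M :> 'M[R]_k).
    by apply: le_trans (success_le VV) _; rewrite lerDl.
  apply: (@le_trans _ _ 1); first exact: qprob_event_le1.
  by rewrite indicE mem_set// lerDr; apply: sumr_ge0 => o _; rewrite mulr_ge0.
apply: (@le_trans _ _ (\int[P]_V (\sum_o coef o * part o V +
    \1_(~` [set V : 'M[R]_(k, n) | V *m V^T = 1%:M]) V)%:E)%E).
  apply: nonneg_integral_le => V; rewrite lee_fin//.
  apply: sumr_ge0 => z _; exact: sqnorm_ge0.
under eq_integral do rewrite EFinD -sumEFin.
rewrite ge0_integralD//; last 3 first.
- by move=> V _; apply: sume_ge0 => o _; rewrite lee_fin mulr_ge0.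
- apply: emeasurable_sum => o; apply/measurable_EFinP; exact: measurable_funM.
- by apply/measurable_EFinP; apply: measurable_indic; exact: measurableC.
rewrite integral_indic//; last exact: measurableC.
rewrite [X in (_ + X <= _)%E](_ : _ = 0%E) ?adde0; last by rewrite setIT; exact: nonframes.
rewrite ge0_integral_sum//; last 2 first.
- by move=> o; apply/measurable_EFinP; exact: measurable_funM.
- by move=> o V _; rewrite lee_fin mulr_ge0.
apply: (@le_trans _ _ (\sum_o (coef o * tail)%:E)%E).
  apply: lee_sum => o _; under eq_integral do rewrite EFinM.
  rewrite ge0_integralZl//; last 3 first.
  - exact/measurable_EFinP.
  - by move=> V _; rewrite lee_fin.
  - by rewrite lee_fin.
  rewrite EFinM; case: o => [[s j]|] /=; last first.
    by rewrite lee_wpmul2l ?lee_fin// bad_weight_tail// /last /= -ltnS prednK.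
  case: ifP => [sj|_]; last by rewrite !mul0e.
  by rewrite lee_wpmul2l ?lee_fin ?mulr_ge0// bad_weight_tail.
rewrite sumEFin lee_fin -mulr_suml ler_wpM2r//.
rewrite sum_option /= lerD2l (eq_bigr (fun sj : 'I_q * 'I_k => coef (Some sj))) => [|[s j] _]//.
apply: (@le_trans _ _ (\sum_(sj : 'I_q * 'I_k) 8 * q%:R)).
  by apply: ler_sum => -[s j] _ /=; case: ifP => // _; rewrite mulr_ge0.
by rewrite sumr_const card_prod !card_ord -[leLHS]mulr_natr natrM mulrA.
Qed.

End QuantumAverage.

(** * Large dimensions *)

Section Asymptotics.
Context {R : realType}.

(** Here [72 / 10000 = (24 / 100) ^ 2 / 8], and [gamma ^ 2 * n = c ^ 2 * ln n]. *)
Lemma tail_le (c : R) n D : 40 <= c -> 40 <= ln (n%:R : R) ->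
  D%:R <= 72 / 10000 * c ^+ 2 ->
  2 * expR (- ((gamma c n * (24 / 100)) ^+ 2 * n%:R / 8)) <= 2 * n%:R ^- D.
Proof.
move=> hc hL hD; have n0 : 0 < n%:R :> R by rewrite ltr0n (dim_gt0 hL).
have L0 : 0 <= ln (n%:R : R) by lra.
rewrite ler_pM2l//.
have -> : (gamma c n * (24 / 100)) ^+ 2 * n%:R / 8 = 72 / 10000 * c ^+ 2 * ln n%:R.
  rewrite /gamma !exprMn sqr_sqrtr ?divr_ge0 ?(ltW n0)//.
  by field; rewrite gt_eqF.
have -> : n%:R ^- D = expR (- (D%:R * ln n%:R)) :> R.
  by rewrite expRN mulrC expRM_natr lnK ?posrE.
by rewrite ler_expR lerN2 ler_wpM2r.
Qed.

Lemma near_ln : \forall n \near \oo, 40 <= ln (n%:R : R).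
Proof.
near=> n; have h : expR 40 <= n%:R :> R by near: n; exact: nbhs_infty_ger.
rewrite -[40]expRK ler_ln ?posrE ?expR_gt0//.
exact: lt_le_trans (expR_gt0 _) h.
Unshelve. all: by end_near. Qed.

Lemma ln_ge_dim n : 40 <= ln (n%:R : R) -> (40 < n)%N.
Proof.
move=> hL; have n0 : 0 < n%:R :> R by rewrite ltr0n (dim_gt0 hL).
by rewrite -(ltr_nat R) (le_lt_trans hL)// ln_sublinear.
Qed.

(** There are fewer than [k ^ 2 * K] pairs of a query and a row, each bad with
    probability at most [2 * n ^- (D + 2)], and [k <= n]. *)
Lemma parallel_lower (c : R) p D (K : nat -> nat) : 40 <= c ->
  D.+2%:R <= 72 / 10000 * c ^+ 2 ->
  (fun n : nat => (K n)%:R * n%:R ^- D : R) @ \oo --> (0 : R) ->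
  parallel_lower_bound c p K.
Proof.
move=> hc hD hK delta delta0; have d8 : 0 < delta / 8 by rewrite divr_gt0.
near=> n => P haarP d W Q A hA.
have hL : 40 <= ln (n%:R : R) by near: n; exact: near_ln.
have Kn : (K n)%:R * n%:R ^- D <= delta / 8 :> R.
  have : `|0 - (K n)%:R * n%:R ^- D| < delta / 8 :> R.
    by near: n; move/cvgrPdist_lt: hK; apply.
  by rewrite sub0r normrN => /ltW; apply: le_trans; exact: ler_norm.
have nd : (delta / 8)^-1 <= n%:R :> R by near: n; exact: nbhs_infty_ger.
have k0 : (0 < dimk c n)%N by exact: leq_ltn_trans hA.
have n0 : 0 < n%:R :> R by rewrite ltr0n (dim_gt0 hL).
apply: le_trans (parallel_success hc hL k0 Q haarP hA) _; rewrite lee_fin.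
apply: (@le_trans _ _ (((n * n * K n).+1)%:R * (2 * n%:R ^- D.+2))).
  apply: ler_pM; [by []|by rewrite mulr_ge0// expR_ge0| |exact: tail_le].
  rewrite ler_nat ltnS mulnAC; apply: leq_mul => //; apply: leq_mul; last exact: dim_le.
  exact: leq_trans (ltnW hA) (dim_le hc hL k0).
have D0 : 0 < n%:R ^- D :> R by rewrite invr_gt0 exprn_gt0.
have E : (n%:R : R) ^- D.+2 = n%:R ^- D / (n%:R * n%:R).
  by rewrite -addn2 exprD invfM expr2.
have D1 : n%:R ^- D <= 1 :> R.
  by rewrite invf_le1 ?exprn_gt0// exprn_ege1// ler1n (dim_gt0 hL).
have h1 : n%:R ^- D.+2 <= delta / 8 :> R.
  rewrite E ler_pdivrMr ?mulr_gt0//; apply: le_trans D1 _.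
  rewrite mulrA; apply: (@le_trans _ _ (delta / 8 * n%:R)).
    by rewrite -ler_pdivrMl// mulr1.
  have n1 : 1 <= n%:R :> R by rewrite ler1n (dim_gt0 hL).
  by rewrite ler_peMr// mulr_ge0// ltW.
have -> : (n * n * K n).+1%:R * (2 * n%:R ^- D.+2) =
    2 * ((K n)%:R * n%:R ^- D) + 2 * n%:R ^- D.+2 :> R.
  rewrite -natr1 !natrM E; set y := n%:R ^- D; set x := n%:R in n0 *.
  by field; rewrite gt_eqF.
lra.
Unshelve. all: by end_near. Qed.

Lemma poly_nat_le (q : {poly nat}) n :
  (q.[n] * n <= (\sum_(i < size q) (q`_i)%R) * n ^ size q)%N.
Proof.
have [->|n0] := posnP n; first by rewrite muln0.
rewrite horner_coef.
have expE i : (n ^+ i)%R = (n ^ i)%N by elim: i => // i IH; rewrite exprS IH expnS.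
rewrite [X in (X * n)%N](_ : _ = (\sum_(i < size q) (q`_i)%R * n ^ i)%N); last first.
  by apply: eq_bigr => i _; rewrite expE.
rewrite !big_distrl /=; apply: leq_sum => i _.
by rewrite -mulnA leq_mul2l -expnSr leq_pexp2l ?orbT.
Qed.

Lemma poly_nat_cvg (q : {poly nat}) :
  (fun n : nat => (q.[n])%:R * n%:R ^- size q : R) @ \oo --> (0 : R).
Proof.
apply/cvgrPdist_lt => e e0; near=> n.
pose M := (\sum_(i < size q) (q`_i)%R)%N.
have n0 : (0 < n)%N by near: n; exact: nbhs_infty_gt.
have nR : 0 < n%:R :> R by rewrite ltr0n.
have hM : (M%:R + 1) / e <= n%:R :> R by near: n; exact: nbhs_infty_ger.
rewrite sub0r normrN ger0_norm; last by rewrite mulr_ge0// invr_ge0 exprn_ge0// ltW.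
rewrite ltr_pdivrMr ?exprn_gt0// -(ltr_pM2r nR).
apply: (@le_lt_trans _ _ (M%:R * n%:R ^+ size q)).
  by rewrite -natrX -!natrM ler_nat poly_nat_le.
rewrite mulrAC ltr_pM2r ?exprn_gt0//.
by move: hM; rewrite ler_pdivrMr// mulrC; apply: lt_le_trans; rewrite ltrDl.
Unshelve. all: by end_near. Qed.

End Asymptotics.

Theorem corollary2 (R : realType) (p : nat) (hp : (0 < p)%N) :
  (forall K : nat -> nat,
     (fun n : nat => (K n)%:R * n%:R ^- 9 : R) @ \oo --> (0 : R) ->
     parallel_lower_bound (40 : R) p K)
  /\
  (forall q : {poly nat}, exists c : R, 0 < c /\
     parallel_lower_bound c p (fun n : nat => q.[n]))
  /\
  (\forall n \near \oo,
     forall P : probability (borel_mx R (dimk (40 : R) n) n) R, haar_frame P ->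
     forall A : quantum_alg (R := R) n (jet_size n p),
     (qalg_queries A < dimk (40 : R) n)%N ->
     (\int[P]_V (qprob_event A
          (oracle p (g_fun p (V : 'M[R]_(dimk (40 : R) n, n))))
          (eps_optimal (g_fun p (V : 'M[R]_(dimk (40 : R) n, n)))
             (epsilon (40 : R) n)))%:E
      <= (n%:R ^- 4)%:E)%E).
Proof.
split; [|split].
(* For [c = 40] the exponent of the tail is [11.52], and [9 + 2] is needed. *)
- move=> K hK; apply: parallel_lower hK => //; lra.
- move=> q; pose D := size q; exists (40 + 200 * D.+2%:R).
  have D0 : (1 : R) <= D.+2%:R by rewrite ler1n.
  split; first lra.
  apply: (@parallel_lower R _ p D); [lra| |exact: poly_nat_cvg].
  nra.
near=> n => P haarP A hA.
have hc : (40 : R) <= 40 by [].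
have hL : 40 <= ln (n%:R : R) by near: n; exact: near_ln.
have k0 : (0 < dimk (40 : R) n)%N by exact: leq_ltn_trans hA.
have n0 : 0 < n%:R :> R by rewrite ltr0n (dim_gt0 hL).
have n40 : 40 <= n%:R :> R by rewrite ler_nat ltnW// (ln_ge_dim hL).
apply: le_trans (quantum_success hc hL k0 haarP hA) _; rewrite lee_fin.
set q := qalg_queries A; set k := dimk (40 : R) n.
have kn : (k%:R : R) <= n%:R by rewrite ler_nat dim_le.
have qn : (q%:R : R) <= n%:R by apply: le_trans kn; rewrite ler_nat ltnW.
apply: (@le_trans _ _ ((2 + 8 * n%:R * n%:R * n%:R) * (2 * n%:R ^- 11))).
  apply: ler_pM; first by rewrite addr_ge0// !mulr_ge0.
  - by rewrite mulr_ge0// expR_ge0.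
  - by rewrite lerD2l ler_pM ?mulr_ge0// ler_pM ?mulr_ge0// ler_wpM2l.
  by apply: tail_le => //; lra.
have -> : (n%:R : R) ^- 11 = n%:R ^- 4 / n%:R ^+ 7 by rewrite -invfM -exprD.
rewrite mulrA mulrCA ger_pMr ?invr_gt0 ?exprn_gt0//.
rewrite ler_pdivrMr ?exprn_gt0// mul1r.
set x := n%:R in n40 *.
have x1 : 1 <= x by lra.
have x3 : 40 <= x ^+ 3.
  by apply: le_trans n40 _; rewrite exprS ler_peMr ?exprn_ege1//; lra.
have -> : x ^+ 7 = x ^+ 3 * (x * x ^+ 3) by ring.
have -> : 8 * x * x * x = 8 * x ^+ 3 by ring.
have x4 : 40 * 1 <= x * x ^+ 3 by apply: ler_pM => //; lra.
have : x ^+ 3 * 40 <= x ^+ 3 * (x * x ^+ 3) by rewrite ler_wpM2l//; lra.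
lra.
Unshelve. all: by end_near. Qed.
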